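(* Consider the setting, the data and the family of analytic solutions $(u_p(t,z,\epsilon))_{0\le p\le\varsigma-1}$ described in the context, and let $0<\beta'<\beta$. Let $p\in\{0,\ldots,\varsigma-1\}$ and assume that the infinite sectors $U_{\mathfrak{d}_p}$ and $U_{\mathfrak{d}_{p+1}}$ have nonempty intersection. Then the following statements hold. (1) There exist $K_1>0$ and $K_2\in\mathbb{R}$ such that $$|u_{p+1}(t,z,\epsilon)-u_p(t,z,\epsilon)|\le K_1\exp\left(-\frac{k_2}{2\log(q)}\log^2|\epsilon t|\right)|\epsilon t|^{K_2}$$ for every $t\in\mathcal{T}$, $z\in H_{\beta'}$ and $\epsilon\in\mathcal{E}_p\cap\mathcal{E}_{p+1}$. (2) There exist $K_1>0$ and $K_2\in\mathbb{R}$ such that $$|u_{p+1}(t,z,\epsilon)-u_p(t,z,\epsilon)|\le K_1q^{\frac{K_2^2}{2k_2}}\left(q^{-\frac{K_2}{k_2}}\right)^Nq^{\frac{N^2}{2k_2}}|\epsilon t|^N$$ for every $t\in\mathcal{T}$, $z\in H_{\beta'}$, $\epsilon\in\mathcal{E}_p\cap\mathcal{E}_{p+1}$ and all integers $N\ge0$.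
   Context: Notation. $D(z_0,r)$ is the open disc, $\overline{D}(z_0,r)$ its closure, $\mathbb{C}^\star=\mathbb{C}\setminus\{0\}$, $H_b=\{z\in\mathbb{C}:|\mathrm{Im}(z)|<b\}$. For $q>1$ and $\delta>0$, $\sigma_{q,t}^{\delta}(f)(t)=f(q^{\delta}t)$ and $\sigma_{q,t}=\sigma_{q,t}^1$. $\mathcal{O}(V)$ is the set of holomorphic functions on an open set $V\subseteq\mathbb{C}^h$. For continuous $f:\mathbb{R}\to\mathbb{C}$ with $|f(m)|\le C(1+|m|)^{-\mu}e^{-\beta|m|}$, $\mathcal{F}^{-1}(f)(x)=\frac{1}{\sqrt{2\pi}}\int_{-\infty}^\infty f(m)e^{ixm}dm$, which extends holomorphically to $H_\beta$. Jacobi Theta function of order $k>0$: $\Theta_{q^{1/k}}(z)=\sum_{n\in\mathbb{Z}}q^{-\frac{n(n-1)}{2k}}z^n$, $z\in\mathbb{C}^\star$. $q$-Laplace transform of order $k$ along direction $d$: $\mathcal{L}_{q;1/k}^{d}(f(u))(T)=\frac{k}{\log(q)}\int_{L_{d}}\frac{f(u)}{\Theta_{q^{1/k}}(u/T)}\frac{du}{u}$, $L_d=[0,\infty)e^{\sqrt{-1}d}$. The equation. Let $q>1$, $1\le k_1<k_2$ real, $\frac1\kappa=\frac1{k_1}-\frac1{k_2}$; $D,D_1,D_2\ge3$ integers, $d_{D_1},d_{D_2}$ positive integers; for $1\le j\le D-1$, $\Delta_j\ge0$ and $d_j,\delta_j\ge1$ integers with $\delta_1=1$, $\delta_j<\delta_{j+1}$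 ($1\le j\le D-2$). Assume for $1\le j\le D-1$: $\Delta_j\ge d_j$, $\frac{d_{D_1}-1}{\kappa}+\frac{d_j}{k_2}+1\ge\delta_j$, $\frac{d_j}{k_1}+1\ge\delta_j$, $\frac{d_{D_2}-1}{k_2}\ge\delta_j-1$; and $k_1(d_{D_2}-1)>k_2d_{D_1}$. Let $\mu>0$ and $Q,R_1,\dots,R_{D-1},R_{D_1},R_{D_2}\in\mathbb{C}[X]$ with $\mu>\deg(R_{D_j})+1$, $Q(im)\ne0$, $R_{D_j}(im)\neq0$ for $m\in\mathbb{R}$, $j=1,2$, and $\deg Q\ge\deg R_{D_1}=\deg R_{D_2}\ge\max_{1\le\ell\le D-1}\deg R_\ell$. The equation is $$Q(\partial_z)\sigma_{q,t}u=\sum_{j=1}^{2}(\epsilon t)^{d_{D_j}}\sigma_{q,t}^{\frac{d_{D_j}}{k_j}+1}R_{D_j}(\partial_z)u+\sum_{\ell=1}^{D-1}\epsilon^{\Delta_{\ell}}t^{d_{\ell}}\sigma_{q,t}^{\delta_{\ell}}\big(c_{\ell}(t,z,\epsilon)R_{\ell}(\partial_z)u\big)+\sigma_{q,t}f(t,z,\epsilon)\qquad(E)$$ for $u=u(t,z,\epsilon)$. Let $\beta>0$, $0<\epsilon_0<1$, $T_0>0$. Here $c_\ell(t,z,\epsilon)=\mathcal{F}^{-1}(m\mapsto\sum_{n\ge0}C_{\ell,n}(m,\epsilon)(\epsilon t)^n)(z)$, $f(t,z,\epsilon)=\mathcal{F}^{-1}(m\mapsto\sum_{n\ge0}F_n(m,\epsilon)(\epsilon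 t)^n)(z)$, with $C_{\ell,n},F_n$ continuous in $m\in\mathbb{R}$, holomorphic in $\epsilon\in D(0,\epsilon_0)$, and for all $m\in\mathbb{R}$, $n\ge0$: $\sup_{\epsilon\in D(0,\epsilon_0)}|C_{\ell,n}(m,\epsilon)|\le\Delta_{C,\ell}T_0^{-n}q^{-\frac{n^2\kappa}{2k_1k_2}}(1+|m|)^{-\mu}e^{-\beta|m|}$, $\sup_{\epsilon\in D(0,\epsilon_0)}|F_n(m,\epsilon)|\le\Delta_FT_0^{-n}(1+|m|)^{-\mu}e^{-\beta|m|}$, for constants $\Delta_{C,\ell},\Delta_F>0$. Geometry. $\varsigma\ge2$ is an integer and $(\mathcal{E}_p)_{0\le p\le\varsigma-1}$ is a good covering in $\mathbb{C}^\star$: each $\mathcal{E}_p$ is an open sector of positive radius with vertex at $0$, $\mathcal{E}_j\cap\mathcal{E}_k\ne\emptyset$ iff $|j-k|\le1$ (convention $\mathcal{E}_\varsigma:=\mathcal{E}_0$), and $\bigcup_p\mathcal{E}_p=\mathcal{U}\setminus\{0\}$ for some neighborhood $\mathcal{U}$ of $0$; also $\mathcal{E}_p\subseteq D(0,\epsilon_0)$. All indices $p+1$ are read with index $\varsigma$ identified with $0$. Let $\alpha,\nu\in\mathbb{R}$, $\nu<1/2$, and let $\mathcal{T}\subseteq D(0,r_{\mathcal{T}})$, $0<r_{\mathcal{T}}<1$, be an open bounded sector with vertex at $0$ such that $\nu+\frac{k_2}{\log q}\log(r_{\mathcal{T}})<0$, $\alpha+\frac{\kappa}{\log q}\log(\epsilon_0r_{\mathcal{T}})<0$,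 $\epsilon_0r_{\mathcal{T}}\le q^{(\frac12-\nu)/k_2}/2$. For directions $\mathfrak{d}_p\in\mathbb{R}$ and fixed $0<\tilde\delta<1$ put $\mathcal{R}_{\mathfrak{d}_p,\tilde\delta}=\{T\in\mathbb{C}^\star:|1+\frac{re^{i\mathfrak{d}_p}}{T}|>\tilde\delta\text{ for all }r\ge0\}$, $\mathcal{R}^b_{\mathfrak{d}_p}=\mathcal{R}_{\mathfrak{d}_p,\tilde\delta}\cap D(0,\epsilon_0r_{\mathcal{T}})$. For $j=1,2$, $Q(im)/R_{D_j}(im)$ ($m\in\mathbb{R}$) takes values in an unbounded sector $S_{Q,R_{D_j}}=\{z:|z|\ge r_{Q,R_{D_j}},|\arg(z)-d_{Q,R_{D_j}}|\le\nu_{Q,R_{D_j}}\}$ with $r_{Q,R_{D_j}},\nu_{Q,R_{D_j}}>0$; let $q_{\ell,j}(m)$, $0\le\ell\le d_{D_j}-1$, be the roots of $P_{m,j}(\tau)=\frac{Q(im)}{(q^{1/k_j})^{k_j(k_j-1)/2}}-\frac{R_{D_j}(im)}{(q^{1/k_j})^{(d_{D_j}+k_j)(d_{D_j}+k_j-1)/2}}\tau^{d_{D_j}}$. The number $\rho>0$, the directions $\mathfrak{d}_p$ and the infinite sectors $U_{\mathfrak{d}_p},S_{\mathfrak{d}_p}$ with vertex $0$ and bisecting direction $\mathfrak{d}_p$ are such that, for some positive constants $M_1,M_2,M_{12},M_{22}$ and all $m\in\mathbb{R}$ and all $\ell$: $|\tau-q_{\ell,1}(m)|\ge M_1(1+|\tau|)$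 and $|\tau-q_{\ell,1}(m)|\ge M_2|q_{\ell,1}(m)|$ for $\tau\in U_{\mathfrak{d}_p}\cup\overline D(0,\rho)$; $|\tau-q_{\ell,2}(m)|\ge M_{12}(1+|\tau|)$ and $|\tau-q_{\ell,2}(m)|\ge M_{22}|q_{\ell,2}(m)|$ for $\tau\in S_{\mathfrak{d}_p}$. Moreover $\mathcal{R}^b_{\mathfrak{d}_p}\cap\mathcal{R}^b_{\mathfrak{d}_{p+1}}\neq\emptyset$, and $\epsilon t\in\mathcal{R}^b_{\mathfrak{d}_p}$ for all $t\in\mathcal{T}$, $\epsilon\in\mathcal{E}_p$. The solutions $u_p$. It is assumed that $r_{Q,R_{D_1}},r_{Q,R_{D_2}}$ are large enough and $\Delta_{C,\ell}$ ($1\le\ell\le D-1$), $\Delta_F$ small enough for the following known construction (Dreyfus–Lastra–Malek) to apply: for each $p$ there is a solution of (E), $u_p\in\mathcal{O}(\mathcal{T}\times H_{\beta'}\times\mathcal{E}_p)$ for every $0<\beta'<\beta$, given by $$u_p(t,z,\epsilon)=\frac{1}{(2\pi)^{1/2}}\frac{k_2}{\log(q)}\int_{-\infty}^{\infty}\int_{L_{\mathfrak{d}_p}}\frac{w^{\mathfrak{d}_p}_{k_2}(u,m,\epsilon)}{\Theta_{q^{1/k_2}}\left(\frac{u}{\epsilon t}\right)}\frac{du}{u}e^{izm}dm,$$ with functions $w^{\mathfrak{d}_p}_{k_2}$ and auxiliary functions $w^{\mathfrak{d}_p}_{k_1}$ having the following properties. (W1) $w_{k_2}^{\mathfrak{d}_p}$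 is continuous on $S_{\mathfrak{d}_p}\times\mathbb{R}\times D(0,\epsilon_0)$, holomorphic in its first and third variables, and for some $C>0$, $\sup_{\epsilon\in D(0,\epsilon_0)}|w_{k_2}^{\mathfrak{d}_p}(u,m,\epsilon)|\le C(1+|m|)^{-\mu}e^{-\beta|m|}\exp(\frac{k_2}{2\log q}\log^2|u|+\nu\log|u|)$ for $u\in S_{\mathfrak{d}_p}$, $m\in\mathbb{R}$. (W2) $w_{k_1}^{\mathfrak{d}_p}$ is continuous on $(U_{\mathfrak{d}_p}\cup\overline D(0,\rho))\times\mathbb{R}\times\mathcal{E}_p$, holomorphic in its first and third variables on $U_{\mathfrak{d}_p}\cup D(0,\rho)$ and $\mathcal{E}_p$, and for some $C_{p,1}>0$ and small $\delta>0$, $\sup_{\epsilon\in\mathcal{E}_p}|w_{k_1}^{\mathfrak{d}_p}(u,m,\epsilon)|\le C_{p,1}(1+|m|)^{-\mu}e^{-\beta|m|}\exp(\frac{\kappa}{2}\frac{\log^2|u+\delta|}{\log q}+\alpha\log|u+\delta|)$. (W3) $\tau\mapsto\mathcal{L}^{\mathfrak{d}_p}_{q;1/\kappa}(w_{k_1}^{\mathfrak{d}_p}(u,m,\epsilon))(\tau)$ is holomorphic on $\mathcal{R}_{\mathfrak{d}_p,\tilde\delta}\cap D(0,r_1)$ for $0<r_1\le q^{(\frac12-\alpha)/\kappa}/2$ and equals $w_{k_2}^{\mathfrak{d}_p}(\tau,m,\epsilon)$ for $\tau$ in a finite sector $S^b_{\mathfrak{d}_p}$ of bisecting direction $\mathfrak{d}_p$,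 $m\in\mathbb{R}$, $\epsilon\in\mathcal{E}_p$. (W4) If $U_{\mathfrak{d}_p}\cap U_{\mathfrak{d}_{p+1}}\ne\emptyset$, then $\mathcal{L}^{\mathfrak{d}_p}_{q;1/\kappa}(w_{k_1}^{\mathfrak{d}_p})$ and $\mathcal{L}^{\mathfrak{d}_{p+1}}_{q;1/\kappa}(w_{k_1}^{\mathfrak{d}_{p+1}})$ coincide for $\tau\in\mathcal{R}^b_{\mathfrak{d}_p}\cap\mathcal{R}^b_{\mathfrak{d}_{p+1}}$, $m\in\mathbb{R}$ and $\epsilon\in\mathcal{E}_p\cap\mathcal{E}_{p+1}$. *)

(* Defs.v *)
From Stdlib Require Export Reals ZArith Arith List.
From Coquelicot Require Export Coquelicot.

Open Scope R_scope.
Set Implicit Arguments.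
Unset Strict Implicit.

(** * Complex analysis *)

Definition cexp (z : C) : C := (exp (fst z) * cos (snd z), exp (fst z) * sin (snd z)).

Definition cis (theta : R) : C := (cos theta, sin theta).

(* Openness of the domain is not part of these definitions: they are only used
   on open sets. *)
Definition holomorphic_on (V : C -> Prop) (f : C -> C) : Prop :=
  forall z, V z -> ex_derive (K := C_AbsRing) (V := C_NormedModule) f z.

Definition C3 : NormedModule C_AbsRing :=
  prod_NormedModule C_AbsRing
    (prod_NormedModule C_AbsRing C_NormedModule C_NormedModule) C_NormedModule.

(* Complex (Frechet) differentiability in the three variables jointly. *)
Definition holomorphic3_on (V : C -> C -> C -> Prop) (f : C -> C -> C -> C) : Prop :=
  forall x y z, V x y z ->
    ex_filterdiff (K := C_AbsRing) (U := C3) (V := C_NormedModule)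
      (fun a : C3 => f (fst (fst a)) (snd (fst a)) (snd a))
      (locally (T := C3) ((x, y), z)).

(* Sums of convergent series; as for [Series], the value carries no meaning when
   the series diverges. *)
Definition CSeries (a : nat -> C) : C :=
  (Series (fun n => fst (a n)), Series (fun n => snd (a n))).

Definition Cpow_Z (z : C) (n : Z) : C :=
  match n with
  | Z0 => RtoC 1
  | Zpos p => (z ^ Pos.to_nat p)%C
  | Zneg p => (/ (z ^ Pos.to_nat p))%C
  end.

Definition CSeries_Z (a : Z -> C) : C :=
  (CSeries (fun n => a (Z.of_nat n)) + CSeries (fun n => a (- Z.of_nat (S n))%Z))%C.

Definition ex_CInt_gen (f : R -> C) (Fa Fb : (R -> Prop) -> Prop) : Prop :=
  ex_RInt_gen (V := C_R_NormedModule) f Fa Fb.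

Definition CInt_gen (f : R -> C) (Fa Fb : (R -> Prop) -> Prop) : C :=
  RInt_gen (V := C_R_CompleteNormedModule) f Fa Fb.

Definition ex_CInt_line (f : R -> C) : Prop :=
  ex_CInt_gen f (Rbar_locally m_infty) (Rbar_locally p_infty).

Definition CInt_line (f : R -> C) : C :=
  CInt_gen f (Rbar_locally m_infty) (Rbar_locally p_infty).

(* The integral of [h u du] along [0,oo) e^{i d}, parametrized by u = r e^{i d};
   improper at both ends. *)
Definition ex_CInt_ray (d : R) (h : C -> C) : Prop :=
  ex_CInt_gen (fun r => h (r * cis d)%C * cis d)%C (at_right 0) (Rbar_locally p_infty).

Definition CInt_ray (d : R) (h : C -> C) : C :=
  CInt_gen (fun r => h (r * cis d)%C * cis d)%C (at_right 0) (Rbar_locally p_infty).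

Definition disc (r : R) (z : C) : Prop := Cmod z < r.

Definition strip (b : R) (z : C) : Prop := Rabs (snd z) < b.

(* Open sectors with vertex 0, bisecting direction [d] and half-opening [h]. *)
Definition sector (d h : R) (z : C) : Prop :=
  exists r theta, 0 < r /\ Rabs (theta - d) < h /\ z = (r * cis theta)%C.

Definition bsector (d h rad : R) (z : C) : Prop := sector d h z /\ Cmod z < rad.

Definition closed_far_sector (d h rad : R) (z : C) : Prop :=
  rad <= Cmod z /\
  exists theta, Rabs (theta - d) <= h /\ z = (Cmod z * cis theta)%C.

(** * Polynomials, given by their list of coefficients (constant term first) *)

Definition cpoly := list C.

Definition pcoef (P : cpoly) (n : nat) : C := nth n P (RtoC 0).

Definition peval (P : cpoly) (z : C) : C :=
  sum_n (G := C_AbelianMonoid) (fun n => pcoef P n * z ^ n)%C (length P).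

(* The degree; 0 for the zero polynomial. *)
Definition pdeg (P : cpoly) : nat :=
  list_max (filter (fun n => if Ceq_dec (pcoef P n) (RtoC 0) then false else true)
                   (seq 0 (length P))).

(** * Operators on functions of (t, z, epsilon) *)

Definition fun3 := C -> C -> C -> C.

Definition sigma_q (q delta : R) (g : fun3) : fun3 :=
  fun t z eps => g (Rpower q delta * t)%C z eps.

(* The differential operator P(d/dz). *)
Definition pdiff (P : cpoly) (g : fun3) : fun3 :=
  fun t z eps =>
    sum_n (G := C_AbelianMonoid)
      (fun n => pcoef P n * Nat.iter n C_derive (fun x => g t x eps) z)%C (length P).

Definition inv_Fourier (f : R -> C) (x : C) : C :=
  (/ sqrt (2 * PI) * CInt_line (fun m => f m * cexp (Ci * x * m)))%C.

(* [Theta q k] is the Theta function attached to q^{1/k}. *)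
Definition Theta (q k : R) (z : C) : C :=
  CSeries_Z (fun n => Rpower q (- IZR (n * (n - 1)) / (2 * k)) * Cpow_Z z n)%C.

Definition ex_qLaplace (q k d : R) (f : C -> C) (T : C) : Prop :=
  ex_CInt_ray d (fun u => f u / Theta q k (u / T) / u)%C.

Definition qLaplace (q k d : R) (f : C -> C) (T : C) : C :=
  ((k / ln q)%R * CInt_ray d (fun u => f u / Theta q k (u / T) / u))%C.

Definition weight (mu beta m : R) : R :=
  Rpower (1 + Rabs m) (- mu) * exp (- beta * Rabs m).

(** * The equation *)

Inductive level : Set := L1 | L2.

(* [e_D1] and [e_D2] only serve as labels of the two principal terms, so the
   objects carrying these labels are indexed by [level] instead.  The index l of
   [e_Delta], [e_d], [e_delta], [e_R], [e_C], [e_DC] ranges over 1 <= l <= D-1;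
   values outside this range are irrelevant. *)
Record equation := Equation {
  e_q : R;
  e_k : level -> R;
  e_D : nat;
  e_D1 : nat;
  e_D2 : nat;
  e_dD : level -> nat;
  e_Delta : nat -> nat;
  e_d : nat -> nat;
  e_delta : nat -> nat;
  e_mu : R;
  e_Q : cpoly;
  e_R : nat -> cpoly;
  e_RD : level -> cpoly;
  e_beta : R;
  e_eps0 : R;
  e_T0 : R;
  e_C : nat -> nat -> R -> C -> C;     (* C_{l,n}(m, epsilon) *)
  e_F : nat -> R -> C -> C;            (* F_n(m, epsilon) *)
  e_DC : nat -> R;
  e_DF : R
}.

Definition e_kappa (e : equation) : R := / (/ e_k e L1 - / e_k e L2).

Definition in_range (e : equation) (l : nat) : Prop := (1 <= l <= e_D e - 1)%nat.

Record equation_hyps (e : equation) : Prop := {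
  eh_q : 1 < e_q e;
  eh_k : 1 <= e_k e L1 < e_k e L2;
  eh_D : (3 <= e_D e)%nat /\ (3 <= e_D1 e)%nat /\ (3 <= e_D2 e)%nat;
  eh_dD : forall j, (1 <= e_dD e j)%nat;
  eh_d : forall l, in_range e l -> (1 <= e_d e l)%nat /\ (1 <= e_delta e l)%nat;
  eh_delta1 : e_delta e 1 = 1%nat;
  eh_delta_lt : forall l, (1 <= l <= e_D e - 2)%nat -> (e_delta e l < e_delta e (S l))%nat;
  eh_Delta : forall l, in_range e l -> (e_d e l <= e_Delta e l)%nat;
  eh_growth1 : forall l, in_range e l ->
    (INR (e_dD e L1) - 1) / e_kappa e + INR (e_d e l) / e_k e L2 + 1 >= INR (e_delta e l);
  eh_growth2 : forall l, in_range e l ->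
    INR (e_d e l) / e_k e L1 + 1 >= INR (e_delta e l);
  eh_growth3 : forall l, in_range e l ->
    (INR (e_dD e L2) - 1) / e_k e L2 >= INR (e_delta e l) - 1;
  eh_growth4 : e_k e L1 * (INR (e_dD e L2) - 1) > e_k e L2 * INR (e_dD e L1);
  eh_mu : 0 < e_mu e;
  eh_mu_deg : forall j, e_mu e > INR (pdeg (e_RD e j)) + 1;
  eh_Q_nz : forall m : R, peval (e_Q e) (Ci * m)%C <> RtoC 0;
  eh_RD_nz : forall j (m : R), peval (e_RD e j) (Ci * m)%C <> RtoC 0;
  eh_deg_Q : (pdeg (e_RD e L1) <= pdeg (e_Q e))%nat;
  eh_deg_RD : pdeg (e_RD e L1) = pdeg (e_RD e L2);
  eh_deg_R : forall l, in_range e l -> (pdeg (e_R e l) <= pdeg (e_RD e L2))%nat;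
  eh_beta : 0 < e_beta e;
  eh_eps0 : 0 < e_eps0 e < 1;
  eh_T0 : 0 < e_T0 e;
  eh_DC : forall l, in_range e l -> 0 < e_DC e l;
  eh_DF : 0 < e_DF e;
  eh_C_cont : forall l n eps, in_range e l -> disc (e_eps0 e) eps ->
    forall m : R, continuous (fun x : R => e_C e l n x eps) m;
  eh_C_holo : forall l n m, in_range e l ->
    holomorphic_on (disc (e_eps0 e)) (e_C e l n m);
  eh_C_bound : forall l n m eps, in_range e l -> disc (e_eps0 e) eps ->
    Cmod (e_C e l n m eps) <=
      e_DC e l * / (e_T0 e ^ n)
      * Rpower (e_q e) (- (INR n ^ 2 * e_kappa e) / (2 * e_k e L1 * e_k e L2))
      * weight (e_mu e) (e_beta e) m;
  eh_F_cont : forall n eps, disc (e_eps0 e) eps ->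
    forall m : R, continuous (fun x : R => e_F e n x eps) m;
  eh_F_holo : forall n m, holomorphic_on (disc (e_eps0 e)) (e_F e n m);
  eh_F_bound : forall n m eps, disc (e_eps0 e) eps ->
    Cmod (e_F e n m eps) <= e_DF e * / (e_T0 e ^ n) * weight (e_mu e) (e_beta e) m
}.

Definition coef_c (e : equation) (l : nat) : fun3 :=
  fun t z eps => inv_Fourier (fun m => CSeries (fun n => e_C e l n m eps * (eps * t) ^ n)%C) z.

Definition forcing (e : equation) : fun3 :=
  fun t z eps => inv_Fourier (fun m => CSeries (fun n => e_F e n m eps * (eps * t) ^ n)%C) z.

Definition main_term (e : equation) (u : fun3) (j : level) : fun3 :=
  fun t z eps =>
    ((eps * t) ^ e_dD e j
     * sigma_q (e_q e) (INR (e_dD e j) / e_k e j + 1) (pdiff (e_RD e j) u) t z eps)%C.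

Definition lower_term (e : equation) (u : fun3) (l : nat) : fun3 :=
  fun t z eps =>
    (eps ^ e_Delta e l * t ^ e_d e l
     * sigma_q (e_q e) (INR (e_delta e l))
         (fun t' z' eps' => coef_c e l t' z' eps' * pdiff (e_R e l) u t' z' eps')
         t z eps)%C.

Definition equation_at (e : equation) (u : fun3) (t z eps : C) : Prop :=
  pdiff (e_Q e) (sigma_q (e_q e) 1 u) t z eps =
  (main_term e u L1 t z eps + main_term e u L2 t z eps
   + sum_n_m (G := C_AbelianMonoid) (fun l => lower_term e u l t z eps) 1 (e_D e - 1)
   + sigma_q (e_q e) 1 (forcing e) t z eps)%C.

(* [u] solves the equation on [T x Z x E].  As q > 1 and [T] will be bounded, the
   equation is required at the points where all its terms make sense: the dilated
   points q^delta t must lie in [T], and epsilon q t in the disc of convergence of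
   the series that defines the forcing term. *)
Definition solves (e : equation) (T Z E : C -> Prop) (u : fun3) : Prop :=
  forall t z eps, T t -> Z z -> E eps ->
    T (Rpower (e_q e) 1 * t)%C ->
    (forall j, T (Rpower (e_q e) (INR (e_dD e j) / e_k e j + 1) * t)%C) ->
    (forall l, in_range e l -> T (Rpower (e_q e) (INR (e_delta e l)) * t)%C) ->
    disc (e_T0 e) (eps * (Rpower (e_q e) 1 * t))%C ->
    equation_at e u t z eps.

(** * The geometry *)

(* Indices p range over 0 <= p < [g_n].  A sector is given by its bisecting
   direction, half-opening and, if bounded, radius. *)
Record geometry := Geometry {
  g_n : nat;
  g_E_dir : nat -> R;
  g_E_half : nat -> R;
  g_E_rad : nat -> R;
  g_alpha : R;
  g_nu : R;
  g_T_dir : R;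
  g_T_half : R;
  g_T_rad : R;
  g_rT : R;
  g_dir : nat -> R;
  g_dtilde : R;
  g_SQ_dir : level -> R;
  g_SQ_half : level -> R;
  g_SQ_rad : level -> R;
  g_root : level -> nat -> R -> C;     (* q_{l,j}(m) *)
  g_rho : R;
  g_U_half : nat -> R;
  g_S_half : nat -> R
}.

Definition next (g : geometry) (p : nat) : nat := Nat.modulo (S p) (g_n g).

Definition E_ (g : geometry) (p : nat) : C -> Prop :=
  bsector (g_E_dir g p) (g_E_half g p) (g_E_rad g p).

Definition T_ (g : geometry) : C -> Prop := bsector (g_T_dir g) (g_T_half g) (g_T_rad g).

Definition U_ (g : geometry) (p : nat) : C -> Prop := sector (g_dir g p) (g_U_half g p).

Definition S_ (g : geometry) (p : nat) : C -> Prop := sector (g_dir g p) (g_S_half g p).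

Definition Rset (g : geometry) (p : nat) (T : C) : Prop :=
  T <> RtoC 0 /\
  forall r : R, 0 <= r -> Cmod (1 + r * cis (g_dir g p) / T)%C > g_dtilde g.

Definition Rbset (e : equation) (g : geometry) (p : nat) (T : C) : Prop :=
  Rset g p T /\ disc (e_eps0 e * g_rT g) T.

Definition P_ (e : equation) (j : level) (m : R) (tau : C) : C :=
  let k := e_k e j in
  let d := INR (e_dD e j) in
  let q1 := Rpower (e_q e) (/ k) in
  (peval (e_Q e) (Ci * m) / Rpower q1 (k * (k - 1) / 2)
   - peval (e_RD e j) (Ci * m) / Rpower q1 ((d + k) * (d + k - 1) / 2)
     * tau ^ e_dD e j)%C.

Record geometry_hyps (e : equation) (g : geometry) : Prop := {
  gh_n : (2 <= g_n g)%nat;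
  gh_E : forall p, (p < g_n g)%nat -> 0 < g_E_half g p <= PI /\ 0 < g_E_rad g p;
  (* |j - k| <= 1 for indices read cyclically *)
  gh_E_inter : forall j k, (j < g_n g)%nat -> (k < g_n g)%nat ->
    ((exists z, E_ g j z /\ E_ g k z) <-> (j = k \/ k = next g j \/ j = next g k));
  gh_E_cover : exists N : C -> Prop, locally (RtoC 0) N /\
    forall z, (exists p, (p < g_n g)%nat /\ E_ g p z) <-> (N z /\ z <> RtoC 0);
  gh_E_sub : forall p z, (p < g_n g)%nat -> E_ g p z -> disc (e_eps0 e) z;
  gh_nu : g_nu g < 1 / 2;
  gh_T : 0 < g_T_half g <= PI /\ 0 < g_T_rad g;
  gh_rT : 0 < g_rT g < 1;
  gh_T_sub : forall t, T_ g t -> disc (g_rT g) t;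
  gh_rT_nu : g_nu g + e_k e L2 / ln (e_q e) * ln (g_rT g) < 0;
  gh_rT_alpha : g_alpha g + e_kappa e / ln (e_q e) * ln (e_eps0 e * g_rT g) < 0;
  gh_rT_le : e_eps0 e * g_rT g <= Rpower (e_q e) ((1 / 2 - g_nu g) / e_k e L2) / 2;
  gh_dtilde : 0 < g_dtilde g < 1;
  gh_SQ_pos : forall j, 0 < g_SQ_rad g j /\ 0 < g_SQ_half g j;
  gh_SQ : forall j (m : R),
    closed_far_sector (g_SQ_dir g j) (g_SQ_half g j) (g_SQ_rad g j)
      (peval (e_Q e) (Ci * m) / peval (e_RD e j) (Ci * m))%C;
  (* The roots are simple, so listing them without repetition is the same as
     listing them with multiplicity. *)
  gh_root : forall j (m : R) tau,
    P_ e j m tau = RtoC 0 <-> exists l, (l < e_dD e j)%nat /\ tau = g_root g j l m;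
  gh_rho : 0 < g_rho g;
  gh_U : forall p, (p < g_n g)%nat -> 0 < g_U_half g p <= PI;
  gh_S : forall p, (p < g_n g)%nat -> 0 < g_S_half g p <= PI;
  gh_U_root : exists M1 M2, 0 < M1 /\ 0 < M2 /\
    forall p l (m : R) tau, (p < g_n g)%nat -> (l < e_dD e L1)%nat ->
      (U_ g p tau \/ Cmod tau <= g_rho g) ->
      Cmod (tau - g_root g L1 l m)%C >= M1 * (1 + Cmod tau) /\
      Cmod (tau - g_root g L1 l m)%C >= M2 * Cmod (g_root g L1 l m);
  gh_S_root : exists M12 M22, 0 < M12 /\ 0 < M22 /\
    forall p l (m : R) tau, (p < g_n g)%nat -> (l < e_dD e L2)%nat ->
      S_ g p tau ->
      Cmod (tau - g_root g L2 l m)%C >= M12 * (1 + Cmod tau) /\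
      Cmod (tau - g_root g L2 l m)%C >= M22 * Cmod (g_root g L2 l m);
  gh_Rb_inter : forall p, (p < g_n g)%nat ->
    exists T, Rbset e g p T /\ Rbset e g (next g p) T;
  gh_Rb_prod : forall p t eps, (p < g_n g)%nat -> T_ g t -> E_ g p eps ->
    Rbset e g p (eps * t)%C
}.

(** * The solutions *)

Record family := Family {
  f_u : nat -> fun3;
  f_w1 : nat -> C -> R -> C -> C;      (* w_{k_1}(u, m, epsilon) *)
  f_w2 : nat -> C -> R -> C -> C       (* w_{k_2}(u, m, epsilon) *)
}.

Definition Laplace_w1 (e : equation) (g : geometry) (s : family)
    (p : nat) (m : R) (eps tau : C) : C :=
  qLaplace (e_q e) (e_kappa e) (g_dir g p) (fun u => f_w1 s p u m eps) tau.

Definition ex_Laplace_w1 (e : equation) (g : geometry) (s : family)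
    (p : nat) (m : R) (eps tau : C) : Prop :=
  ex_qLaplace (e_q e) (e_kappa e) (g_dir g p) (fun u => f_w1 s p u m eps) tau.

Definition u_inner (e : equation) (g : geometry) (s : family)
    (p : nat) (t eps : C) (m : R) (u : C) : C :=
  (f_w2 s p u m eps / Theta (e_q e) (e_k e L2) (u / (eps * t)) / u)%C.

Definition u_outer (e : equation) (g : geometry) (s : family)
    (p : nat) (t z eps : C) (m : R) : C :=
  (CInt_ray (g_dir g p) (u_inner e g s p t eps m) * cexp (Ci * z * m))%C.

Record family_hyps (e : equation) (g : geometry) (s : family) : Prop := {
  fh_holo : forall p b, (p < g_n g)%nat -> 0 < b < e_beta e ->
    holomorphic3_on (fun t z eps => T_ g t /\ strip b z /\ E_ g p eps) (f_u s p);
  fh_sol : forall p, (p < g_n g)%nat ->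
    solves e (T_ g) (strip (e_beta e)) (E_ g p) (f_u s p);
  fh_repr : forall p t z eps, (p < g_n g)%nat ->
    T_ g t -> strip (e_beta e) z -> E_ g p eps ->
    (forall m, ex_CInt_ray (g_dir g p) (u_inner e g s p t eps m)) /\
    ex_CInt_line (u_outer e g s p t z eps) /\
    f_u s p t z eps =
      (/ sqrt (2 * PI) * (e_k e L2 / ln (e_q e))%R
       * CInt_line (u_outer e g s p t z eps))%C;

  fh_W1_cont : forall p, (p < g_n g)%nat ->
    continuous_on
      (fun x : C * R * C => S_ g p (fst (fst x)) /\ disc (e_eps0 e) (snd x))
      (fun x : C * R * C => f_w2 s p (fst (fst x)) (snd (fst x)) (snd x));
  fh_W1_holo_u : forall p m eps, (p < g_n g)%nat -> disc (e_eps0 e) eps ->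
    holomorphic_on (S_ g p) (fun u => f_w2 s p u m eps);
  fh_W1_holo_eps : forall p u m, (p < g_n g)%nat -> S_ g p u ->
    holomorphic_on (disc (e_eps0 e)) (f_w2 s p u m);
  fh_W1_bound : forall p, (p < g_n g)%nat -> exists K, 0 < K /\
    forall u m eps, S_ g p u -> disc (e_eps0 e) eps ->
      Cmod (f_w2 s p u m eps) <=
        K * weight (e_mu e) (e_beta e) m
        * exp (e_k e L2 / (2 * ln (e_q e)) * ln (Cmod u) ^ 2 + g_nu g * ln (Cmod u));

  fh_W2_cont : forall p, (p < g_n g)%nat ->
    continuous_on
      (fun x : C * R * C =>
         (U_ g p (fst (fst x)) \/ Cmod (fst (fst x)) <= g_rho g) /\ E_ g p (snd x))
      (fun x : C * R * C => f_w1 s p (fst (fst x)) (snd (fst x)) (snd x));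
  fh_W2_holo_u : forall p m eps, (p < g_n g)%nat -> E_ g p eps ->
    holomorphic_on (fun u => U_ g p u \/ disc (g_rho g) u) (fun u => f_w1 s p u m eps);
  fh_W2_holo_eps : forall p u m, (p < g_n g)%nat ->
    (U_ g p u \/ disc (g_rho g) u) ->
    holomorphic_on (E_ g p) (f_w1 s p u m);
  (* At u = -delta the right-hand side is +oo, whereas [ln 0] is 0 here: that
     point is left out. *)
  fh_W2_bound : forall p, (p < g_n g)%nat -> exists K delta, 0 < K /\ 0 < delta /\
    forall u m eps, (U_ g p u \/ Cmod u <= g_rho g) -> E_ g p eps ->
      (u + delta)%C <> RtoC 0 ->
      Cmod (f_w1 s p u m eps) <=
        K * weight (e_mu e) (e_beta e) m
        * exp (e_kappa e / 2 * (ln (Cmod (u + delta)) ^ 2 / ln (e_q e))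
               + g_alpha g * ln (Cmod (u + delta)));

  fh_W3_holo : forall p m eps r1, (p < g_n g)%nat -> E_ g p eps ->
    0 < r1 <= Rpower (e_q e) ((1 / 2 - g_alpha g) / e_kappa e) / 2 ->
    (forall tau, Rset g p tau -> disc r1 tau -> ex_Laplace_w1 e g s p m eps tau) /\
    holomorphic_on (fun tau => Rset g p tau /\ disc r1 tau) (Laplace_w1 e g s p m eps);
  fh_W3_eq : forall p, (p < g_n g)%nat -> exists h rad, 0 < h <= PI /\ 0 < rad /\
    forall tau, bsector (g_dir g p) h rad tau ->
      S_ g p tau /\ Rset g p tau /\
      disc (Rpower (e_q e) ((1 / 2 - g_alpha g) / e_kappa e) / 2) tau /\
      forall m eps, E_ g p eps -> Laplace_w1 e g s p m eps tau = f_w2 s p tau m eps;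

  fh_W4 : forall p, (p < g_n g)%nat ->
    (exists z, U_ g p z /\ U_ g (next g p) z) ->
    forall tau m eps, Rbset e g p tau -> Rbset e g (next g p) tau ->
      E_ g p eps -> E_ g (next g p) eps ->
      Laplace_w1 e g s p m eps tau = Laplace_w1 e g s (next g p) m eps tau
}.

(* Main.v *)
Require Import Defs.
From Stdlib Require Import Lra Lia.

(** Write T = epsilon t, k = k_2 and c = k / log q.  Up to a constant factor the
    difference of the two solutions is the Fourier integral in m of the difference of
    two q-Laplace integrals of order k, of the functions w_{k_2}, along the rays of
    directions d_p and d_{p+1}.  Near the origin these functions are q-Laplace
    transforms, of order kappa, of the functions w_{k_1}; as such they are holomorphic
    on wide cones around the two rays, and they agree where the cones meet.  So below
    some radius r_1 both paths can be rotated onto one common ray, where the two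
    integrands are equal: what remains are the parts of the two rays beyond r_1 and
    arcs of radius r_1 ([rays_difference]).  There |u| >= r_1, and the size
    exp ((c/2) log^2 |u/T|) of Theta (u/T) beats the growth exp ((c/2) log^2 |u|) of
    w_{k_2} and leaves the factor exp (- (c/2) log^2 |T|) |T|^{K_2} with
    K_2 = c log r_1 + 1/2.  The second estimate holds with the same constants: for
    L = log |T|, completing the square bounds - (c/2) L^2 + (K_2 - N) L by
    (K_2 - N)^2 / (2c).

    The zeros of u |-> Theta (u/T) lie on the half-line opposite to T, and the
    intersection of the two cones may have two components, so the sense of rotation has
    to depend on T.  Both directions are represented by angles at distance at most
    PI from arg T.  Since |1 + s e^{i phi}| decreases in |phi| on [0, PI]
    ([Cmod_1_cis_anti]), all angles between them are then as far from the zeros as the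
    two directions are, and the two halves of the turn stay in the respective cones.

    The analysis behind this is the following.
    - Cauchy's theorem for sectors of annuli ([cauchy_polar]), which is Goursat's
      theorem ([goursat]) on a rectangle in the coordinate log u.
    - The lower bound of Theta ([theta_lower]).  A finite form of the Jacobi triple
      product ([finite_jacobi]) converges to Theta by Tannery's theorem
      ([jacobi_limit]), and its factors are bounded below on one fundamental annulus;
      the functional equation [theta_shift] carries the bound to all z.
    - A bound of the q-Laplace transform of w_{k_1} by the weight in m, uniform on the
      cone near the origin ([Laplace_w1_bound]).  The available bound of w_{k_1}(u)
      involves log |u + delta|, so it is useless near u = - delta, a point which may
      lie on the path of integration; there the maximum principle on a circle around u
      replaces it ([log_gaussian_ray_bound]). *)

(** * Complex differentiability *)

Notation is_CInt f a b l := (is_RInt (V := C_R_NormedModule) f a b l).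
Notation ex_CInt f a b := (ex_RInt (V := C_R_NormedModule) f a b).
Definition CInt (f : R -> C) (a b : R) : C := RInt (V := C_R_CompleteNormedModule) f a b.
Notation Cdiff f z := (ex_derive (K := C_AbsRing) (V := C_NormedModule) f z).

Lemma norm_C_R (z : C) : norm (z : C_R_NormedModule) = Cmod z.
Proof.
unfold norm; simpl. unfold prod_norm, Cmod; simpl.
f_equal. unfold norm; simpl. unfold abs; simpl.
rewrite <- !Rmult_assoc, !Rmult_1_r.
rewrite <- !Rabs_mult, !Rabs_pos_eq; try ring; apply Rle_0_sqr.
Qed.

Lemma Cmod_ball (z w : C) (e : R) : Cmod (w - z) < e -> ball (z : C_UniformSpace) e w.
Proof.
intros H. assert (H1 := Rmax_Cmod (w - z)%C).
split; unfold ball; simpl; unfold AbsRing_ball, abs, minus, plus, opp; simpl;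
 simpl in H1; eapply Rle_lt_trans; [|apply H| |apply H];
 eapply Rle_trans; [|apply H1| |apply H1]; [apply Rmax_l|apply Rmax_r].
Qed.

Lemma ball_Cmod (z w : C) (e : posreal) : ball (z : C_UniformSpace) e w ->
  Cmod (w - z) < sqrt 2 * e.
Proof.
intros [H1 H2]. unfold ball in H1, H2; simpl in *.
eapply Rle_lt_trans. apply Cmod_2Rmax. simpl.
apply Rmult_lt_compat_l. apply sqrt_lt_R0; lra.
apply Rmax_lub_lt; assumption.
Qed.

(** The uniform structure of C is that of a product of two lines, so its balls are
    squares; this passes to round discs. *)
Lemma locally_Cmod (z : C) (P : C -> Prop) :
  locally (T := C_UniformSpace) z P <-> exists d : R, 0 < d /\ forall w, Cmod (w - z) < d -> P w.
Proof.
split.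
- intros [e H]. exists e. split. apply cond_pos. intros w Hw. apply H. apply Cmod_ball, Hw.
- intros [d [Hd H]]. 
  assert (Hs : 0 < sqrt 2) by (apply sqrt_lt_R0; lra).
  assert (He : 0 < d / sqrt 2) by (apply Rdiv_lt_0_compat; lra).
  exists (mkposreal _ He). intros w Hw. apply H.
  apply ball_Cmod in Hw. simpl in Hw.
    replace (sqrt 2 * (d / sqrt 2)) with d in Hw by (field; lra). exact Hw.
Qed.

Lemma Cdiff_eps (f : C -> C) (z : C) :
  Cdiff f z <->
  exists l : C, forall e, 0 < e -> exists d, 0 < d /\
    forall w, Cmod (w - z) < d -> Cmod (f w - f z - (w - z) * l) <= e * Cmod (w - z).
Proof.
split.
- intros [l [_ H]]. exists l. intros e He.
  specialize (H z (fun P HP => HP) (mkposreal _ He)).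
  destruct H as [d H]. exists d. split. apply cond_pos. exact H.
- intros [l H]. exists l. split. apply @is_linear_scal_l.
  intros x Hx. 
  assert (x = z) as ->. { symmetry.
    apply (is_filter_lim_locally_unique (V := AbsRing_NormedModule C_AbsRing) z x). exact Hx. }
  intros [e He]. destruct (H e He) as [d [Hd Hd']].
  exists (mkposreal d Hd). exact Hd'.
Qed.

(** The two structures of normed module of C over itself have different balls but the
    same norm; the product and chain rules concern the second one. *)
Lemma Cdiff_iff_AbsRing (f : C -> C) (z : C) :
  Cdiff f z <-> ex_derive (K := C_AbsRing) (V := AbsRing_NormedModule C_AbsRing) f z.
Proof.
split; intros [l [H1 H2]]; exists l; (split; [apply @is_linear_scal_l|exact H2]).
Qed.

Lemma Cdiff_ext_loc (f g : C -> C) (z : C) (d : R) : 0 < d ->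
  (forall w, Cmod (w - z) < d -> f w = g w) -> Cdiff f z -> Cdiff g z.
Proof.
intros Hd H. apply (ex_derive_ext_loc (K := C_AbsRing) (V := C_NormedModule)).
exists (mkposreal d Hd). intros w Hw. apply H, Hw.
Qed.

Lemma Cdiff_const (c z : C) : Cdiff (fun _ => c) z.
Proof. apply (ex_derive_const (K := C_AbsRing) (V := C_NormedModule)). Qed.

Lemma Cdiff_id (z : C) : Cdiff (fun w => w) z.
Proof. apply Cdiff_iff_AbsRing. apply (ex_derive_id (K := C_AbsRing)). Qed.

Lemma Cdiff_plus (f g : C -> C) (z : C) : Cdiff f z -> Cdiff g z ->
  Cdiff (fun w => f w + g w)%C z.
Proof. apply (ex_derive_plus (K := C_AbsRing) (V := C_NormedModule)). Qed.

Lemma Cdiff_mult (f g : C -> C) (z : C) : Cdiff f z -> Cdiff g z ->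
  Cdiff (fun w => f w * g w)%C z.
Proof.
intros [a Ha] [b Hb]. apply Cdiff_iff_AbsRing.
eexists. apply (is_derive_mult (K := C_AbsRing) f g z a b); try assumption.
- destruct Ha as [_ H]; split; [apply @is_linear_scal_l|exact H].
- destruct Hb as [_ H]; split; [apply @is_linear_scal_l|exact H].
- exact Cmult_comm.
Qed.

Lemma Cdiff_comp (f g : C -> C) (z : C) : Cdiff f (g z) -> Cdiff g z ->
  Cdiff (fun w => f (g w)) z.
Proof.
intros Hf Hg. apply Cdiff_iff_AbsRing in Hg.
  apply (ex_derive_comp (K := C_AbsRing) (V := C_NormedModule)); assumption.
Qed.

(** The practical criterion below: a Taylor remainder of second order. *)
Lemma Cdiff_quadratic (f : C -> C) (z l : C) (d M : R) : 0 < d ->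
  (forall w, Cmod (w - z) < d -> Cmod (f w - f z - (w - z) * l) <= M * Cmod (w - z) ^ 2) ->
  Cdiff f z.
Proof.
intros Hd H. apply Cdiff_eps. exists l. intros e He.
assert (HM : 0 < Rabs M + 1) by (assert (H0 := Rabs_pos M); lra).
assert (He' : 0 < e / (Rabs M + 1)) by (apply Rdiv_lt_0_compat; lra).
exists (Rmin d (e / (Rabs M + 1))). split. apply Rmin_glb_lt; assumption.
intros w Hw. 
assert (Hw1 : Cmod (w - z) < d) by (eapply Rlt_le_trans; [apply Hw|apply Rmin_l]).
assert (Hw2 : Cmod (w - z) < e / (Rabs M + 1)) by (eapply Rlt_le_trans; [apply Hw|apply Rmin_r]).
eapply Rle_trans. apply H, Hw1.
assert (H0 := Cmod_ge_0 (w - z)). 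
replace (M * Cmod (w - z) ^ 2) with (M * Cmod (w - z) * Cmod (w - z)) by ring.
apply Rmult_le_compat_r; [assumption|].
apply Rle_trans with ((Rabs M + 1) * (e / (Rabs M + 1))).
- eapply Rle_trans; [|apply Rmult_le_compat_l; [lra|left; apply Hw2]].
  apply Rmult_le_compat_r; [assumption|]. assert (HH := Rle_abs M); lra.
- right; field; lra.
Qed.

Lemma Cdiff_inv (z : C) : z <> RtoC 0 -> Cdiff Cinv z.
Proof.
intros Hz. assert (Hm : 0 < Cmod z) by (apply Cmod_gt_0, Hz).
apply Cdiff_quadratic with (l := (- / (z * z))%C) (d := Cmod z / 2) (M := 2 / (Cmod z) ^ 3);
  [lra|].
intros w Hw.
assert (Hw2 : Cmod z / 2 <= Cmod w).
{ assert (H := Cmod_triangle w (z - w)). replace (w + (z - w))%C with z in H by ring.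
  replace (z - w)%C with (- (w - z))%C in H by ring. rewrite Cmod_opp in H. lra. }
assert (Hw0 : w <> RtoC 0). { intros E. rewrite E, Cmod_0 in Hw2. lra. }
replace (/ w - / z - (w - z) * - / (z * z))%C with ((w - z) * (w - z) * (/ w * / (z * z)))%C
  by (field; auto).
assert (Hzz : (z * z)%C <> RtoC 0) by (apply Cmult_neq_0; assumption).
rewrite !Cmod_mult, !Cmod_inv, !Cmod_mult; auto.
replace (Cmod (w - z) * Cmod (w - z)) with (Cmod (w - z) ^ 2) by ring.
rewrite Rmult_comm. apply Rmult_le_compat_r. apply pow2_ge_0.
replace (2 / Cmod z ^ 3) with (/ (Cmod z / 2) * / (Cmod z * Cmod z)) by (field; lra).
apply Rmult_le_compat_r. left; apply Rinv_0_lt_compat; nra.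
apply Rinv_le_contravar; lra.
Qed.

Lemma Cdiff_continuous (f : C -> C) (z : C) : Cdiff f z ->
  continuous (T := C_UniformSpace) (U := C_UniformSpace) f z.
Proof.
intros H. apply Cdiff_eps in H. destruct H as [l H].
intros P HP. apply (proj1 (locally_Cmod (f z) P)) in HP. destruct HP as [e [He HP]].
apply (proj2 (locally_Cmod z (fun w => P (f w)))).
destruct (H 1 Rlt_0_1) as [d [Hd H1]].
assert (Hl := Cmod_ge_0 l).
assert (Hq : 0 < e / (Cmod l + 2)) by (apply Rdiv_lt_0_compat; lra).
exists (Rmin d (e / (Cmod l + 2))). split. apply Rmin_glb_lt; assumption.
intros w Hw. apply HP.
assert (Hw1 : Cmod (w - z) < d) by (eapply Rlt_le_trans; [apply Hw|apply Rmin_l]).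
assert (Hw2 : Cmod (w - z) < e / (Cmod l + 2)) by (eapply Rlt_le_trans; [apply Hw|apply Rmin_r]).
specialize (H1 w Hw1).
replace (f w - f z)%C with ((f w - f z - (w - z) * l) + (w - z) * l)%C by ring.
eapply Rle_lt_trans. apply Cmod_triangle. rewrite Cmod_mult.
assert (H0 := Cmod_ge_0 (w - z)).
apply Rle_lt_trans with ((Cmod l + 2) * Cmod (w - z)); [nra|].
apply Rlt_le_trans with ((Cmod l + 2) * (e / (Cmod l + 2))).
apply Rmult_lt_compat_l; lra. right; field; lra.
Qed.

Lemma RtoC_neq_0 (a : R) : a <> 0 -> RtoC a <> RtoC 0.
Proof. intros H E. apply H. injection E. auto. Qed.

Lemma cexp_plus (a b : C) : cexp (a + b) = (cexp a * cexp b)%C.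
Proof.
unfold cexp, Cmult; simpl. rewrite exp_plus, cos_plus, sin_plus. f_equal; ring.
Qed.

Lemma Cmod_cis (t : R) : Cmod (cis t) = 1.
Proof.
unfold Cmod, cis; simpl. replace (cos t * (cos t * 1) + sin t * (sin t * 1))
  with (Rsqr (sin t) + Rsqr (cos t)) by (unfold Rsqr; ring).
rewrite sin2_cos2. apply sqrt_1.
Qed.

Lemma cexp_cis (z : C) : cexp z = (exp (fst z) * cis (snd z))%C.
Proof. unfold cexp, cis, Cmult, RtoC; simpl. f_equal; ring. Qed.

Lemma Cmod_cexp (z : C) : Cmod (cexp z) = exp (fst z).
Proof. rewrite cexp_cis, Cmod_mult, Cmod_cis, Cmod_R, Rabs_pos_eq; [ring|left; apply exp_pos].
  Qed.

Lemma cis_plus (a b : R) : cis (a + b) = (cis a * cis b)%C.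
Proof. unfold cis, Cmult; simpl. rewrite cos_plus, sin_plus. f_equal; ring. Qed.

Lemma real_derive_eps (f : R -> R) (x l : R) : is_derive f x l ->
  forall e, 0 < e -> exists d, 0 < d /\ forall h, Rabs h < d ->
    Rabs (f (x + h) - f x - h * l) <= e * Rabs h.
Proof.
intros [_ H] e He. specialize (H x (fun P HP => HP) (mkposreal _ He)).
destruct H as [d H]. exists d. split. apply cond_pos. intros h Hh.
specialize (H (x + h)). unfold norm, minus, plus, opp, scal in H; simpl in H.
unfold abs, mult in H; simpl in H.
replace (x + h + - x) with h in H by ring. 
replace (f (x + h) - f x - h * l) with (f (x + h) + - f x + - (h * l)) by ring. apply H.
unfold ball; simpl; unfold AbsRing_ball, abs, minus, plus, opp; simpl.
replace (x + h + - x) with h by ring. exact Hh.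
Qed.

Lemma Cmod_le_Rabs (z : C) : Cmod z <= Rabs (fst z) + Rabs (snd z).
Proof.
rewrite (surjective_pairing z) at 1.
replace ((fst z, snd z) : C) with (RtoC (fst z) + Ci * RtoC (snd z))%C
  by (unfold RtoC, Ci, Cplus, Cmult; simpl; f_equal; ring).
eapply Rle_trans. apply Cmod_triangle. rewrite Cmod_mult, Cmod_Ci, !Cmod_R. lra.
Qed.

Lemma Rabs_fst_le (z : C) : Rabs (fst z) <= Cmod z.
Proof. eapply Rle_trans; [apply Rmax_l|apply Rmax_Cmod]. Qed.

Lemma Rabs_snd_le (z : C) : Rabs (snd z) <= Cmod z.
Proof. eapply Rle_trans; [apply Rmax_r|apply Rmax_Cmod]. Qed.

(** By [cexp_plus] this is differentiability at 0, hence three real first-order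
    expansions, of exp, cos and sin. *)
Lemma Cdiff_cexp (z : C) : Cdiff cexp z.
Proof.
apply Cdiff_eps. exists (cexp z). intros e He.
assert (Hz : 0 < exp (fst z)) by apply exp_pos.
set (E := e / (5 * exp (fst z))).
assert (HE : 0 < E) by (apply Rdiv_lt_0_compat; lra).
destruct (real_derive_eps exp 0 1) with (e := E) as [d1 [Hd1 H1]]; [|exact HE|].
{ replace 1 with (exp 0) by apply exp_0. apply is_derive_exp. }
destruct (real_derive_eps cos 0 0) with (e := Rmin E 1) as [d2 [Hd2 H2]];
  [|apply Rmin_glb_lt; lra|].
{ replace 0 with (- sin 0) at 2 by (rewrite sin_0; ring). apply is_derive_cos. }
destruct (real_derive_eps sin 0 1) with (e := Rmin E 1) as [d3 [Hd3 H3]];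
  [|apply Rmin_glb_lt; lra|].
{ replace 1 with (cos 0) by apply cos_0. apply is_derive_sin. }
set (d4 := Rmin E 1 / 8).
assert (HE1 : 0 < Rmin E 1) by (apply Rmin_glb_lt; lra).
assert (HEa : Rmin E 1 <= E) by apply Rmin_l.
assert (HEb : Rmin E 1 <= 1) by apply Rmin_r.
exists (Rmin (Rmin d1 d2) (Rmin d3 d4)). split.
{ repeat apply Rmin_glb_lt; unfold d4; lra. }
intros w Hw.
replace w with (z + (w - z))%C at 1 by ring. set (v := (w - z)%C) in *.
rewrite cexp_plus.
replace (cexp z * cexp v - cexp z - v * cexp z)%C with (cexp z * (cexp v - 1 - v))%C by ring.
rewrite Cmod_mult, Cmod_cexp. clearbody v.
assert (Hb : forall x, x < Rmin (Rmin d1 d2) (Rmin d3 d4) -> x < d1 /\ x < d2 /\ x < d3 /\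
  x < d4).
{ intros x Hx. repeat split; (eapply Rlt_le_trans; [apply Hx|]); 
  [eapply Rle_trans; [apply Rmin_l|apply Rmin_l]|eapply Rle_trans; [apply Rmin_l|apply Rmin_r]|
   eapply Rle_trans; [apply Rmin_r|apply Rmin_l]|eapply Rle_trans; [apply Rmin_r|apply Rmin_r]]. }
apply Hb in Hw. destruct Hw as [W1 [W2 [W3 W4]]].
assert (X := Rabs_fst_le v). assert (Y := Rabs_snd_le v).
specialize (H1 (fst v)). specialize (H2 (snd v)). specialize (H3 (snd v)).
rewrite Rplus_0_l in *. rewrite exp_0 in H1. rewrite cos_0 in H2. rewrite sin_0 in H3.
specialize (H1 ltac:(lra)). specialize (H2 ltac:(lra)). specialize (H3 ltac:(lra)).
assert (Hkey : Cmod (cexp v - 1 - v) <= 5 * E * Cmod v).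
2:{ apply Rle_trans with (exp (fst z) * (5 * E * Cmod v)). apply Rmult_le_compat_l; lra.
    right. unfold E. field. lra. }
eapply Rle_trans. apply Cmod_le_Rabs. unfold cexp, Cminus, Cplus, Copp, RtoC; simpl.
set (x := fst v) in *. set (y := snd v) in *. set (c := Cmod v) in *.
assert (Hx0 := Rabs_pos x). assert (Hy0 := Rabs_pos y).
set (ex := exp x - 1 - x * 1) in *. set (cy := cos y - 1 - y * 0) in *.
  set (sy := sin y - 0 - y * 1) in *.
assert (Hex : exp x = 1 + x + ex) by (unfold ex; ring).
assert (Hcy : cos y = 1 + cy) by (unfold cy; ring).
assert (Hsy : sin y = y + sy) by (unfold sy; ring).
assert (Hd4 : c < E / 8 /\ c < 1 / 8). { unfold d4 in W4. lra. }
assert (Hex' : Rabs ex <= E * c) by (eapply Rle_trans; [apply H1|]; nra).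
assert (Hcy' : Rabs cy <= E * c) by (eapply Rle_trans; [apply H2|]; nra).
assert (Hsy' : Rabs sy <= E * c) by (eapply Rle_trans; [apply H3|]; nra).
assert (Hcos : Rabs (cos y) <= 1). { apply Rabs_le. apply COS_bound. }
assert (Hsin : Rabs (sin y) <= 2 * c).
  { rewrite Hsy. eapply Rle_trans. apply Rabs_triang. assert (Rabs sy <= 1 * Rabs y); [|lra].
  eapply Rle_trans; [apply H3|]; apply Rmult_le_compat_r; lra. }
replace (exp x * cos y + - (1) + - x) with (ex * cos y + (x * cy + cy)) by (rewrite Hex, Hcy;
  ring).
replace (exp x * sin y + - 0 + - y) with (ex * sin y + x * sin y + sy) by (rewrite Hex, Hsy at 1;
  rewrite Hsy; ring).
assert (T1 : Rabs (ex * cos y + (x * cy + cy)) <= E * c + (1/8 * (E * c) + E * c)).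
{ eapply Rle_trans. apply Rabs_triang. rewrite Rabs_mult. 
  assert (Rabs (x * cy + cy) <= 1/8 * (E * c) + E * c).
    { eapply Rle_trans. apply Rabs_triang. rewrite Rabs_mult. 
   assert (Rabs x * Rabs cy <= 1/8 * (E * c)).
     { apply Rmult_le_compat; try apply Rabs_pos; lra. } lra. }
  assert (Rabs ex * Rabs (cos y) <= (E * c) * 1).
    { apply Rmult_le_compat; try apply Rabs_pos; lra. } lra. }
assert (T2 : Rabs (ex * sin y + x * sin y + sy) <= (E * c) * (1/4) + E / 8 * (2 * c) + E * c).
{ eapply Rle_trans. apply Rabs_triang. eapply Rle_trans. apply Rplus_le_compat_r.
  apply Rabs_triang. rewrite !Rabs_mult.
  assert (Rabs ex * Rabs (sin y) <= (E * c) * (1/4)).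
    { apply Rmult_le_compat; try apply Rabs_pos; lra. }
  assert (Rabs x * Rabs (sin y) <= E / 8 * (2 * c)).
    { apply Rmult_le_compat; try apply Rabs_pos; lra. } lra. }
assert (0 <= E * c) by (apply Rmult_le_pos; [lra|apply Cmod_ge_0]).
lra.
Qed.

(** * Integrals of complex-valued functions of a real variable *)

Lemma is_CInt_components (f : R -> C) (a b : R) (l : C) :
  is_CInt f a b l <-> is_RInt (fun x => fst (f x)) a b (fst l) /\
    is_RInt (fun x => snd (f x)) a b (snd l).
Proof.
split.
- intros H. split. 
  apply (is_RInt_fct_extend_fst (U := R_NormedModule) (V := R_NormedModule) f a b l H).
  apply (is_RInt_fct_extend_snd (U := R_NormedModule) (V := R_NormedModule) f a b l H).
- intros [H1 H2]. apply (is_RInt_fct_extend_pair (U := R_NormedModule) (V :=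
  R_NormedModule) f a b (fst l) (snd l)) in H1; [|exact H2].
  rewrite (surjective_pairing l). exact H1.
Qed.

(** Real linearity of the integral does not cover complex factors. *)
Lemma is_CInt_Cmult (c : C) (f : R -> C) (a b : R) (l : C) :
  is_CInt f a b l -> is_CInt (fun x => c * f x)%C a b (c * l)%C.
Proof.
intros H. apply is_CInt_components in H. destruct H as [H1 H2].
apply is_CInt_components. simpl. split.
- apply (is_RInt_minus (V := R_NormedModule)); apply (is_RInt_scal (V := R_NormedModule));
  assumption.
- apply (is_RInt_plus (V := R_NormedModule)); apply (is_RInt_scal (V := R_NormedModule));
  assumption.
Qed.

Lemma CInt_correct (f : R -> C) (a b : R) : ex_CInt f a b -> is_CInt f a b (CInt f a b).
Proof. apply (RInt_correct (V := C_R_CompleteNormedModule)). Qed.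

Lemma CInt_unique (f : R -> C) (a b : R) (l : C) : is_CInt f a b l -> CInt f a b = l.
Proof. apply (is_RInt_unique (V := C_R_CompleteNormedModule)). Qed.

Lemma is_CInt_ext (f g : R -> C) (a b : R) (l : C) :
  (forall x, Rmin a b < x < Rmax a b -> f x = g x) -> is_CInt f a b l -> is_CInt g a b l.
Proof. apply (is_RInt_ext (V := C_R_NormedModule)). Qed.

Lemma is_CInt_plus (f g : R -> C) (a b : R) (l m : C) :
  is_CInt f a b l -> is_CInt g a b m -> is_CInt (fun x => f x + g x)%C a b (l + m)%C.
Proof. apply (is_RInt_plus (V := C_R_NormedModule)). Qed.

Lemma is_CInt_minus (f g : R -> C) (a b : R) (l m : C) :
  is_CInt f a b l -> is_CInt g a b m -> is_CInt (fun x => f x - g x)%C a b (l - m)%C.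
Proof. apply (is_RInt_minus (V := C_R_NormedModule)). Qed.

Lemma CInt_Chasles (f : R -> C) (a b c : R) :
  ex_CInt f a b -> ex_CInt f b c -> CInt f a c = (CInt f a b + CInt f b c)%C.
Proof. intros H1 H2. symmetry. apply (RInt_Chasles (V := C_R_CompleteNormedModule)); assumption.
  Qed.

Lemma Cmod_CInt_le (f : R -> C) (g : R -> R) (a b : R) (l : C) (m : R) : a <= b ->
  (forall x, a <= x <= b -> Cmod (f x) <= g x) ->
  is_CInt f a b l -> is_RInt g a b m -> Cmod l <= m.
Proof.
intros Hab H H1 H2. rewrite <- norm_C_R.
apply (norm_RInt_le (V := C_R_NormedModule) f g a b l m Hab); try assumption.
intros x Hx. rewrite norm_C_R. apply H, Hx.
Qed.

Lemma Cmod_CInt_le_const (f : R -> C) (a b : R) (l : C) (M : R) :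
  (forall x, Rmin a b <= x <= Rmax a b -> Cmod (f x) <= M) ->
  is_CInt f a b l -> Cmod l <= Rabs (b - a) * M.
Proof.
intros H H1. rewrite <- norm_C_R.
apply (norm_RInt_le_const_abs (V := C_R_NormedModule) f a b l M); try assumption.
intros x Hx. rewrite norm_C_R. apply H, Hx.
Qed.

Lemma ex_CInt_continuous (f : R -> C) (a b : R) :
  (forall x, Rmin a b <= x <= Rmax a b -> continuous (U := C_UniformSpace) f x) -> ex_CInt f a b.
Proof. apply (ex_RInt_continuous (V := C_R_CompleteNormedModule)). Qed.

Lemma continuous_pair (f g : R -> R) (x : R) :
  continuous f x -> continuous g x ->
    continuous (U := C_UniformSpace) (fun t => (f t, g t) : C) x.
Proof.
intros Hf Hg P [e HP].
specialize (Hf (fun u => ball (f x) e u)). specialize (Hg (fun u => ball (g x) e u)).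
assert (A1 := Hf (locally_ball (f x) e)). assert (A2 := Hg (locally_ball (g x) e)).
unfold filtermap in A1, A2. change (locally x (fun t => P (f t, g t))).
  generalize (filter_and (F := locally x) _ _ A1 A2). apply filter_imp. intros t [H1 H2].
  exact (HP (f t, g t) (conj H1 H2)).
Qed.

Lemma Cdiff_path_continuous (f : C -> C) (g h : R -> R) (x : R) :
  continuous g x -> continuous h x -> Cdiff f (g x, h x) ->
  continuous (U := C_UniformSpace) (fun t => f (g t, h t)) x.
Proof.
intros Hg Hh Hf. apply (continuous_comp (V := C_UniformSpace) (W := C_UniformSpace) (fun t =>
  (g t, h t) : C) f).
apply continuous_pair; assumption. apply Cdiff_continuous, Hf.
Qed.

Lemma ex_CInt_path (f : C -> C) (g h : R -> R) (a b : R) :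
  (forall x, continuous g x) -> (forall x, continuous h x) ->
  (forall x, Rmin a b <= x <= Rmax a b -> Cdiff f (g x, h x)) ->
  ex_CInt (fun t => f (g t, h t)) a b.
Proof.
intros Hg Hh Hf. apply ex_CInt_continuous. intros x Hx. apply Cdiff_path_continuous; auto.
Qed.

(** * Goursat's theorem on rectangles *)

(** The integral of f along the boundary of [x0, x1] x [y0, y1], counterclockwise. *)
Definition rect_int (f : C -> C) (x0 x1 y0 y1 : R) : C :=
  (CInt (fun x => f (x, y0)) x0 x1 + Ci * CInt (fun y => f (x1, y)) y0 y1
   - CInt (fun x => f (x, y1)) x0 x1 - Ci * CInt (fun y => f (x0, y)) y0 y1)%C.

Definition diff_rect (f : C -> C) (x0 x1 y0 y1 : R) : Prop :=
  forall x y, x0 <= x <= x1 -> y0 <= y <= y1 -> Cdiff f (x, y).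

Lemma ex_CInt_horiz (f : C -> C) x0 x1 y0 y1 y a b : diff_rect f x0 x1 y0 y1 ->
  y0 <= y <= y1 -> x0 <= a -> a <= b -> b <= x1 -> ex_CInt (fun x => f (x, y)) a b.
Proof.
intros H Hy Ha Hab Hb. apply (ex_CInt_path f (fun x => x) (fun _ => y)).
intros; apply continuous_id. intros; apply continuous_const.
intros x Hx. rewrite Rmin_left, Rmax_right in Hx by lra. apply H; lra.
Qed.

Lemma ex_CInt_vert (f : C -> C) x0 x1 y0 y1 x a b : diff_rect f x0 x1 y0 y1 ->
  x0 <= x <= x1 -> y0 <= a -> a <= b -> b <= y1 -> ex_CInt (fun y => f (x, y)) a b.
Proof.
intros H Hy Ha Hab Hb. apply (ex_CInt_path f (fun _ => x) (fun y => y)).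
intros; apply continuous_const. intros; apply continuous_id.
intros y Hx. rewrite Rmin_left, Rmax_right in Hx by lra. apply H; lra.
Qed.

Lemma rect_split (f : C -> C) x0 xm x1 y0 ym y1 :
  x0 <= xm <= x1 -> y0 <= ym <= y1 -> diff_rect f x0 x1 y0 y1 ->
  rect_int f x0 x1 y0 y1 =
  (rect_int f x0 xm y0 ym + rect_int f xm x1 y0 ym + rect_int f x0 xm ym y1
    + rect_int f xm x1 ym y1)%C.
Proof.
intros Hx Hy H. unfold rect_int.
rewrite (CInt_Chasles (fun x => f (x, y0)) x0 xm x1) by (eapply ex_CInt_horiz; try exact H; lra).
rewrite (CInt_Chasles (fun x => f (x, y1)) x0 xm x1) by (eapply ex_CInt_horiz; try exact H; lra).
rewrite (CInt_Chasles (fun y => f (x0, y)) y0 ym y1) by (eapply ex_CInt_vert; try exact H; lra).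
rewrite (CInt_Chasles (fun y => f (x1, y)) y0 ym y1) by (eapply ex_CInt_vert; try exact H; lra).
ring.
Qed.

Lemma is_CInt_affine (p v : C) (a b : R) (al be : C) :
  is_CInt (fun t => al * (p + v * t) + be)%C a b
    ((al * p + be) * RtoC (b - a) + al * v * RtoC ((b * b - a * a) / 2))%C.
Proof.
assert (H1 : is_RInt (fun _ : R => 1) a b (b - a)).
{ replace (b - a) with (scal (b - a) 1) by (unfold scal; simpl; unfold mult; simpl; ring).
  apply (is_RInt_const (V := R_NormedModule)). }
assert (H2 : is_RInt (fun t : R => t) a b ((b * b - a * a) / 2)).
{ replace ((b * b - a * a) / 2) with (minus (b * b / 2) (a * a / 2)) by (unfold minus, plus, opp;
  simpl; field).
  apply (is_RInt_derive (V := R_CompleteNormedModule) (fun t => t * t / 2)).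
  - intros x _. auto_derive; trivial. field.
  - intros x _. apply continuous_id. }
assert (H0 : is_RInt (fun _ : R => 0) a b 0).
{ assert (X := is_RInt_const (V := R_NormedModule) a b 0).
  unfold scal in X; simpl in X; unfold mult in X; simpl in X; rewrite Rmult_0_r in X. exact X. }
assert (K1 : is_CInt (fun _ => RtoC 1) a b (RtoC (b - a))).
{ apply is_CInt_components. simpl. split. exact H1.
  exact H0. }
assert (K2 : is_CInt (fun t => RtoC t) a b (RtoC ((b * b - a * a) / 2))).
{ apply is_CInt_components. simpl. split. exact H2.
  exact H0. }
apply (is_CInt_ext (fun t => (al * p + be) * RtoC 1 + (al * v) * RtoC t)%C).
intros; ring.
apply is_CInt_plus; apply is_CInt_Cmult; assumption.
Qed.

(** An affine function has a primitive, so its boundary integral is 0.  Near c only the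
    error of the first-order expansion of f contributes, over a path of length at most
    twice the sum of the sides. *)
Lemma rect_int_affine_error (f : C -> C) (c l : C) (eta : R) x0 x1 y0 y1 :
  x0 <= x1 -> y0 <= y1 -> 0 <= eta -> diff_rect f x0 x1 y0 y1 ->
  x0 <= fst c <= x1 -> y0 <= snd c <= y1 ->
  (forall x y, x0 <= x <= x1 -> y0 <= y <= y1 ->
     Cmod (f (x, y) - f c - ((x, y) - c) * l)%C <= eta * Cmod ((x, y) - c)%C) ->
  Cmod (rect_int f x0 x1 y0 y1) <= 4 * eta * ((x1 - x0) ^ 2 + (y1 - y0) ^ 2).
Proof.
intros Hx Hy He H Hc1 Hc2 Hf.
set (D := (x1 - x0) + (y1 - y0)).
assert (HD : forall x y, x0 <= x <= x1 -> y0 <= y <= y1 ->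
  Cmod (f (x, y) - (l * (x, y) + (f c - l * c)))%C <= eta * D).
{ intros x y Ax Ay. replace (f (x, y) - (l * (x, y) + (f c - l * c)))%C
  with (f (x, y) - f c - ((x, y) - c) * l)%C by ring.
  eapply Rle_trans. apply Hf; assumption. apply Rmult_le_compat_l; [assumption|].
  eapply Rle_trans. apply Cmod_le_Rabs. unfold Cminus, Cplus, Copp; simpl. unfold D.
  apply Rplus_le_compat; apply Rabs_le; lra. }
set (be := (f c - l * c)%C) in *.
assert (E1 : forall y, y0 <= y <= y1 -> exists r, Cmod r <= (x1 - x0) * (eta * D) /\
   CInt (fun x => f (x, y)) x0 x1 = ((l * (Ci * y) + be) * RtoC (x1 - x0) + l * 1
     * RtoC ((x1 * x1 - x0 * x0) / 2) + r)%C).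
{ intros y Ay. assert (I1 := CInt_correct _ _ _
  (ex_CInt_horiz f x0 x1 y0 y1 y x0 x1 H Ay (Rle_refl _) Hx (Rle_refl _))).
  assert (I2 := is_CInt_affine (Ci * y)%C 1 x0 x1 l be).
  assert (I3 := is_CInt_minus _ _ _ _ _ _ I1 I2). simpl in I3.
  eexists. split; [|]. 2: match goal with |- ?a = (?b + ?r)%C => instantiate (1 := (a - b)%C);
    ring end.
  replace ((x1 - x0) * (eta * D)) with (Rabs (x1 - x0) * (eta * D))
    by (rewrite Rabs_pos_eq by lra; ring).
  eapply Cmod_CInt_le_const; [|exact I3]. rewrite Rmin_left, Rmax_right by lra.
  intros x Ax. replace (Ci * y + 1 * x)%C with ((x, y) : C). apply HD; assumption.
  unfold Ci, Cplus, Cmult, RtoC; simpl; f_equal; ring. }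
assert (E2 : forall x, x0 <= x <= x1 -> exists r, Cmod r <= (y1 - y0) * (eta * D) /\
   CInt (fun y => f (x, y)) y0 y1 = ((l * x + be) * RtoC (y1 - y0) + l * Ci
     * RtoC ((y1 * y1 - y0 * y0) / 2) + r)%C).
{ intros x Ax. assert (I1 := CInt_correct _ _ _
  (ex_CInt_vert f x0 x1 y0 y1 x y0 y1 H Ax (Rle_refl _) Hy (Rle_refl _))).
  assert (I2 := is_CInt_affine x Ci y0 y1 l be).
  assert (I3 := is_CInt_minus _ _ _ _ _ _ I1 I2). simpl in I3.
  eexists. split; [|]. 2: match goal with |- ?a = (?b + ?r)%C => instantiate (1 := (a - b)%C);
    ring end.
  replace ((y1 - y0) * (eta * D)) with (Rabs (y1 - y0) * (eta * D))
    by (rewrite Rabs_pos_eq by lra; ring).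
  eapply Cmod_CInt_le_const; [|exact I3]. rewrite Rmin_left, Rmax_right by lra.
  intros y Ay. replace (x + Ci * y)%C with ((x, y) : C). apply HD; assumption.
  unfold Ci, Cplus, Cmult, RtoC; simpl; f_equal; ring. }
destruct (E1 y0 ltac:(lra)) as [r1 [R1 Q1]]. destruct (E1 y1 ltac:(lra)) as [r2 [R2 Q2]].
destruct (E2 x0 ltac:(lra)) as [r3 [R3 Q3]]. destruct (E2 x1 ltac:(lra)) as [r4 [R4 Q4]].
unfold rect_int. rewrite Q1, Q2, Q3, Q4.
match goal with |- Cmod ?e <= _ => replace e with (r1 + Ci * r4 - r2 - Ci * r3)%C end.
2:{ rewrite !RtoC_minus. ring. }
unfold Cminus. eapply Rle_trans. apply Cmod_triangle. 
eapply Rle_trans. apply Rplus_le_compat_r. apply Cmod_triangle.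
eapply Rle_trans. apply Rplus_le_compat_r. apply Rplus_le_compat_r. apply Cmod_triangle.
rewrite !Cmod_opp, !Cmod_mult, Cmod_Ci.
apply Rle_trans with (2 * eta * D * D); [unfold D in *; nra|].
unfold D. assert (0 <= eta * (x1 - x0 - (y1 - y0))^2) by (apply Rmult_le_pos;
  [lra|apply pow2_ge_0]). nra.
Qed.

Lemma nested_intervals (u v : nat -> R) :
  (forall n, u n <= u (S n)) -> (forall n, v (S n) <= v n) -> (forall n, u n <= v n) ->
  exists c, forall n, u n <= c <= v n.
Proof.
intros Hu Hv Huv.
assert (Mu : forall n k, u n <= u (n + k)%nat).
{ intros n; induction k; [rewrite Nat.add_0_r; lra|rewrite Nat.add_succ_r; eapply Rle_trans;
  [apply IHk|apply Hu]]. }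
assert (Mv : forall n k, v (n + k)%nat <= v n).
{ intros n; induction k; [rewrite Nat.add_0_r; lra|rewrite Nat.add_succ_r; eapply Rle_trans;
  [apply Hv|apply IHk]]. }
assert (X : forall n m, u n <= v m).
{ intros n m. eapply Rle_trans. apply (Mu n m). eapply Rle_trans. apply Huv. rewrite Nat.add_comm.
  apply Mv. }
destruct (completeness (fun x => exists n, x = u n)) as [c [Hc1 Hc2]].
- exists (v O). intros x [n ->]. apply X.
- exists (u O). exists O. reflexivity.
- exists c. intros n. split. apply Hc1. exists n. reflexivity.
  apply Hc2. intros x [m ->]. apply X.
Qed.

Section Goursat.
Variables (f : C -> C) (x0 x1 y0 y1 : R).
Hypothesis Hx : x0 <= x1.
Hypothesis Hy : y0 <= y1.
Hypothesis Hf : diff_rect f x0 x1 y0 y1.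

Let width (n : nat) := (x1 - x0) * (/ 2) ^ n.
Let height (n : nat) := (y1 - y0) * (/ 2) ^ n.
Let cell (n : nat) (c : R * R) := rect_int f (fst c) (fst c + width n) (snd c) (snd c + height n).
Let good (E : R) (n : nat) (c : R * R) := Cmod (cell n c) <= E * (width n ^ 2 + height n ^ 2).

(** The lower left vertex of the first quarter of the cell at c whose boundary integral
    is too large; by default the last quarter. *)
Let bad_quarter (E : R) (n : nat) (c : R * R) : R * R :=
  let a := (fst c + width (S n)) in let b := (snd c + height (S n)) in
  if Rle_dec (Cmod (cell (S n) c)) (E * (width (S n) ^ 2 + height (S n) ^ 2)) then
  if Rle_dec (Cmod (cell (S n) (a, snd c))) (E * (width (S n) ^ 2 + height (S n) ^ 2)) then
  if Rle_dec (Cmod (cell (S n) (fst c, b))) (E * (width (S n) ^ 2 + height (S n) ^ 2)) then (a, b)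
  else (fst c, b) else (a, snd c) else c.

Let bad_corner (E : R) := fix F (n : nat) := match n with O => (x0, y0) | S m =>
  bad_quarter E m (F m) end.

Lemma pow_half_pos n : 0 < (/ 2) ^ n.
Proof. apply pow_lt; lra. Qed.

Lemma width_half n : width n = width (S n) + width (S n).
Proof. unfold width; simpl; field. Qed.

Lemma height_half n : height n = height (S n) + height (S n).
Proof. unfold height; simpl; field. Qed.

Lemma width_ge_0 n : 0 <= width n.
Proof. unfold width. assert (H := pow_half_pos n). nra. Qed.

Lemma height_ge_0 n : 0 <= height n.
Proof. unfold height. assert (H := pow_half_pos n). nra. Qed.

Lemma bad_quarter_range E n c : fst c <= fst (bad_quarter E n c) <= fst c + width (S n) /\
  snd c <= snd (bad_quarter E n c) <= snd c + height (S n).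
Proof.
assert (H1 := width_ge_0 (S n)). assert (H2 := height_ge_0 (S n)).
unfold bad_quarter. destruct Rle_dec; [|lra].
destruct Rle_dec; [|cbn [fst snd]; lra]. destruct Rle_dec; cbn [fst snd]; lra.
Qed.

(** The bound is additive: the boundary integral is the sum over the quarters, and the
    four quarters have together the same sum of squares of sides as the cell. *)
Lemma bad_quarter_bad E n c : x0 <= fst c -> fst c + width n <= x1 -> y0 <= snd c ->
  snd c + height n <= y1 ->
  ~ good E n c -> ~ good E (S n) (bad_quarter E n c).
Proof.
intros A1 A2 A3 A4 Hb Hg. apply Hb. clear Hb.
assert (H1 := width_ge_0 (S n)). assert (H2 := height_ge_0 (S n)).
assert (H1' := width_half n). assert (H2' := height_half n).
unfold good in *. 
unfold bad_quarter in Hg. destruct Rle_dec as [G1|G1]; [|contradiction].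
destruct Rle_dec as [G2|G2] in Hg; [|contradiction].
destruct Rle_dec as [G3|G3] in Hg; [|contradiction].
unfold cell in *; simpl fst in *; simpl snd in *.
rewrite (rect_split f (fst c) (fst c + width (S n)) (fst c + width n) (snd c) (snd c
  + height (S n)) (snd c + height n)); try lra.
2:{ intros x y Ax Ay. apply Hf; lra. }
rewrite !Rplus_assoc, <- H1', <- H2' in *.
eapply Rle_trans. apply Cmod_triangle. 
eapply Rle_trans. apply Rplus_le_compat_r. apply Cmod_triangle.
eapply Rle_trans. apply Rplus_le_compat_r. apply Rplus_le_compat_r. apply Cmod_triangle.
replace (E * (width n ^ 2 + height n ^ 2)) with (4 * (E * (width (S n) ^ 2 + height (S n) ^ 2)))
  by (rewrite H1', H2'; ring).
lra.
Qed.

Lemma bad_corner_range E n : x0 <= fst (bad_corner E n) /\ fst (bad_corner E n) + width n <= x1 /\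
  y0 <= snd (bad_corner E n) /\ snd (bad_corner E n) + height n <= y1.
Proof.
induction n.
- simpl. unfold width, height; simpl. lra.
- destruct IHn as [I1 [I2 [I3 I4]]]. simpl. 
  assert (P := bad_quarter_range E n (bad_corner E n)). 
  assert (H1' := width_half n). assert (H2' := height_half n). lra.
Qed.

(** Otherwise repeated quartering yields nested cells which violate the bound and shrink
    to a point c, where differentiability contradicts [rect_int_affine_error]. *)
Lemma rect_int_le_eps E : 0 < E -> Cmod (rect_int f x0 x1 y0 y1)
  <= E * ((x1 - x0) ^ 2 + (y1 - y0) ^ 2).
Proof.
intros HE.
assert (H0 : good E 0 (x0, y0) <-> Cmod (rect_int f x0 x1 y0 y1)
  <= E * ((x1 - x0) ^ 2 + (y1 - y0) ^ 2)).
{ unfold good, cell, width, height; simpl fst; simpl snd; simpl pow at 1 2. simpl ((/ 2) ^ 0).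
  rewrite !Rmult_1_r.
  replace (x0 + (x1 - x0)) with x1 by ring. replace (y0 + (y1 - y0)) with y1 by ring. tauto. }
apply H0. destruct (Rle_dec (Cmod (cell 0 (x0, y0))) (E * (width 0 ^ 2 + height 0 ^ 2))) as [G|G];
  [exact G|exfalso].
assert (Hbad : forall n, ~ good E n (bad_corner E n)).
{ induction n; [exact G|]. simpl. apply bad_quarter_bad; try assumption; apply bad_corner_range. }
destruct (nested_intervals (fun n => fst (bad_corner E n)) (fun n =>
  fst (bad_corner E n) + width n)) as [cx Hcx].
- intros n. apply (bad_quarter_range E n (bad_corner E n)).
- intros n. assert (H := bad_quarter_range E n (bad_corner E n)). simpl.
  assert (H1' := width_half n). lra.
- intros n. assert (H := width_ge_0 n). lra.
- destruct (nested_intervals (fun n => snd (bad_corner E n)) (fun n =>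
  snd (bad_corner E n) + height n)) as [cy Hcy].
  + intros n. apply (bad_quarter_range E n (bad_corner E n)).
  + intros n. assert (H := bad_quarter_range E n (bad_corner E n)). simpl.
    assert (H1' := height_half n). lra.
  + intros n. assert (H := height_ge_0 n). lra.
  + assert (Hd : Cdiff f (cx, cy)).
    { specialize (Hcx O). specialize (Hcy O).
      unfold width in Hcx; unfold height in Hcy; simpl in Hcx, Hcy. apply Hf; lra. }
    apply Cdiff_eps in Hd. destruct Hd as [l Hd].
    destruct (Hd (E / 4)) as [d [Hd0 Hd1]]; [lra|].
    set (S0 := (x1 - x0) + (y1 - y0) + 1).
    destruct (pow_lt_1_zero (/ 2)) with (y := d / S0) as [N HN].
    { rewrite Rabs_pos_eq; lra. } { apply Rdiv_lt_0_compat; unfold S0; lra. }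
    specialize (HN N (Nat.le_refl _)). rewrite Rabs_pos_eq in HN by (left; apply pow_half_pos).
    assert (HN' : width N + height N < d).
    { unfold width, height. assert (P := pow_half_pos N).
      apply Rle_lt_trans with (S0 * (/ 2) ^ N).
      unfold S0; nra. apply Rlt_le_trans with (S0 * (d / S0)).
        apply Rmult_lt_compat_l; [unfold S0; lra|exact HN].
      right; field; unfold S0; lra. }
    apply (Hbad N). unfold good, cell. 
    assert (I := bad_corner_range E N). destruct I as [I1 [I2 [I3 I4]]].
    specialize (Hcx N). specialize (Hcy N). simpl in Hcx, Hcy.
    set (c := bad_corner E N) in *. assert (W1 := width_ge_0 N). assert (W2 := height_ge_0 N).
    replace (E * (width N ^ 2 + height N ^ 2))
      with (4 * (E / 4) * ((fst c + width N - fst c) ^ 2 + (snd c + height N - snd c) ^ 2))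
      by field.
    apply rect_int_affine_error with (c := (cx, cy)) (l := l); simpl fst; simpl snd; try lra.
    * intros x y Ax Ay. apply Hf; lra.
    * intros x y Ax Ay. apply Hd1. eapply Rle_lt_trans. apply Cmod_le_Rabs.
      unfold Cminus, Cplus, Copp; simpl. 
      assert (Rabs (x + - cx) <= width N) by (apply Rabs_le; lra).
      assert (Rabs (y + - cy) <= height N) by (apply Rabs_le; lra). lra.
Qed.

Theorem goursat : rect_int f x0 x1 y0 y1 = RtoC 0.
Proof.
apply Cmod_eq_0. apply Rle_antisym; [|apply Cmod_ge_0].
apply le_epsilon. intros e He. rewrite Rplus_0_l.
set (S0 := (x1 - x0) ^ 2 + (y1 - y0) ^ 2).
assert (HS : 0 <= S0) by (unfold S0; assert (A1 := pow2_ge_0 (x1 - x0));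
  assert (A2 := pow2_ge_0 (y1 - y0)); lra).
eapply Rle_trans. apply (rect_int_le_eps (e / (S0 + 1))). apply Rdiv_lt_0_compat; lra.
fold S0. apply Rle_trans with (e / (S0 + 1) * (S0 + 1)). 
apply Rmult_le_compat_l; [left; apply Rdiv_lt_0_compat; lra|lra]. right; field; lra.
Qed.

End Goursat.

(** * Cauchy's theorem in polar coordinates and the maximum principle on discs *)

Lemma scal_R_C (r : R) (z : C_R_NormedModule) : scal r z = (RtoC r * z)%C.
Proof. unfold scal; simpl. unfold prod_scal, Cmult, RtoC; simpl.
  unfold scal; simpl; unfold mult; simpl. f_equal; ring. Qed.

Lemma cexp_polar (r t : R) : 0 < r -> cexp (ln r, t) = (r * cis t)%C.
Proof. intros H. rewrite cexp_cis. simpl. rewrite exp_ln; auto. Qed.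

Lemma is_CInt_polar (F : C -> C) (a b t : R) : 0 < a <= b ->
  (forall r, a <= r <= b -> Cdiff F (r * cis t)%C) ->
  is_CInt (fun r => / r * F (r * cis t))%C a b (CInt (fun x => F (cexp (x, t))) (ln a) (ln b)).
Proof.
intros Hab HF.
assert (H := is_RInt_comp (V := C_R_CompleteNormedModule) (fun x => F (cexp (x, t))) ln Rinv a b).
rewrite Rmin_left, Rmax_right in H by lra.
apply (is_CInt_ext (fun r => scal (/ r) (F (cexp (ln r, t)) : C_R_NormedModule))); [|apply H].
- intros r Hr. rewrite Rmin_left, Rmax_right in Hr by lra.
  rewrite cexp_polar by lra. etransitivity. apply (scal_R_C (/ r) (F (r * cis t)%C)). 
  rewrite RtoC_inv by lra. reflexivity.
- intros r Hr. apply (Cdiff_path_continuous (fun z => F (cexp z)) (fun x => x) (fun _ => t)).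
  apply continuous_id. apply continuous_const.
  apply Cdiff_comp; [|apply Cdiff_cexp]. rewrite cexp_polar by lra. apply HF, Hr.
- intros r Hr. split. 
  + auto_derive. lra. field; lra.
  + apply (ex_derive_continuous (K := R_AbsRing) (V := R_NormedModule)). auto_derive. lra.
Qed.

Definition diff_polar (F : C -> C) (a b al be : R) : Prop :=
  forall r t, a <= r <= b -> al <= t <= be -> Cdiff F (r * cis t)%C.

Lemma ex_CInt_arc (F : C -> C) (a b al be r : R) : 0 < a -> al <= be -> diff_polar F a b al be ->
  a <= r <= b ->
  ex_CInt (fun t => F (r * cis t)%C) al be.
Proof.
intros Ha Hal HF Hr.
eapply (ex_RInt_ext (V := C_R_NormedModule));
  [|apply (ex_CInt_path (fun z => F (cexp z)) (fun _ => ln r) (fun t => t))].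
- intros t _. simpl. rewrite cexp_polar by lra. reflexivity.
- intros; apply continuous_const.
- intros; apply continuous_id.
- intros t Ht. rewrite Rmin_left, Rmax_right in Ht by lra.
  apply Cdiff_comp; [|apply Cdiff_cexp]. rewrite cexp_polar by lra. apply HF; assumption.
Qed.

Lemma ln_le_compat (a b : R) : 0 < a -> a <= b -> ln a <= ln b.
Proof. intros Ha [H| ->]; [left; apply ln_increasing; assumption|right; reflexivity]. Qed.

(** In the coordinate w = ln u, for which du/u = dw, a sector of an annulus becomes a
    rectangle and rays and arcs become its sides. *)
Lemma cauchy_polar (F : C -> C) (a b al be : R) : 0 < a <= b -> al <= be ->
  diff_polar F a b al be ->
  (CInt (fun r => / r * F (r * cis be)) a b - CInt (fun r => / r * F (r * cis al)) a b)%C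
  = (Ci * (CInt (fun t => F (b * cis t)) al be - CInt (fun t => F (a * cis t)) al be))%C.
Proof.
intros Hab Hal HF.
rewrite (CInt_unique _ _ _ _ (is_CInt_polar F a b be Hab (fun r Hr =>
  HF r be Hr (conj Hal (Rle_refl _))))).
rewrite (CInt_unique _ _ _ _ (is_CInt_polar F a b al Hab (fun r Hr =>
  HF r al Hr (conj (Rle_refl _) Hal)))).
assert (HG : diff_rect (fun z => F (cexp z)) (ln a) (ln b) al be).
{ intros x y Hx Hy. apply Cdiff_comp; [|apply Cdiff_cexp].
  rewrite <- (ln_exp x), cexp_polar by apply exp_pos. apply HF; [|exact Hy].
  split. rewrite <- (exp_ln a) by lra.
    destruct Hx as [[Hx| <-] _]; [left; apply exp_increasing; exact Hx|right; reflexivity].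
  rewrite <- (exp_ln b) by lra. destruct Hx as [_ [Hx| ->]];
    [left; apply exp_increasing; exact Hx|right; reflexivity]. }
assert (H := goursat _ _ _ _ _ (ln_le_compat a b (proj1 Hab) (proj2 Hab)) Hal HG).
unfold rect_int in H.
assert (E : forall r, 0 < r -> CInt (fun t => F (r * cis t)%C) al be = CInt (fun y =>
  F (cexp (ln r, y))) al be).
{ intros r Hr. unfold CInt. apply (RInt_ext (V := C_R_CompleteNormedModule)). intros t _.
  rewrite cexp_polar by exact Hr. reflexivity. }
rewrite (E b) by lra. rewrite (E a) by lra.
match type of H with (?A + Ci * ?B - ?Cc - Ci * ?D)%C = _ => 
 replace (Ci * (B - D))%C with ((A + Ci * B - Cc - Ci * D) + (Cc - A))%C by ring end.
rewrite H. ring.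
Qed.

Lemma cis_2PI : cis (2 * PI) = cis 0.
Proof. unfold cis. rewrite cos_2PI, sin_2PI, cos_0, sin_0. reflexivity. Qed.

Lemma Cmod_polar (r t : R) : 0 <= r -> Cmod (r * cis t) = r.
Proof. intros H. rewrite Cmod_mult, Cmod_cis, Cmod_R, Rabs_pos_eq; lra. Qed.

(** For f (u0 + u) the two sides of the slit annulus cancel in [cauchy_polar], so the mean
    of f over circles around u0 does not depend on the radius; as the radius tends to 0
    it tends to f u0. *)
Lemma Cmod_le_of_circle (f : C -> C) (u0 : C) (r M : R) : 0 < r ->
  (forall u, Cmod (u - u0) <= r -> Cdiff f u) ->
  (forall u, Cmod (u - u0) = r -> Cmod (f u) <= M) ->
  Cmod (f u0) <= M.
Proof.
intros Hr Hf HM. apply le_epsilon. intros e He.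
assert (Hd : Cdiff f u0). { apply Hf. replace (u0 - u0)%C with (RtoC 0) by ring. rewrite Cmod_0.
  lra. }
apply Cdiff_continuous in Hd.
assert (Hl : locally (T := C_UniformSpace) (f u0) (fun v => Cmod (v - f u0) < e)).
{ apply locally_Cmod. exists e. auto. }
apply Hd in Hl. apply (proj1 (locally_Cmod u0 (fun u => Cmod (f u - f u0) < e))) in Hl.
  destruct Hl as [d [Hd0 Hd1]].
set (a := Rmin r (d / 2)).
assert (Ha : 0 < a) by (apply Rmin_glb_lt; lra).
assert (Har : a <= r) by apply Rmin_l. assert (Had : a <= d / 2) by apply Rmin_r.
set (F := fun u => f (u0 + u)%C).
assert (HF : diff_polar F a r 0 (2 * PI)).
{ intros s t Hs Ht. apply (Cdiff_comp f (fun u => u0 + u)%C). apply Hf.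
  replace (u0 + s * cis t - u0)%C with (s * cis t)%C by ring.
  rewrite Cmod_polar; lra. apply Cdiff_plus. apply Cdiff_const. apply Cdiff_id. }
assert (HPI := PI_RGT_0).
assert (Hc := cauchy_polar F a r 0 (2 * PI) (conj Ha Har) ltac:(lra) HF).
rewrite cis_2PI in Hc. unfold Cminus at 1 in Hc. rewrite Cplus_opp_r in Hc.
assert (I1 := CInt_correct _ _ _ (ex_CInt_arc F a r 0 (2 * PI) r Ha ltac:(lra) HF ltac:(lra))).
assert (I2 := CInt_correct _ _ _ (ex_CInt_arc F a r 0 (2 * PI) a Ha ltac:(lra) HF ltac:(lra))).
set (A1 := CInt (fun t : R => F (r * cis t)%C) 0 (2 * PI)) in *.
set (A2 := CInt (fun t : R => F (a * cis t)%C) 0 (2 * PI)) in *.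
assert (EA : A1 = A2).
{ assert (X : (A1 - A2)%C = RtoC 0).
  { replace (A1 - A2)%C with (- Ci * (Ci * (A1 - A2)))%C. rewrite <- Hc. ring.
    unfold Ci, Cmult, Cminus, Cplus, Copp; simpl. apply injective_projections; simpl; ring. }
  replace A1 with (A1 - A2 + A2)%C by ring. rewrite X. ring. }
assert (B1 : Cmod A1 <= Rabs (2 * PI - 0) * M).
{ eapply Cmod_CInt_le_const; [|exact I1]. intros t Ht. apply HM. 
  replace (u0 + r * cis t - u0)%C with (r * cis t)%C by ring. apply Cmod_polar; lra. }
assert (I3 : is_CInt (fun _ => f u0) 0 (2 * PI) ((2 * PI - 0)%R * f u0)%C).
{ assert (X := is_RInt_const (V := C_R_NormedModule) 0 (2 * PI) (f u0)). rewrite scal_R_C in X.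
  exact X. }
assert (I4 := is_CInt_minus _ _ _ _ _ _ I3 I2).
(* a is so small that f is within e of f u0 on the circle of radius a. *)
assert (B2 : Cmod ((2 * PI - 0)%R * f u0 - A2) <= Rabs (2 * PI - 0) * e).
{ eapply Cmod_CInt_le_const; [|exact I4]. intros t Ht. cbv beta.
  replace (f u0 - F (a * cis t))%C with (- (f (u0 + a * cis t)%C - f u0))%C by (unfold F; ring).
    rewrite Cmod_opp.
  left; apply Hd1. replace (u0 + a * cis t - u0)%C with (a * cis t)%C by ring.
    rewrite Cmod_polar; lra. }
rewrite Rabs_pos_eq in B1, B2 by lra.
assert (B3 : Cmod ((2 * PI - 0)%R * f u0) <= (2 * PI - 0) * (M + e)).
{ replace ((2 * PI - 0)%R * f u0)%C with (((2 * PI - 0)%R * f u0 - A2) + A1)%C by (rewrite EA;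
  ring).
  eapply Rle_trans. apply Cmod_triangle. lra. }
rewrite Cmod_mult, Cmod_R, Rabs_pos_eq in B3 by lra.
apply Rmult_le_reg_l in B3; lra.
Qed.

(** * Complex series, Tannery's theorem and entire power series *)

Definition Csummable (a : nat -> C) : Prop := ex_series (fun n => Cmod (a n)).

Lemma Csummable_le (a : nat -> C) (b : nat -> R) :
  (forall n, Cmod (a n) <= b n) -> ex_series b -> Csummable a.
Proof.
intros H Hb. apply (ex_series_le (K := R_AbsRing) (V := R_CompleteNormedModule) _ b); [|exact Hb].
intros n. unfold norm; simpl; unfold abs; simpl. rewrite Rabs_pos_eq; [apply H|apply Cmod_ge_0].
Qed.

Lemma Csummable_fst (a : nat -> C) : Csummable a -> ex_series (fun n => fst (a n)).
Proof.
intros H. apply (ex_series_le (K := R_AbsRing) (V := R_CompleteNormedModule) _ (fun n =>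
  Cmod (a n))); [|exact H].
intros n. apply Rabs_fst_le.
Qed.

Lemma Csummable_snd (a : nat -> C) : Csummable a -> ex_series (fun n => snd (a n)).
Proof.
intros H. apply (ex_series_le (K := R_AbsRing) (V := R_CompleteNormedModule) _ (fun n =>
  Cmod (a n))); [|exact H].
intros n. apply Rabs_snd_le.
Qed.

Lemma Csummable_plus (a b : nat -> C) : Csummable a -> Csummable b ->
  Csummable (fun n => a n + b n)%C.
Proof.
intros Ha Hb. apply Csummable_le with (b := fun n => Cmod (a n) + Cmod (b n)).
intros n; apply Cmod_triangle. apply (ex_series_plus (V := R_NormedModule)); assumption.
Qed.

Lemma Csummable_scal (c : C) (a : nat -> C) : Csummable a -> Csummable (fun n => c * a n)%C.
Proof.
intros Ha. apply Csummable_le with (b := fun n => Cmod c * Cmod (a n)).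
intros n; rewrite Cmod_mult; lra. apply (ex_series_scal (K := R_AbsRing) (V :=
  R_NormedModule) (Cmod c)). exact Ha.
Qed.

Lemma Csummable_minus (a b : nat -> C) : Csummable a -> Csummable b ->
  Csummable (fun n => a n - b n)%C.
Proof.
intros Ha Hb. apply (Csummable_plus a (fun n => - b n)%C Ha).
apply Csummable_le with (b := fun n => Cmod (b n)). intros; rewrite Cmod_opp; lra. exact Hb.
Qed.

Lemma CSeries_ext (a b : nat -> C) : (forall n, a n = b n) -> CSeries a = CSeries b.
Proof. intros H. unfold CSeries. f_equal; apply Series_ext; intros n; rewrite H; reflexivity. Qed.

Lemma CSeries_plus (a b : nat -> C) : Csummable a -> Csummable b ->
  CSeries (fun n => a n + b n)%C = (CSeries a + CSeries b)%C.
Proof.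
intros Ha Hb. unfold CSeries. unfold Cplus at 3. simpl.
f_equal; [apply Series_plus|apply Series_plus]; try (apply Csummable_fst; assumption);
  apply Csummable_snd; assumption.
Qed.

Lemma CSeries_scal (c : C) (a : nat -> C) : Csummable a ->
  CSeries (fun n => c * a n)%C = (c * CSeries a)%C.
Proof.
intros Ha. assert (H1 := Csummable_fst _ Ha). assert (H2 := Csummable_snd _ Ha).
unfold CSeries, Cmult; simpl. f_equal.
- rewrite Series_minus by (apply (ex_series_scal (K := R_AbsRing) (V := R_NormedModule));
  assumption).
  rewrite !Series_scal_l. reflexivity.
- rewrite Series_plus by (apply (ex_series_scal (K := R_AbsRing) (V := R_NormedModule));
  assumption).
  rewrite !Series_scal_l. reflexivity.
Qed.

Lemma CSeries_minus (a b : nat -> C) : Csummable a -> Csummable b ->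
  CSeries (fun n => a n - b n)%C = (CSeries a - CSeries b)%C.
Proof.
intros Ha Hb. rewrite (CSeries_ext _ (fun n => a n + (- RtoC 1) * b n)%C) by (intros; ring).
rewrite CSeries_plus, CSeries_scal; auto. ring. apply Csummable_scal, Hb.
Qed.

Lemma CSeries_incr_1 (a : nat -> C) : Csummable a ->
  CSeries a = (a O + CSeries (fun n => a (S n)))%C.
Proof.
intros Ha. unfold CSeries. rewrite (Series_incr_1 (fun n => fst (a n))),
  (Series_incr_1 (fun n => snd (a n))).
reflexivity. apply Csummable_snd, Ha. apply Csummable_fst, Ha.
Qed.

Lemma Csummable_incr_1 (a : nat -> C) : Csummable a <-> Csummable (fun n => a (S n)).
Proof. apply (ex_series_incr_1 (K := R_AbsRing) (V := R_NormedModule) (fun n => Cmod (a n))). Qed.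

Definition Csum (a : nat -> C) (n : nat) : C := sum_n (G := C_AbelianMonoid) a n.

Lemma Csum_S (a : nat -> C) n : Csum a (S n) = (Csum a n + a (S n))%C.
Proof. apply (sum_Sn (G := C_AbelianMonoid)). Qed.

Lemma Csum_O (a : nat -> C) : Csum a 0 = a O.
Proof. apply (sum_O (G := C_AbelianMonoid)). Qed.

Lemma fst_Csum (a : nat -> C) n : fst (Csum a n) = sum_n (fun k => fst (a k)) n.
Proof. induction n; [rewrite Csum_O, sum_O; reflexivity|]. rewrite Csum_S, sum_Sn, <- IHn.
  reflexivity. Qed.

Lemma snd_Csum (a : nat -> C) n : snd (Csum a n) = sum_n (fun k => snd (a k)) n.
Proof. induction n; [rewrite Csum_O, sum_O; reflexivity|]. rewrite Csum_S, sum_Sn, <- IHn.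
  reflexivity. Qed.

Lemma Cmod_Csum_le (a : nat -> C) n : Cmod (Csum a n) <= sum_n (fun k => Cmod (a k)) n.
Proof.
induction n. rewrite Csum_O, sum_O; lra.
rewrite Csum_S, sum_Sn. unfold plus; simpl. eapply Rle_trans. apply Cmod_triangle. lra.
Qed.

Lemma sum_n_le_Series (a : nat -> R) n : (forall k, 0 <= a k) -> ex_series a ->
  sum_n a n <= Series a.
Proof.
intros Ha H. apply Series_correct in H.
apply (is_lim_seq_incr_compare (sum_n a)); [exact H|].
intros k. rewrite sum_Sn. unfold plus; simpl. specialize (Ha (S k)). lra.
Qed.

Lemma Csum_lim (a : nat -> C) : Csummable a ->
  is_lim_seq (fun n => Cmod (Csum a n - CSeries a)) 0.
Proof.
intros Ha. 
assert (H1 := Series_correct _ (Csummable_fst _ Ha)).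
  assert (H2 := Series_correct _ (Csummable_snd _ Ha)).
assert (G1 : is_lim_seq (fun n => Rabs (sum_n (fun k => fst (a k)) n - Series (fun k =>
  fst (a k)))) 0).
{ apply (proj1 (is_lim_seq_abs_0 _)).
  replace (Finite 0) with (Rbar_minus (Series (fun k => fst (a k))) (Series (fun k => fst (a k))))
  by (simpl; f_equal; ring).
  apply is_lim_seq_minus'. exact H1. apply is_lim_seq_const. }
assert (G2 : is_lim_seq (fun n => Rabs (sum_n (fun k => snd (a k)) n - Series (fun k =>
  snd (a k)))) 0).
{ apply (proj1 (is_lim_seq_abs_0 _)).
  replace (Finite 0) with (Rbar_minus (Series (fun k => snd (a k))) (Series (fun k => snd (a k))))
  by (simpl; f_equal; ring).
  apply is_lim_seq_minus'. exact H2. apply is_lim_seq_const. }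
assert (G3 := is_lim_seq_plus' _ _ _ _ G1 G2). rewrite Rplus_0_r in G3.
apply (is_lim_seq_le_le (fun _ => 0) _ _ 0) with (3 := G3); [|apply is_lim_seq_const].
intros n. split. apply Cmod_ge_0. eapply Rle_trans. apply Cmod_le_Rabs.
rewrite <- fst_Csum, <- snd_Csum. right. reflexivity.
Qed.

Lemma Cmod_CSeries_le (a : nat -> C) : Csummable a ->
  Cmod (CSeries a) <= Series (fun n => Cmod (a n)).
Proof.
intros Ha. assert (H := Csum_lim a Ha).
assert (H' : is_lim_seq (fun n => Series (fun n =>
  Cmod (a n)) + Cmod (Csum a n - CSeries a)) (Series (fun n => Cmod (a n)) + 0)).
{ apply is_lim_seq_plus'. apply is_lim_seq_const. exact H. }
rewrite Rplus_0_r in H'.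
apply (is_lim_seq_le (fun _ => Cmod (CSeries a)) _ (Cmod (CSeries a)) (Series (fun n =>
  Cmod (a n)))) with (2 := is_lim_seq_const _) (3 := H').
intros n. replace (CSeries a) with (Csum a n + - (Csum a n - CSeries a))%C at 1 by ring.
eapply Rle_trans. apply Cmod_triangle. rewrite Cmod_opp. apply Rplus_le_compat_r.
eapply Rle_trans. apply Cmod_Csum_le. apply sum_n_le_Series. intros; apply Cmod_ge_0. exact Ha.
Qed.

Lemma Cmod_CSeries_minus_le (a : nat -> C) (N : nat) : Csummable a ->
  Cmod (CSeries a) <= sum_n (fun k => Cmod (a k)) N + Series (fun n => Cmod (a (S N + n)%nat)).
Proof.
intros Ha. eapply Rle_trans. apply Cmod_CSeries_le, Ha.
rewrite (Series_incr_n _ (S N)); [|lia|exact Ha]. simpl Nat.pred.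
rewrite sum_n_Reals. lra.
Qed.

Lemma is_lim_seq_sum_n (u : nat -> nat -> R) (N : nat) :
  (forall k, is_lim_seq (fun n => u n k) 0) -> is_lim_seq (fun n => sum_n (u n) N) 0.
Proof.
intros H. induction N.
- apply (is_lim_seq_ext (fun n => u n O)). intros; rewrite sum_O; reflexivity. apply H.
- apply (is_lim_seq_ext (fun n => sum_n (u n) N + u n (S N))).
  intros; rewrite sum_Sn; reflexivity.
  replace 0 with (0 + 0) by ring. apply is_lim_seq_plus'; [exact IHN|apply H].
Qed.

Lemma Series_tail_lim (b : nat -> R) : ex_series b ->
  is_lim_seq (fun N => Series (fun n => b (S N + n)%nat)) 0.
Proof.
intros H. assert (H1 := Series_correct _ H).
apply (is_lim_seq_ext (fun N => Series b - sum_n b N)).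
- intros N. rewrite (Series_incr_n b (S N)); [|lia|exact H]. simpl Nat.pred. rewrite sum_n_Reals.
  ring.
- replace (Finite 0) with (Rbar_minus (Series b) (Series b)) by (simpl; f_equal; ring).
  apply is_lim_seq_minus'. apply is_lim_seq_const. exact H1.
Qed.

(** Dominated convergence for series, for terms that tend to 0. *)
Lemma tannery (a : nat -> nat -> C) (b : nat -> R) :
  (forall n k, Cmod (a n k) <= b k) -> ex_series b ->
  (forall k, is_lim_seq (fun n => Cmod (a n k)) 0) ->
  is_lim_seq (fun n => Cmod (CSeries (a n))) 0.
Proof.
intros Hab Hb Hl. apply is_lim_seq_spec. intros e.
assert (He := cond_pos e).
assert (Ht := Series_tail_lim b Hb). apply is_lim_seq_spec in Ht.
destruct (Ht (pos_div_2 e)) as [N HN]. specialize (HN N (Nat.le_refl _)).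
assert (Hs := is_lim_seq_sum_n (fun n k => Cmod (a n k)) N Hl). apply is_lim_seq_spec in Hs.
destruct (Hs (pos_div_2 e)) as [M HM]. exists M. intros n Hn. specialize (HM n Hn).
rewrite Rminus_0_r in *. simpl in HN, HM.
assert (Hsa : Csummable (a n)) by (apply Csummable_le with b; auto).
rewrite Rabs_pos_eq by apply Cmod_ge_0.
eapply Rle_lt_trans. apply (Cmod_CSeries_minus_le _ N Hsa).
assert (Series (fun m => Cmod (a n (S N + m)%nat)) <= Series (fun m => b (S N + m)%nat)).
{ apply Series_le. intros m; split; [apply Cmod_ge_0|apply Hab].
  apply (ex_series_incr_n b (S N)), Hb. }
assert (A1 := Rle_abs (sum_n (fun k => Cmod (a n k)) N)).
  assert (A2 := Rle_abs (Series (fun m => b (S N + m)%nat))).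
simpl in *. lra.
Qed.

Definition entire (a : nat -> C) : Prop := forall r, 0 <= r ->
  ex_series (fun n => Cmod (a n) * r ^ n).

Lemma entire_summable (a : nat -> C) (z : C) : entire a -> Csummable (fun n => a n * z ^ n)%C.
Proof.
intros H. apply Csummable_le with (b := fun n => Cmod (a n) * Cmod z ^ n).
intros n. rewrite Cmod_mult, Cmod_pow. lra. apply H, Cmod_ge_0.
Qed.

(** The derivative of the n-th power. *)
Definition dpow (z : C) (n : nat) : C := (INR n * z ^ (pred n))%C.

Lemma INR_le_pow2 n : INR n <= 2 ^ n.
Proof. induction n. simpl; lra. rewrite S_INR. simpl.
  assert (1 <= 2 ^ n) by (apply pow_R1_Rle; lra). lra. Qed.

(** The remainders e_n satisfy e_{n+1} = w e_n + (w - z)^2 n z^{n-1}; the factor 4^n leaves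
    room for the n terms that accumulate and is harmless for an entire series. *)
Lemma pow_taylor (z w : C) (rho : R) (n : nat) : 1 <= rho -> Cmod z <= rho -> Cmod w <= rho ->
  Cmod (w ^ n - z ^ n - (w - z) * dpow z n) <= (4 * rho) ^ n * Cmod (w - z) ^ 2.
Proof.
intros Hr Hz Hw. induction n.
- unfold dpow; simpl. replace (1 - 1 - (w - z) * (0 * 1))%C with (RtoC 0) by ring.
  rewrite Cmod_0. assert (H := pow2_ge_0 (Cmod (w - z))). simpl in H. lra.
- replace (w ^ S n - z ^ S n - (w - z) * dpow z (S n))%C
    with (w * (w ^ n - z ^ n - (w - z) * dpow z n) + dpow z n * ((w - z) * (w - z)))%C.
  2:{ unfold dpow. rewrite S_INR, RtoC_plus. destruct n; simpl; ring. }
  eapply Rle_trans. apply Cmod_triangle. rewrite !Cmod_mult.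
  set (D := Cmod (w - z)) in *. assert (HD : 0 <= D) by apply Cmod_ge_0.
  assert (B1 : Cmod w * Cmod (w ^ n - z ^ n - (w - z) * dpow z n)
    <= rho * ((4 * rho) ^ n * D ^ 2)).
  { apply Rmult_le_compat; auto; apply Cmod_ge_0. }
  assert (B2 : Cmod (dpow z n) <= rho * (4 * rho) ^ n).
  { unfold dpow. rewrite Cmod_mult, Cmod_pow, Cmod_R, Rabs_pos_eq by apply pos_INR.
    rewrite Rpow_mult_distr. 
    assert (T1 : INR n <= 4 ^ n). { eapply Rle_trans. apply INR_le_pow2. apply pow_incr; lra. }
    assert (T2 : Cmod z ^ pred n <= rho ^ n).
    { apply Rle_trans with (rho ^ pred n). apply pow_incr; split; [apply Cmod_ge_0|exact Hz].
      apply Rle_pow; [lra|lia]. }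
    assert (T3 := Rmult_le_compat _ _ _ _ (pos_INR n) (pow_le _ (pred n) (Cmod_ge_0 z)) T1 T2).
    assert (0 <= 4 ^ n * rho ^ n). { apply Rmult_le_pos; apply pow_le; lra. } nra. }
  assert (HD2 : 0 <= D * D) by nra.
  assert (B3 := Rmult_le_compat_r _ _ _ HD2 B2).
  assert (0 <= (4 * rho) ^ n) by (apply pow_le; lra).
  assert (0 <= (4 * rho) ^ n * (D * D)) by (apply Rmult_le_pos; auto).
  simpl. nra.
Qed.

Lemma Cdiff_entire (a : nat -> C) (z : C) : entire a ->
  Cdiff (fun w => CSeries (fun n => a n * w ^ n)%C) z.
Proof.
intros Ha. set (rho := Cmod z + 1). assert (Hz := Cmod_ge_0 z).
apply Cdiff_quadratic with (l := CSeries (fun n => a n * dpow z n)%C) (d := 1) (M :=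
  Series (fun n => Cmod (a n) * (4 * rho) ^ n)); [lra|].
intros w Hw.
assert (Hw' : Cmod w <= rho).
{ replace w with (z + (w - z))%C by ring. eapply Rle_trans. apply Cmod_triangle. unfold rho; lra.
  }
assert (S1 := entire_summable a w Ha). assert (S2 := entire_summable a z Ha).
assert (S3 : Csummable (fun n => a n * dpow z n)%C).
{ apply Csummable_le with (b := fun n => Cmod (a n) * (2 * rho) ^ n).
  - intros n. rewrite Cmod_mult. apply Rmult_le_compat_l. apply Cmod_ge_0.
    unfold dpow. rewrite Cmod_mult, Cmod_pow, Cmod_R, Rabs_pos_eq by apply pos_INR.
      rewrite Rpow_mult_distr.
    apply Rmult_le_compat. apply pos_INR. apply pow_le, Cmod_ge_0. apply INR_le_pow2.
    apply Rle_trans with (rho ^ pred n). apply pow_incr; split; [apply Cmod_ge_0|unfold rho; lra].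
      apply Rle_pow; [unfold rho; lra|lia].
  - apply Ha. unfold rho; lra. }
rewrite <- CSeries_scal by exact S3. 
rewrite <- CSeries_minus by assumption.
rewrite <- CSeries_minus; [|apply Csummable_minus; assumption|apply Csummable_scal, S3].
assert (Hb : forall n, Cmod (a n * w ^ n - a n * z ^ n - (w - z) * (a n * dpow z n))
  <= Cmod (w - z) ^ 2 * (Cmod (a n) * (4 * rho) ^ n)).
{ intros n. replace (a n * w ^ n - a n * z ^ n - (w - z) * (a n * dpow z n))%C
  with (a n * (w ^ n - z ^ n - (w - z) * dpow z n))%C by ring.
  rewrite Cmod_mult. replace (Cmod (w - z) ^ 2 * (Cmod (a n) * (4 * rho) ^ n))
    with (Cmod (a n) * ((4 * rho) ^ n * Cmod (w - z) ^ 2)) by ring.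
  apply Rmult_le_compat_l. apply Cmod_ge_0. apply pow_taylor; unfold rho in *; lra. }
assert (He : ex_series (fun n => Cmod (w - z) ^ 2 * (Cmod (a n) * (4 * rho) ^ n))).
{ apply (ex_series_scal (K := R_AbsRing) (V := R_NormedModule) (Cmod (w - z) ^ 2)). apply Ha.
  unfold rho; lra. }
eapply Rle_trans. apply Cmod_CSeries_le. { apply Csummable_le with (1 := Hb). exact He. }
rewrite (Rmult_comm (Series _)). rewrite <- Series_scal_l. apply Series_le; [|exact He].
intros n; split; [apply Cmod_ge_0|apply Hb].
Qed.

(** * The finite Jacobi triple product *)

Fixpoint Cprod (f : nat -> C) (n : nat) : C :=
  match n with O => RtoC 1 | S m => (Cprod f m * f m)%C end.

(** The q-Pochhammer symbol (h; h)_n. *)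
Fixpoint qpoch (h : R) (n : nat) : R :=
  match n with O => 1 | S m => qpoch h m * (1 - h ^ S m) end.

(** This is h ^ (n (n - 1) / 2), in a form that avoids division in nat. *)
Fixpoint qtri (h : R) (n : nat) : R :=
  match n with O => 1 | S m => qtri h m * h ^ m end.

(** The Gaussian binomial coefficient of base h. *)
Definition qbinom (h : R) (N k : nat) : R :=
  if (k <=? N)%nat then qpoch h N / (qpoch h k * qpoch h (N - k)) else 0.

(** The power h ^ (j (j - 1) / 2) for the integer j = k - n, which may be negative. *)
Definition qtriZ (h : R) (n k : nat) : R := Rpower h ((INR k - INR n) * (INR k - INR n - 1) / 2).

Section Jacobi.
Variable h : R.
Hypothesis Hh : 0 < h < 1.

Lemma pow_base_range n : 0 < h ^ n <= 1.
Proof. split. apply pow_lt; lra. rewrite <- (pow1 n). apply pow_incr; lra. Qed.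

Lemma pow_base_lt_1 n : h ^ S n < 1.
Proof. simpl. assert (H := pow_base_range n). nra. Qed.

Lemma qpoch_pos n : 0 < qpoch h n.
Proof. induction n; [simpl; lra|]. change (0 < qpoch h n * (1 - h ^ S n)).
  apply Rmult_lt_0_compat; [exact IHn|]. assert (H := pow_base_lt_1 n); lra. Qed.

Lemma qpoch_decr n : qpoch h (S n) <= qpoch h n.
Proof. change (qpoch h n * (1 - h ^ S n) <= qpoch h n). assert (H := pow_base_range (S n)).
  assert (H1 := qpoch_pos n). nra. Qed.

Lemma qpoch_anti n k : qpoch h (n + k) <= qpoch h n.
Proof. induction k; [rewrite Nat.add_0_r; lra|rewrite Nat.add_succ_r; eapply Rle_trans;
  [apply qpoch_decr|exact IHk]]. Qed.

Lemma qtri_pos n : 0 < qtri h n.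
Proof. induction n; simpl; [lra|]. apply Rmult_lt_0_compat; [exact IHn|apply pow_base_range]. Qed.

(** From 1 - x >= exp (- x / (1 - x)) for the factors; the exponents form a geometric sum. *)
Lemma qpoch_lower n : exp (- (h / (1 - h) ^ 2) * (1 - h ^ n)) <= qpoch h n.
Proof.
induction n.
- simpl. rewrite Rminus_diag, Rmult_0_r, exp_0. lra.
- change (qpoch h (S n)) with (qpoch h n * (1 - h ^ S n)).
  replace (- (h / (1 - h) ^ 2) * (1 - h ^ S n))
    with (- (h / (1 - h) ^ 2) * (1 - h ^ n) + - (h ^ S n / (1 - h))) by (simpl; field; lra).
  rewrite exp_plus. assert (B := pow_base_range n). assert (B' := pow_base_lt_1 n).
  apply Rmult_le_compat; try (left; apply exp_pos); [exact IHn|].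
  (* The n-th factor: 1 / (1 - x) <= 1 + x / (1 - h) <= exp (x / (1 - h)) for x = h^{n+1}. *)
  rewrite exp_Ropp. rewrite <- (Rinv_inv (1 - h ^ S n)). 
  apply Rinv_le_contravar. apply Rinv_0_lt_compat; lra.
  apply Rle_trans with (1 + h ^ S n / (1 - h)); [|apply exp_ineq1_le].
  apply Rmult_le_reg_r with ((1 - h ^ S n) * (1 - h)). nra.
  field_simplify; try lra. simpl in *. nra.
Qed.

Definition qpoch_inf := real (Lim_seq (qpoch h)).

Lemma qpoch_cv : is_lim_seq (qpoch h) qpoch_inf /\ 0 < qpoch_inf.
Proof.
assert (H : ex_finite_lim_seq (qpoch h)).
{ apply ex_finite_lim_seq_decr with 0. apply qpoch_decr. intros; left; apply qpoch_pos. }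
apply Lim_seq_correct' in H. split; [exact H|].
apply Rlt_le_trans with (exp (- (h / (1 - h) ^ 2))). apply exp_pos.
apply (is_lim_seq_le (fun _ => exp (- (h / (1 - h) ^ 2))) (qpoch h) (exp (- (h / (1 - h) ^ 2)))
  qpoch_inf) with (2 := is_lim_seq_const _) (3 := H).
intros n. eapply Rle_trans; [|apply qpoch_lower]. 
assert (B := pow_base_range n).
assert (0 < h / (1 - h) ^ 2) by (apply Rdiv_lt_0_compat; [lra|apply pow_lt; lra]).
destruct (Rle_lt_or_eq_dec (- (h / (1 - h) ^ 2)) (- (h / (1 - h) ^ 2) * (1 - h ^ n))) as [G|G];
  [nra|left; apply exp_increasing, G|right; rewrite <- G; reflexivity].
Qed.

Lemma qpoch_inf_le n : qpoch_inf <= qpoch h n.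
Proof. apply (is_lim_seq_decr_compare (qpoch h) qpoch_inf). apply qpoch_cv. apply qpoch_decr. Qed.

Lemma qbinom_le N k : (k <= N)%nat -> qbinom h N k = qpoch h N / (qpoch h k * qpoch h (N - k)).
Proof. intros H. unfold qbinom. rewrite (proj2 (Nat.leb_le _ _) H). reflexivity. Qed.

Lemma qbinom_gt N k : (N < k)%nat -> qbinom h N k = 0.
Proof. intros H. unfold qbinom. rewrite (proj2 (Nat.leb_gt _ _) H). reflexivity. Qed.

Lemma qbinom_0 N : qbinom h N 0 = 1.
Proof. rewrite qbinom_le by lia. rewrite Nat.sub_0_r. assert (H := qpoch_pos N). simpl. field.
  lra. Qed.

Lemma qbinom_pascal1 N k : (k <= N)%nat ->
  qbinom h (S N) (S k) = qbinom h N (S k) + h ^ (N - k) * qbinom h N k.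
Proof.
intros H. assert (H1 := qpoch_pos N). assert (H2 := qpoch_pos k). assert (H4 := pow_base_lt_1 k).
destruct (Nat.eq_dec k N) as [->|Hn].
- rewrite (qbinom_gt N (S N)) by lia. rewrite !qbinom_le by lia. rewrite !Nat.sub_diag.
  change (qpoch h (S N)) with (qpoch h N * (1 - h ^ S N)). simpl qpoch. field.
    simpl in *; split; lra.
- rewrite !qbinom_le by lia. replace (S N - S k)%nat with (S (N - S k))%nat by lia.
  replace (N - k)%nat with (S (N - S k)) by lia. set (r := (N - S k)%nat).
  assert (H3 := qpoch_pos r). assert (H5 := pow_base_lt_1 r).
  change (qpoch h (S N)) with (qpoch h N * (1 - h ^ S N)).
    change (qpoch h (S k)) with (qpoch h k * (1 - h ^ S k)).
  change (qpoch h (S r)) with (qpoch h r * (1 - h ^ S r)).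
  replace (h ^ S N) with (h ^ S k * h ^ S r) by (rewrite <- pow_add; f_equal; lia).
  field. repeat split; lra.
Qed.

Lemma qbinom_pascal2 N k : (k <= N)%nat ->
  qbinom h (S N) (S k) = qbinom h N k + h ^ (S k) * qbinom h N (S k).
Proof.
intros H. assert (H1 := qpoch_pos N). assert (H2 := qpoch_pos k). assert (H4 := pow_base_lt_1 k).
destruct (Nat.eq_dec k N) as [->|Hn].
- rewrite (qbinom_gt N (S N)) by lia. rewrite !qbinom_le by lia. rewrite !Nat.sub_diag.
  change (qpoch h (S N)) with (qpoch h N * (1 - h ^ S N)). simpl qpoch. field.
    simpl in *; split; lra.
- rewrite !qbinom_le by lia. replace (S N - S k)%nat with (S (N - S k))%nat by lia.
  replace (N - k)%nat with (S (N - S k)) by lia. set (r := (N - S k)%nat).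
  assert (H3 := qpoch_pos r). assert (H5 := pow_base_lt_1 r).
  change (qpoch h (S N)) with (qpoch h N * (1 - h ^ S N)).
    change (qpoch h (S k)) with (qpoch h k * (1 - h ^ S k)).
  change (qpoch h (S r)) with (qpoch h r * (1 - h ^ S r)).
  replace (h ^ S N) with (h ^ S k * h ^ S r) by (rewrite <- pow_add; f_equal; lia).
  field. repeat split; lra.
Qed.

Lemma Csum_shift (a : nat -> C) n : Csum a (S n) = (a O + Csum (fun k => a (S k)) n)%C.
Proof.
induction n. rewrite Csum_S, !Csum_O. reflexivity.
rewrite Csum_S, IHn, Csum_S. ring.
Qed.

Lemma Csum_ext (a b : nat -> C) n : (forall k, (k <= n)%nat -> a k = b k) -> Csum a n = Csum b n.
Proof.
induction n; intros H. rewrite !Csum_O. apply H; lia.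
rewrite !Csum_S, IHn, H; auto.
Qed.

Lemma Csum_plus (a b : nat -> C) n : Csum (fun k => a k + b k)%C n = (Csum a n + Csum b n)%C.
Proof. induction n. rewrite !Csum_O; reflexivity. rewrite !Csum_S, IHn. ring. Qed.

Lemma Csum_scal (c : C) (a : nat -> C) n : Csum (fun k => c * a k)%C n = (c * Csum a n)%C.
Proof. induction n. rewrite !Csum_O; reflexivity. rewrite !Csum_S, IHn. ring. Qed.

Lemma Rpower_nat n : Rpower h (INR n) = h ^ n.
Proof. apply Rpower_pow; lra. Qed.

Lemma qtriZ_0_S k : qtriZ h 0 (S k) = qtriZ h 0 k * h ^ k.
Proof. unfold qtriZ. rewrite <- Rpower_nat, <- Rpower_plus. f_equal. rewrite S_INR. simpl INR.
  field. Qed.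

Lemma qtriZ_S_S n k : qtriZ h (S n) (S k) = qtriZ h n k.
Proof. unfold qtriZ. f_equal. rewrite !S_INR. field. Qed.

Lemma qtriZ_S n k : h ^ S n * qtriZ h n k = h ^ k * qtriZ h (S n) k.
Proof. unfold qtriZ. rewrite <- !Rpower_nat, <- !Rpower_plus. f_equal. rewrite S_INR. field. Qed.

Lemma Cprod_S f n : Cprod f (S n) = (Cprod f n * f n)%C.
Proof. reflexivity. Qed.

(** Induction on m: the coefficient of z^{k+1} in the product by 1 + z h^m is the first
    Pascal rule. *)
Lemma qbinom_theorem (z : C) m :
  Cprod (fun i => 1 + z * (h ^ i)%R)%C m = Csum (fun k =>
    (qbinom h m k * qtriZ h 0 k)%R * z ^ k)%C m.
Proof.
induction m.
- rewrite Csum_O. rewrite qbinom_0. unfold qtriZ. simpl.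
  replace ((0 - 0) * (0 - 0 - 1) / 2) with 0 by field. rewrite Rpower_O by lra.
  rewrite Rmult_1_r. ring.
- rewrite Cprod_S, IHm, Csum_shift.
  set (b := fun k => ((qbinom h m k * qtriZ h 0 k)%R * z ^ k)%C).
  rewrite (Csum_ext (fun k => (qbinom h (S m) (S k) * qtriZ h 0 (S k))%R * z ^ S k)%C (fun k =>
    b (S k) + (z * (h ^ m)%R) * b k)%C).
  + rewrite (Csum_plus (fun k => b (S k)) (fun k => (z * (h ^ m)%R) * b k)%C), (Csum_scal _ b).
    assert (X : Csum b (S m) = (b O + Csum (fun k => b (S k)) m)%C) by apply Csum_shift.
    rewrite Csum_S in X. assert (Y : b (S m) = RtoC 0).
      { unfold b. rewrite qbinom_gt by lia. rewrite Rmult_0_l. ring. }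
    rewrite Y in X.
    replace (((qbinom h (S m) 0 * qtriZ h 0 0)%R * z ^ 0)%C) with (b O) by (unfold b;
      rewrite !qbinom_0; reflexivity).
    replace (Csum (fun k => b (S k)) m) with (Csum b m - b O)%C.
    ring. replace (Csum b m) with (Csum b m + 0)%C by ring. rewrite X. ring.
  + intros k Hk. unfold b. rewrite qbinom_pascal1 by exact Hk. rewrite qtriZ_0_S.
    replace (h ^ m) with (h ^ (m - k) * h ^ k) by (rewrite <- pow_add; f_equal; lia).
    rewrite !RtoC_mult, !RtoC_plus, !RtoC_mult. simpl. ring.
Qed.

(** The second family of factors is written as polynomials z + h^{i+1} so that only
    nonnegative powers occur; dividing by z^n gives the usual two-sided form.  Induction
    on n: multiplication by z + h^{n+1} is the second Pascal rule. *)
Lemma finite_jacobi (z : C) m n :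
  (Cprod (fun i => 1 + z * (h ^ i)%R) m * Cprod (fun i => z + (h ^ S i)%R) n)%C
  = Csum (fun k => (qbinom h (m + n) k * qtriZ h n k)%R * z ^ k)%C (m + n).
Proof.
induction n.
- rewrite Nat.add_0_r. simpl (Cprod _ 0). rewrite Cmult_1_r. apply qbinom_theorem.
- rewrite Cprod_S, Cmult_assoc, IHn, Nat.add_succ_r. set (N := (m + n)%nat).
  rewrite Csum_shift.
  set (b := fun k => ((qbinom h N k * qtriZ h n k)%R * z ^ k)%C).
  rewrite (Csum_ext (fun k => (qbinom h (S N) (S k) * qtriZ h (S n) (S k))%R
    * z ^ S k)%C (fun k => z * b k + (h ^ S n)%R * b (S k))%C).
  + rewrite (Csum_plus (fun k => z * b k)%C (fun k => (h ^ S n)%R * b (S k))%C), (Csum_scal _ b),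
    (Csum_scal _ (fun k => b (S k))).
    assert (X : Csum b (S N) = (b O + Csum (fun k => b (S k)) N)%C) by apply Csum_shift.
    rewrite Csum_S in X. assert (Y : b (S N) = RtoC 0).
      { unfold b. rewrite qbinom_gt by lia. rewrite Rmult_0_l. ring. }
    rewrite Y in X.
    replace (((qbinom h (S N) 0 * qtriZ h (S n) 0)%R * z ^ 0)%C) with ((h ^ S n)%R * b O)%C.
    2:{ unfold b; rewrite !qbinom_0. rewrite !Rmult_1_l, Cmult_assoc, <- RtoC_mult, qtriZ_S.
      rewrite pow_O, Rmult_1_l. reflexivity. }
    replace (Csum (fun k => b (S k)) N) with (Csum b N - b O)%C.
    ring. replace (Csum b N) with (Csum b N + 0)%C by ring. rewrite X. ring.
  + intros k Hk. unfold b. rewrite qbinom_pascal2 by exact Hk. rewrite Rmult_plus_distr_r.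
    rewrite qtriZ_S_S at 1.
    replace (h ^ S k * qbinom h N (S k) * qtriZ h (S n) (S k))
      with (qbinom h N (S k) * (h ^ S n * qtriZ h n (S k))) by (rewrite qtriZ_S; ring).
    rewrite !RtoC_plus, !RtoC_mult. simpl. ring.
Qed.

End Jacobi.

(** * The Theta function: holomorphy and functional equation *)

Section ThetaSeries.
Variable h : R.
Hypothesis Hh : 0 < h < 1.

Lemma qtri_Rpower n : qtri h n = Rpower h (INR n * (INR n - 1) / 2).
Proof.
induction n. simpl. replace (0 * (0 - 1) / 2) with 0 by field. rewrite Rpower_O; lra.
simpl qtri. rewrite IHn, <- (Rpower_nat h Hh), <- Rpower_plus. f_equal. rewrite S_INR. field.
Qed.

Lemma qtriZ_high n j : qtriZ h n (n + j) = qtri h j.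
Proof. rewrite qtri_Rpower. unfold qtriZ. f_equal. rewrite plus_INR. field. Qed.

Lemma qtriZ_low i j : qtriZ h (S (i + j)) i = qtri h (S (S j)).
Proof. rewrite qtri_Rpower. unfold qtriZ. f_equal. rewrite !S_INR, plus_INR. field. Qed.

Lemma ex_series_qtri (r : R) : 0 <= r -> ex_series (fun n => qtri h n * r ^ n).
Proof.
intros Hr.
assert (G : forall s, 0 < s -> ex_series (fun n => qtri h n * s ^ n)).
{ intros s Hs. apply ex_series_ext with (a := fun n => qtri h n * s ^ n). reflexivity.
  assert (P : forall n, 0 < qtri h n * s ^ n).
    { intros n. apply Rmult_lt_0_compat. apply qtri_pos, Hh. apply pow_lt, Hs. }
  apply ex_series_Rabs. apply ex_series_DAlembert with 0; [lra| |].
  - intros n. specialize (P n). lra.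
  - apply (is_lim_seq_ext (fun n => s * h ^ n)).
    + intros n. simpl. rewrite Rabs_pos_eq. field. split. apply pow_nonzero; lra.
      assert (X := qtri_pos h Hh n); lra.
      specialize (P (S n)) as P1. specialize (P n). left. apply Rdiv_lt_0_compat; assumption.
    + replace (Finite 0) with (Rbar_mult s 0) by (simpl; f_equal; ring).
      apply is_lim_seq_scal_l. apply is_lim_seq_geom. rewrite Rabs_pos_eq; lra. }
apply (ex_series_le (K := R_AbsRing) (V := R_CompleteNormedModule) _ (fun n =>
  qtri h n * (r + 1) ^ n)); [|apply G; lra].
intros n. unfold norm; simpl; unfold abs; simpl. assert (X := qtri_pos h Hh n).
rewrite Rabs_pos_eq. apply Rmult_le_compat_l; [lra|]. apply pow_incr; lra.
apply Rmult_le_pos; [lra|apply pow_le, Hr].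
Qed.

Lemma qtri_SS_le n : qtri h (S (S n)) <= qtri h n.
Proof.
simpl. assert (X := qtri_pos h Hh n). assert (B := pow_base_range h Hh n). 
assert (0 < h * h ^ n <= 1) by nra. assert (0 < h ^ n * (h * h ^ n) <= 1) by nra.
rewrite Rmult_assoc. nra.
Qed.

Lemma entire_qtri : entire (fun n => RtoC (qtri h n)).
Proof.
intros r Hr. apply (ex_series_ext (fun n => qtri h n * r ^ n)); [|apply ex_series_qtri, Hr].
intros n. rewrite Cmod_R, Rabs_pos_eq. reflexivity. left; apply qtri_pos, Hh.
Qed.

Lemma entire_qtri_SS : entire (fun n => RtoC (qtri h (S (S n)))).
Proof.
intros r Hr. apply (ex_series_le (K := R_AbsRing) (V := R_CompleteNormedModule) _ (fun n =>
  qtri h n * r ^ n)); [|apply ex_series_qtri, Hr].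
intros n. assert (X := qtri_pos h Hh (S (S n))).
  rewrite Cmod_R, (Rabs_pos_eq (qtri h (S (S n)))) by lra. 
unfold norm; simpl norm; unfold abs; simpl abs. assert (Y := pow_le r n Hr).
rewrite Rabs_pos_eq by (apply Rmult_le_pos; lra).
  apply Rmult_le_compat_r; [exact Y|apply qtri_SS_le].
Qed.

(** The terms of nonnegative index of the Theta series. *)
Definition theta_pos_part (z : C) : C := CSeries (fun n => qtri h n * z ^ n)%C.
(** The terms of negative index, as a power series in w = 1/z from which one factor w has
    been removed: the exponent of the index - (n + 1) is (n + 1) (n + 2) / 2. *)
Definition theta_neg_part (w : C) : C := CSeries (fun n => qtri h (S (S n)) * w ^ n)%C.

Lemma summable_theta_pos_part z : Csummable (fun n => qtri h n * z ^ n)%C.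
Proof. apply (entire_summable (fun n => RtoC (qtri h n))), entire_qtri. Qed.

Lemma summable_theta_neg_part z : Csummable (fun n => qtri h (S (S n)) * z ^ n)%C.
Proof. apply (entire_summable (fun n => RtoC (qtri h (S (S n))))), entire_qtri_SS. Qed.

Definition theta (z : C) : C := (theta_pos_part z + / z * theta_neg_part (/ z))%C.

Lemma Cdiff_theta (z : C) : z <> RtoC 0 -> Cdiff theta z.
Proof.
intros Hz. apply Cdiff_plus.
- apply (Cdiff_entire (fun n => RtoC (qtri h n))), entire_qtri.
- apply (Cdiff_comp (fun w => w * theta_neg_part w)%C Cinv); [|apply Cdiff_inv, Hz].
  apply Cdiff_mult. apply Cdiff_id.
    apply (Cdiff_entire (fun n => RtoC (qtri h (S (S n))))), entire_qtri_SS.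
Qed.

(** Replacing z by h z shifts the index of the series by one, which moves the term of
    index 0 from one half of the series to the other. *)
Lemma theta_shift (z : C) : z <> RtoC 0 -> theta z = (z * theta (h * z))%C.
Proof.
intros Hz. assert (Hh0 : RtoC h <> RtoC 0) by (apply RtoC_neq_0; lra).
unfold theta.
assert (E1 : theta_pos_part z = (1 + z * theta_pos_part (h * z))%C).
{ unfold theta_pos_part. rewrite (CSeries_incr_1 (fun n => qtri h n * z ^ n)%C)
  by apply summable_theta_pos_part.
  f_equal. simpl; ring. rewrite <- CSeries_scal by apply summable_theta_pos_part.
    apply CSeries_ext.
  intros n. rewrite Cpow_mult_l, <- RtoC_pow. simpl qtri. rewrite RtoC_mult. simpl. ring. }
assert (E2 : theta_neg_part (/ (h * z)) = (h * z * (1 + / z * theta_neg_part (/ z)) * / z)%C).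
{ unfold theta_neg_part at 1. rewrite (CSeries_incr_1 (fun n =>
  qtri h (S (S n)) * (/ (h * z)) ^ n)%C) by apply summable_theta_neg_part.
  replace (h * z * (1 + / z * theta_neg_part (/ z)) * / z)%C
    with (h + h * / z * theta_neg_part (/ z))%C by (field; exact Hz).
  assert (X0 : (qtri h 2 * (/ (h * z)) ^ 0)%C = RtoC h).
    { change ((/ (h * z)) ^ 0)%C with (RtoC 1). rewrite Cmult_1_r. f_equal. simpl. ring. }
  rewrite X0. f_equal. unfold theta_neg_part.
    rewrite <- CSeries_scal by apply summable_theta_neg_part.
  apply CSeries_ext. intros n. replace (/ (h * z))%C with (/ h * / z)%C by (field; split; auto).
  rewrite Cpow_mult_l. rewrite <- RtoC_inv by lra. rewrite <- RtoC_pow.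
  replace (qtri h (S (S (S n)))) with (h * h ^ (S n) * qtri h (S (S n))) by (simpl; ring).
  assert (Y : h ^ S n * (/ h) ^ S n = 1). { rewrite <- Rpow_mult_distr, Rinv_r, pow1; lra. }
  rewrite Cmult_assoc, <- RtoC_mult.
  replace (h * h ^ S n * qtri h (S (S n)) * (/ h) ^ S n)
    with (h * qtri h (S (S n)) * (h ^ S n * (/ h) ^ S n)) by ring.
  rewrite Y, Rmult_1_r, RtoC_mult, Cpow_S. ring. }
rewrite E1, E2. field. split; auto.
Qed.

End ThetaSeries.

(** * The Jacobi triple product as a limit *)

Lemma CSeries_zero : CSeries (fun _ => RtoC 0) = RtoC 0.
Proof. unfold CSeries. simpl. rewrite (Series_ext _ (fun _ => 0 * 0)) by (intros; ring).
  rewrite Series_scal_l. unfold RtoC. f_equal; ring. Qed.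

Lemma Csummable_zero : Csummable (fun _ => RtoC 0).
Proof.
apply Csummable_le with (b := fun n => 0 * (/ 2) ^ n). intros; rewrite Cmod_0; lra.
apply (ex_series_scal (K := R_AbsRing) (V := R_NormedModule) 0). apply ex_series_geom.
  rewrite Rabs_pos_eq; lra.
Qed.

Lemma CSeries_trunc (b : nat -> C) p :
  Csummable (fun j => if (j <? p)%nat then b j else RtoC 0) /\
  forall m, p = S m -> CSeries (fun j => if (j <? p)%nat then b j else RtoC 0) = Csum b m.
Proof.
revert b. induction p; intros b.
- split; [|discriminate]. apply Csummable_zero.
- destruct (IHp (fun j => b (S j))) as [I1 I2].
  assert (X : Csummable (fun j => if (j <? S p)%nat then b j else RtoC 0))
    by (apply Csummable_incr_1; exact I1).
  split; [exact X|]. intros m [= ->]. rewrite CSeries_incr_1 by exact X.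
    simpl (if (0 <? S m)%nat then _ else _).
  change (fun n => if (S n <? S m)%nat then b (S n) else RtoC 0) with (fun n =>
    if (n <? m)%nat then b (S n) else RtoC 0).
  destruct m. 
  + rewrite (CSeries_ext _ (fun _ => RtoC 0)) by reflexivity. rewrite CSeries_zero, Csum_O. ring.
  + rewrite (I2 m eq_refl). rewrite Csum_shift. reflexivity.
Qed.

(** Both halves are written as series of truncated sequences, counted away from the index
    p, because termwise limits will be taken in them. *)
Lemma Csum_two_sided (a : nat -> C) p m :
  Csum a (p + m) = (CSeries (fun j => if (j <? S m)%nat then a (p + j)%nat else RtoC 0)
                    + CSeries (fun j => if (j <? p)%nat then a (p - 1 - j)%nat else RtoC 0))%C.
Proof.
rewrite (proj2 (CSeries_trunc (fun j => a (p + j)%nat) (S m)) m eq_refl).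
revert m. induction p; intros m.
- rewrite (CSeries_ext _ (fun _ => RtoC 0)) by reflexivity. rewrite CSeries_zero, Cplus_0_r.
  reflexivity.
- replace (S p + m)%nat with (p + S m)%nat by lia. rewrite IHp, Csum_shift.
  rewrite (CSeries_incr_1 (fun j => if (j <? S p)%nat then a (S p - 1 - j)%nat else RtoC 0))
    by apply CSeries_trunc with (b := fun j => a (S p - 1 - j)%nat).
  rewrite (CSeries_ext (fun n => if (S n <? S p)%nat then a (S p - 1 - S n)%nat
    else RtoC 0) (fun j => if (j <? p)%nat then a (p - 1 - j)%nat else RtoC 0)).
  2:{ intros n. change (S n <? S p)%nat with (n <? p)%nat.
    destruct (n <? p)%nat; [f_equal; lia|reflexivity]. }
  change (0 <? S p)%nat with true. replace (S p - 1 - 0)%nat with p by lia. rewrite Nat.add_0_r.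
  rewrite (Csum_ext (fun k => a (p + S k)%nat) (fun j => a (S p + j)%nat)) by (intros; f_equal;
    lia). ring.
Qed.

Section Lower.
Variable h : R.
Hypothesis Hh : 0 < h < 1.

Lemma qbinom_bounds N k : 0 <= qbinom h N k <= / qpoch_inf h.
Proof.
destruct (qpoch_cv h Hh) as [_ HL].
destruct (le_lt_dec k N) as [H|H].
- rewrite qbinom_le by exact H. assert (H1 := qpoch_pos h Hh N). assert (H2 := qpoch_pos h Hh k).
  assert (H3 := qpoch_pos h Hh (N - k)).
  split. left. apply Rdiv_lt_0_compat; [lra|apply Rmult_lt_0_compat; lra].
  apply Rle_trans with (/ qpoch h (N - k));
    [|apply Rinv_le_contravar; [lra|apply qpoch_inf_le, Hh]].
  assert (H4 : qpoch h N <= qpoch h k).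
    { replace N with (k + (N - k))%nat by lia. apply qpoch_anti, Hh. }
  apply Rmult_le_reg_r with (qpoch h k * qpoch h (N - k)). apply Rmult_lt_0_compat; lra.
  field_simplify; lra.
- rewrite qbinom_gt by exact H. split. lra. left; apply Rinv_0_lt_compat, HL.
Qed.

Lemma qbinom_lim (u v : nat -> nat) : (forall n, (u n + v n = n + n)%nat) ->
  (exists c, forall n, (n <= u n + c)%nat) -> (exists c, forall n, (n <= v n + c)%nat) ->
  is_lim_seq (fun n => qbinom h (n + n) (u n)) (/ qpoch_inf h).
Proof.
intros Huv Hu Hv. destruct (qpoch_cv h Hh) as [HL HL0].
assert (Hw : forall w : nat -> nat, (exists c, forall n, (n <= w n + c)%nat) ->
  is_lim_seq (fun n => qpoch h (w n)) (qpoch_inf h)).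
{ intros w [c Hw]. apply (is_lim_seq_subseq (qpoch h) (qpoch_inf h) w); [|exact HL].
  intros P [N HN]. exists (N + c)%nat. intros n Hn. apply HN. specialize (Hw n). lia. }
apply (is_lim_seq_ext (fun n => qpoch h (n + n) / (qpoch h (u n) * qpoch h (v n)))).
{ intros n. specialize (Huv n). rewrite qbinom_le by lia. do 3 f_equal. lia. }
replace (/ qpoch_inf h) with (qpoch_inf h / (qpoch_inf h * qpoch_inf h)) by (field; lra).
apply is_lim_seq_div'. apply (Hw (fun n => n + n)%nat). exists O; intros; lia.
apply is_lim_seq_mult'; apply Hw; assumption. nra.
Qed.

Lemma Rabs_qbinom_error b N k : Rabs ((if b : bool then qbinom h N k else 0) - / qpoch_inf h)
  <= / qpoch_inf h.
Proof.
assert (B := qbinom_bounds N k). destruct b; apply Rabs_le; lra.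
Qed.

Lemma qtri_series_error (z : C) (g : nat -> nat -> R) (t : nat -> R) :
  (forall j, 0 <= t j) -> ex_series (fun n => t n * Cmod z ^ n) ->
  (forall n j, Rabs (g n j - / qpoch_inf h) <= / qpoch_inf h) ->
  (forall j, is_lim_seq (fun n => g n j) (/ qpoch_inf h)) ->
  is_lim_seq (fun n => Cmod (CSeries (fun j => ((g n j - / qpoch_inf h) * t j)%R * z ^ j)%C)) 0.
Proof.
intros Ht Hs Hg Hl. destruct (qpoch_cv h Hh) as [_ HL0].
assert (HLi : 0 < / qpoch_inf h) by (apply Rinv_0_lt_compat, HL0).
assert (E : forall n j, Cmod (((g n j - / qpoch_inf h) * t j)%R * z ^ j)%C
  = Rabs (g n j - / qpoch_inf h) * (t j * Cmod z ^ j)).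
{ intros n j. rewrite Cmod_mult, Cmod_R, Cmod_pow, Rabs_mult, (Rabs_pos_eq (t j)) by apply Ht.
  ring. }
apply tannery with (b := fun j => / qpoch_inf h * (t j * Cmod z ^ j)).
- intros n j. rewrite E. apply Rmult_le_compat_r; [|apply Hg].
  apply Rmult_le_pos; [apply Ht|apply pow_le, Cmod_ge_0].
- apply (ex_series_scal (K := R_AbsRing) (V := R_NormedModule) (/ qpoch_inf h)). exact Hs.
- intros j. apply (is_lim_seq_ext (fun n => Rabs (g n j - / qpoch_inf h) * (t j * Cmod z ^ j))).
  intros; symmetry; apply E.
  replace (Finite 0) with (Rbar_mult 0 (t j * Cmod z ^ j)) by (simpl; f_equal; ring).
  apply is_lim_seq_scal_r. apply (proj1 (is_lim_seq_abs_0 _)).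
  replace (Finite 0) with (Rbar_minus (/ qpoch_inf h) (/ qpoch_inf h)) by (simpl; f_equal; ring).
  apply is_lim_seq_minus'. apply Hl. apply is_lim_seq_const.
Qed.

(** The truncated Jacobi product, of the factors 1 + z h^i for i < n and 1 + h^i / z for
    1 <= i <= n. *)
Definition jacobi_prod (z : C) (n : nat) : C :=
  ((/ z) ^ n * (Cprod (fun i => 1 + z * (h ^ i)%R) n * Cprod (fun i => z + (h ^ S i)%R) n))%C.

(** The central Gaussian binomial coefficients tend to the inverse of (h; h)_infinity and
    stay below it, so that Tannery's theorem applies to both halves of the expansion given
    by [finite_jacobi]. *)
Lemma jacobi_limit (z : C) : z <> RtoC 0 ->
  is_lim_seq (fun n => Cmod (jacobi_prod z n - (/ qpoch_inf h)%R * theta h z)%C) 0.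
Proof.
intros Hz. destruct (qpoch_cv h Hh) as [_ HL0].
set (g1 := fun n j => if (j <? S n)%nat then qbinom h (n + n) (n + j) else 0).
set (g2 := fun n j => if (j <? n)%nat then qbinom h (n + n) (n - 1 - j) else 0).
assert (L1 : is_lim_seq (fun n => Cmod (CSeries (fun j =>
  ((g1 n j - / qpoch_inf h) * qtri h j)%R * z ^ j)%C)) 0).
{ apply qtri_series_error.
  - intros; left; apply qtri_pos, Hh.
  - apply ex_series_qtri. exact Hh. apply Cmod_ge_0.
  - intros. apply Rabs_qbinom_error.
  - intros j. apply (is_lim_seq_ext_loc (fun n =>
    qbinom h (n + n) (if (j <? S n)%nat then n + j else n)%nat)).
    exists j. intros n Hn. unfold g1. rewrite (proj2 (Nat.ltb_lt j (S n))) by lia. reflexivity.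
    apply qbinom_lim with (v := fun n => (if (j <? S n)%nat then n - j else n)%nat).
    intros n. destruct (Nat.ltb_spec j (S n)); lia.
    exists O. intros n. destruct (Nat.ltb_spec j (S n)); lia.
    exists j. intros n. destruct (Nat.ltb_spec j (S n)); lia. }
assert (L2 : is_lim_seq (fun n => Cmod (CSeries (fun j =>
  ((g2 n j - / qpoch_inf h) * qtri h (S (S j)))%R * (/ z) ^ j)%C)) 0).
{ apply qtri_series_error with (t := fun j => qtri h (S (S j))).
  - intros; left; apply qtri_pos, Hh.
  - apply (ex_series_ext (fun n => Cmod (qtri h (S (S n))) * Cmod (/ z) ^ n)). intros n.
    rewrite Cmod_R, Rabs_pos_eq. reflexivity. left; apply qtri_pos, Hh.
    apply (entire_qtri_SS h Hh). apply Cmod_ge_0.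
  - intros. apply Rabs_qbinom_error.
  - intros j. apply (is_lim_seq_ext_loc (fun n =>
    qbinom h (n + n) (if (j <? n)%nat then n - 1 - j else n)%nat)).
    exists (S j). intros n Hn. unfold g2. rewrite (proj2 (Nat.ltb_lt j n)) by lia. reflexivity.
    apply qbinom_lim with (v := fun n => (if (j <? n)%nat then n + 1 + j else n)%nat).
    intros n. destruct (Nat.ltb_spec j n); lia.
    exists (S j). intros n. destruct (Nat.ltb_spec j n); lia.
    exists O. intros n. destruct (Nat.ltb_spec j n); lia. }
assert (S1 : forall n, Csummable (fun j => (g1 n j * qtri h j)%R * z ^ j)%C).
{ intros n. apply Csummable_le with (b := fun j => / qpoch_inf h * (qtri h j * Cmod z ^ j)).
  - intros j. rewrite Cmod_mult, Cmod_R, Cmod_pow, Rabs_mult, (Rabs_pos_eq (qtri h j)),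
    Rmult_assoc by (left; apply qtri_pos, Hh).
    apply Rmult_le_compat_r. apply Rmult_le_pos;
      [left; apply qtri_pos, Hh|apply pow_le, Cmod_ge_0].
    unfold g1. destruct (j <? S n)%nat. rewrite Rabs_pos_eq; apply qbinom_bounds. rewrite Rabs_R0.
      left; apply Rinv_0_lt_compat, HL0.
  - apply (ex_series_scal (K := R_AbsRing) (V := R_NormedModule) (/ qpoch_inf h)).
    apply ex_series_qtri. exact Hh. apply Cmod_ge_0. }
assert (S2 : forall n, Csummable (fun j => (g2 n j * qtri h (S (S j)))%R * (/ z) ^ j)%C).
{ intros n. apply Csummable_le with (b := fun j =>
  / qpoch_inf h * (Cmod (qtri h (S (S j))) * Cmod (/ z) ^ j)).
  - intros j. rewrite Cmod_mult, RtoC_mult, !Cmod_mult, Cmod_pow, Rmult_assoc.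
    apply Rmult_le_compat_r. apply Rmult_le_pos; [apply Cmod_ge_0|apply pow_le, Cmod_ge_0].
      rewrite Cmod_R.
    unfold g2. destruct (j <? n)%nat. rewrite Rabs_pos_eq; apply qbinom_bounds. rewrite Rabs_R0.
      left; apply Rinv_0_lt_compat, HL0.
  - apply (ex_series_scal (K := R_AbsRing) (V := R_NormedModule) (/ qpoch_inf h)).
    apply (entire_qtri_SS h Hh). apply Cmod_ge_0. }
assert (J : forall n, jacobi_prod z n = (CSeries (fun j => (g1 n j * qtri h j)%R * z ^ j)
   + / z * CSeries (fun j => (g2 n j * qtri h (S (S j)))%R * (/ z) ^ j))%C).
{ intros n. unfold jacobi_prod. rewrite finite_jacobi by exact Hh. rewrite <- Csum_scal.
  rewrite Csum_two_sided.
  rewrite <- CSeries_scal by apply S2.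
  assert (Hzn : forall k, (/ z ^ k)%C = ((/ z) ^ k)%C) by (intros; symmetry; apply Cpow_inv, Hz).
  f_equal; apply CSeries_ext; intros j.
  - unfold g1. destruct (Nat.ltb_spec j (S n)). 2: rewrite Rmult_0_l; ring.
    rewrite qtriZ_high by exact Hh. rewrite <- Hzn, Cpow_add_r. field. apply Cpow_nz, Hz.
  - unfold g2. destruct (Nat.ltb_spec j n). 2: rewrite Rmult_0_l; ring.
    assert (T1 : qtriZ h n (n - 1 - j) = qtri h (S (S j))).
      { rewrite <- (qtriZ_low h Hh (n - 1 - j) j). f_equal. lia. }
    assert (T2 : (z ^ n = z * z ^ (n - 1 - j) * z ^ j)%C).
      { rewrite <- Cpow_S, <- Cpow_add_r. f_equal. lia. }
    rewrite T1, <- !Hzn, T2. field. repeat split; try apply Cpow_nz; exact Hz. }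
assert (T : theta h z = (CSeries (fun j => qtri h j * z ^ j) + / z * CSeries (fun j =>
  qtri h (S (S j)) * (/ z) ^ j))%C) by reflexivity.
assert (L3 := is_lim_seq_plus' _ _ _ _ L1 (is_lim_seq_scal_l _ (Cmod (/ z)) _ L2)).
match type of L3 with is_lim_seq ?u _ => assert (L4 : is_lim_seq u 0) end.
{ replace 0 with (0 + Cmod (/ z) * 0) by ring. exact L3. }
clear L3; rename L4 into L3.
apply (is_lim_seq_le_le (fun _ => 0) _ _ 0) with (3 := L3); [|apply is_lim_seq_const].
intros n. split. apply Cmod_ge_0. rewrite <- Cmod_mult. eapply Rle_trans; [|apply Cmod_triangle].
right. f_equal. rewrite J, T.
rewrite (CSeries_ext (fun j => ((g1 n j - / qpoch_inf h) * qtri h j)%R * z ^ j)%C (fun j =>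
  (g1 n j * qtri h j)%R * z ^ j - (/ qpoch_inf h)%R * (qtri h j * z ^ j))%C).
2:{ intros j. rewrite !RtoC_mult, RtoC_minus. ring. }
rewrite (CSeries_ext (fun j => ((g2 n j - / qpoch_inf h) * qtri h (S (S j)))%R
  * (/ z) ^ j)%C (fun j => (g2 n j * qtri h (S (S j)))%R * (/ z) ^ j - (/ qpoch_inf h)%R
  * (qtri h (S (S j)) * (/ z) ^ j))%C).
2:{ intros j. rewrite !RtoC_mult, RtoC_minus. ring. }
assert (SA := summable_theta_pos_part h Hh z). assert (SB := summable_theta_neg_part h Hh (/ z)).
rewrite (CSeries_minus _ _ (S1 n) (Csummable_scal _ _ SA)),
  (CSeries_minus _ _ (S2 n) (Csummable_scal _ _ SB)).
rewrite (CSeries_scal _ _ SA), (CSeries_scal _ _ SB).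
ring.
Qed.

End Lower.

(** * Lower bound of the Theta function *)

(** Distance from the half-line of negative reals, on which the zeros of Theta lie,
    measured invariantly under dilations. *)
Definition away (d : R) (z : C) : Prop := forall s, 0 <= s -> d <= Cmod (1 + s * z)%C.

Lemma away_scal d z r : 0 <= r -> away d z -> away d (r * z)%C.
Proof. intros Hr H s Hs. rewrite Cmult_assoc, <- RtoC_mult. apply H.
  apply Rmult_le_pos; assumption. Qed.

(** Complex conjugation maps 1/z to a positive multiple of z. *)
Lemma away_inv d z s : z <> RtoC 0 -> 0 <= s -> away d z -> d <= Cmod (1 + s * / z)%C.
Proof.
intros Hz Hs H. assert (Hm : 0 < Cmod z) by (apply Cmod_gt_0, Hz).
rewrite <- Cmod_conj. 
replace (Cconj (1 + s * / z)%C) with (1 + (s / (Cmod z * Cmod z))%R * z)%C.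
apply H. apply Rmult_le_pos; [exact Hs|left; apply Rinv_0_lt_compat; nra].
rewrite Cplus_conj, Cmult_conj, Cinv_conj by exact Hz.
assert (E : (z * Cconj z)%C = RtoC (Cmod z * Cmod z)).
{ unfold Cmult, Cconj, RtoC, Cmod; simpl. rewrite sqrt_sqrt. f_equal; ring. nra. }
assert (Hc : Cconj z <> RtoC 0).
{ intros E0. rewrite E0, Cmult_0_r in E. injection E. nra. }
rewrite RtoC_div by nra. rewrite <- E.
replace (Cconj 1) with (RtoC 1) by (unfold Cconj, RtoC; simpl; f_equal; ring).
replace (Cconj s) with (RtoC s) by (unfold Cconj, RtoC; simpl; f_equal; ring).
field. auto.
Qed.

Section ThetaLower.
Variable h : R.
Hypothesis Hh : 0 < h < 1.

(** In each of the two products the first factor is at least d; as h <= |z| <= 1, the others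
    are at least the successive factors 1 - h^i of (h; h)_n. *)
Lemma jacobi_prod_lower (z : C) d n : 0 < d -> h <= Cmod z <= 1 -> away d z ->
  (d * qpoch h n) * (d * qpoch h n) <= Cmod (jacobi_prod h z (S n)).
Proof.
intros Hd Hz Ha. 
assert (Hz0 : z <> RtoC 0) by (intros ->; rewrite Cmod_0 in Hz; lra).
assert (P1 : d * qpoch h n <= Cmod (Cprod (fun i => 1 + z * (h ^ i)%R)%C (S n))).
{ clear - Hd Hz Ha Hh. induction n.
  - simpl. rewrite Cmult_1_l, Rmult_1_r. rewrite (Cmult_comm z). apply Ha. lra.
  - rewrite Cprod_S, Cmod_mult. change (qpoch h (S n)) with (qpoch h n * (1 - h ^ S n)).
    rewrite <- Rmult_assoc.
    assert (B := pow_base_range h Hh (S n)). assert (Q := qpoch_pos h Hh n).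
    apply Rmult_le_compat; [nra|lra|exact IHn|].
    assert (T := Cmod_triangle (1 + z * (h ^ S n)%R) (- (z * (h ^ S n)%R))).
    replace (1 + z * (h ^ S n)%R + - (z * (h ^ S n)%R))%C with (RtoC 1) in T by ring.
    rewrite Cmod_opp, Cmod_1, Cmod_mult, Cmod_R, (Rabs_pos_eq (h ^ S n)) in T by lra. nra. }
assert (P2 : d * qpoch h n <= Cmod ((/ z) ^ S n * Cprod (fun i => z + (h ^ S i)%R) (S n))%C).
{ clear P1. induction n.
  - simpl. rewrite Cmult_1_l, !Rmult_1_r, Cmult_1_r.
    replace (/ z * (z + h))%C with (1 + h * / z)%C by (field; exact Hz0).
    apply away_inv; auto; lra.
  - rewrite Cprod_S, Cpow_S. 
    replace (/ z * (/ z) ^ S n * (Cprod (fun i =>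
      z + (h ^ S i)%R) (S n) * (z + (h ^ S (S n))%R)))%C
      with ((/ z) ^ S n * Cprod (fun i => z + (h ^ S i)%R) (S n) * (1 + (h ^ S (S n))%R * / z))%C
        by (field; exact Hz0).
    rewrite Cmod_mult. change (qpoch h (S n)) with (qpoch h n * (1 - h ^ S n)).
      rewrite <- Rmult_assoc.
    assert (B := pow_base_range h Hh (S n)). assert (Q := qpoch_pos h Hh n).
    apply Rmult_le_compat; [nra|lra|exact IHn|].
    set (y := ((h ^ S (S n))%R * / z)%C).
    assert (T := Cmod_triangle (1 + y) (- y)).
    replace (1 + y + - y)%C with (RtoC 1) in T by ring.
    rewrite Cmod_opp, Cmod_1 in T.
    assert (Y : Cmod y <= h ^ S n).
    { unfold y. rewrite Cmod_mult, Cmod_R, Cmod_inv by exact Hz0. 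
      assert (B2 := pow_base_range h Hh (S (S n))). rewrite Rabs_pos_eq by lra. 
      apply Rmult_le_reg_r with (Cmod z). lra. rewrite Rmult_assoc, Rinv_l by lra. simpl in *.
        nra. }
    lra. }
unfold jacobi_prod. 
replace ((/ z) ^ S n * (Cprod (fun i => 1 + z * (h ^ i)%R) (S n) * Cprod (fun i =>
  z + (h ^ S i)%R) (S n)))%C
 with (Cprod (fun i => 1 + z * (h ^ i)%R) (S n)
   * ((/ z) ^ S n * Cprod (fun i => z + (h ^ S i)%R) (S n)))%C by ring.
rewrite Cmod_mult. assert (Q := qpoch_pos h Hh n). apply Rmult_le_compat; auto; nra.
Qed.

Lemma theta_lower_annulus (z : C) d : 0 < d -> h <= Cmod z <= 1 -> away d z ->
  d ^ 2 * qpoch_inf h ^ 3 <= Cmod (theta h z).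
Proof.
intros Hd Hz Ha. destruct (qpoch_cv h Hh) as [_ HL].
assert (Hz0 : z <> RtoC 0) by (intros ->; rewrite Cmod_0 in Hz; lra).
set (K := Cmod ((/ qpoch_inf h)%R * theta h z)).
assert (L : is_lim_seq (fun n => Cmod (jacobi_prod h z (S n) - (/ qpoch_inf h)%R * theta h z)%C
  + K) (0 + K)).
{ apply is_lim_seq_plus'; [|apply is_lim_seq_const].
  apply (is_lim_seq_incr_1 (fun n => Cmod (jacobi_prod h z n - (/ qpoch_inf h)%R * theta h z)%C)).
  apply jacobi_limit; assumption. }
rewrite Rplus_0_l in L.
assert (HK : (d * qpoch_inf h) * (d * qpoch_inf h) <= K).
{ apply (is_lim_seq_le (fun _ => (d * qpoch_inf h) * (d * qpoch_inf h)) _ ((d * qpoch_inf h)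
  * (d * qpoch_inf h)) K) with (2 := is_lim_seq_const _) (3 := L).
  intros n. apply Rle_trans with (Cmod (jacobi_prod h z (S n))).
  - eapply Rle_trans; [|apply (jacobi_prod_lower z d n); assumption].
    assert (Q := qpoch_inf_le h Hh n).
    assert (0 < d * qpoch_inf h) by nra. assert (d * qpoch_inf h <= d * qpoch h n) by nra.
    apply Rmult_le_compat; lra.
  - replace (jacobi_prod h z (S n))
    with ((jacobi_prod h z (S n) - (/ qpoch_inf h)%R * theta h z) + (/ qpoch_inf h)%R
    * theta h z)%C at 1 by ring.
    apply Cmod_triangle. }
unfold K in HK. rewrite Cmod_mult, Cmod_R,
  Rabs_pos_eq in HK by (left; apply Rinv_0_lt_compat, HL).
replace (d ^ 2 * qpoch_inf h ^ 3) with (qpoch_inf h * (d * qpoch_inf h * (d * qpoch_inf h)))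
  by ring.
replace (Cmod (theta h z)) with (qpoch_inf h * (/ qpoch_inf h * Cmod (theta h z))) by (field;
  lra).
apply Rmult_le_compat_l; lra.
Qed.

(** Under z |-> h z both sides are divided by |z|, the right-hand side by
    [theta_shift].  Induction on the number of such steps needed to reach the annulus
    h <= |z| <= 1, that is - 1/c <= log |z| <= 0, where the exponential is at most 1. *)
Lemma theta_lower (c d : R) (z : C) : 0 < c -> h = exp (- / c) -> 0 < d -> z <> RtoC 0 ->
  away d z ->
  d ^ 2 * qpoch_inf h ^ 3 * exp (c / 2 * ln (Cmod z) ^ 2 + ln (Cmod z) / 2) <= Cmod (theta h z).
Proof.
intros Hc Hhc Hd Hz0 Ha. destruct (qpoch_cv h Hh) as [_ HL].
assert (Hci : 0 < / c) by (apply Rinv_0_lt_compat, Hc).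
set (K := d ^ 2 * qpoch_inf h ^ 3).
assert (HK : 0 < K) by (unfold K; apply Rmult_lt_0_compat; apply pow_lt; assumption).
assert (Main : forall m z, z <> RtoC 0 -> away d z ->
  - (1 + INR m) / c <= ln (Cmod z) <= INR m / c ->
  K * exp (c / 2 * ln (Cmod z) ^ 2 + ln (Cmod z) / 2) <= Cmod (theta h z)).
2:{ destruct (INR_unbounded (c * Rabs (ln (Cmod z)))) as [m Hm].
    apply (Main m); auto. assert (Hr : Rabs (ln (Cmod z)) <= INR m / c).
    { apply Rmult_le_reg_l with c; [lra|]. replace (c * (INR m / c)) with (INR m) by (field; lra).
      lra. }
    apply Rabs_le_between in Hr. split; [|lra]. 
    replace (- (1 + INR m) / c) with (- (INR m / c) - / c) by (field; lra). lra. }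
clear z Hz0 Ha. induction m; intros z Hz0 Ha Hx.
- simpl INR in Hx. assert (Hm : 0 < Cmod z) by (apply Cmod_gt_0, Hz0).
  set (x := ln (Cmod z)) in *.
  assert (Hx1 : - / c <= x <= 0). { replace (- / c) with (- (1 + 0) / c) by (field; lra).
    replace 0 with (0 / c) at 2 by (field; lra). exact Hx. }
  apply Rle_trans with (K * 1).
  + apply Rmult_le_compat_l; [lra|]. rewrite <- exp_0. 
    assert (Q : c / 2 * x ^ 2 + x / 2 <= 0).
    { assert (- 1 <= c * x). { replace (- 1) with (c * - / c) by (field; lra).
      apply Rmult_le_compat_l; lra. } nra. }
    destruct Q as [Q|Q]; [left; apply exp_increasing, Q|rewrite Q; right; reflexivity].
  + rewrite Rmult_1_r. apply theta_lower_annulus; auto. 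
    rewrite <- (exp_ln (Cmod z)) by exact Hm. fold x. rewrite Hhc. rewrite <- exp_0.
    split; [destruct (proj1 Hx1) as [Q|Q]|destruct (proj2 Hx1) as [Q|Q]];
      try (left; apply exp_increasing, Q); rewrite Q; right; reflexivity.
- assert (Hm : 0 < Cmod z) by (apply Cmod_gt_0, Hz0). rewrite S_INR in Hx.
  assert (Hh0 : RtoC h <> RtoC 0) by (apply RtoC_neq_0; lra).
  assert (Lh : ln h = - / c) by (rewrite Hhc; apply ln_exp).
  assert (HINR := pos_INR m).
  assert (Hmc : 0 <= INR m / c) by (apply Rmult_le_pos; lra).
  replace (- (1 + (INR m + 1)) / c) with (- (1 + INR m) / c - / c) in Hx by (field; lra).
  replace ((INR m + 1) / c) with (INR m / c + / c) in Hx by (field; lra).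
  assert (D1 : - (1 + INR m) / c = - (INR m / c) - / c) by (field; lra).
  (* z is moved towards the annulus: to z / h if it is too small, to h z if too large. *)
  destruct (Rle_lt_dec (ln (Cmod z)) 0) as [L0|L0].
  + destruct (Rle_lt_dec (- / c) (ln (Cmod z))) as [L1|L1]; [apply IHm; auto; lra|].
    set (w := (/ h * z)%C).
    assert (Hw0 : w <> RtoC 0). { apply Cmult_neq_0;
      [rewrite <- RtoC_inv by lra; apply RtoC_neq_0, Rinv_neq_0_compat; lra|exact Hz0]. }
    assert (Hzw : z = (h * w)%C) by (unfold w; field; exact Hh0).
    assert (Hcw : Cmod z = h * Cmod w) by (rewrite Hzw, Cmod_mult, Cmod_R, Rabs_pos_eq; lra).
    assert (Hw : 0 < Cmod w) by (apply Cmod_gt_0, Hw0).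
    assert (Hln : ln (Cmod z) = - / c + ln (Cmod w)) by (rewrite Hcw, ln_mult, Lh; lra).
    assert (I := IHm w Hw0). 
    assert (A : away d w). { unfold w. rewrite <- RtoC_inv by lra. apply away_scal; auto.
      left; apply Rinv_0_lt_compat; lra. }
    specialize (I A ltac:(lra)). rewrite (theta_shift h Hh w Hw0), <- Hzw, Cmod_mult in I.
    apply Rmult_le_reg_l with (Cmod w); [exact Hw|].
    eapply Rle_trans; [|exact I]. right. rewrite Hln.
      rewrite <- (exp_ln (Cmod w)) at 1 by exact Hw.
    rewrite <- Rmult_assoc, (Rmult_comm (exp _) K), Rmult_assoc, <- exp_plus. do 2 f_equal.
      field; lra.
  + set (w := (h * z)%C).
    assert (Hw0 : w <> RtoC 0) by (apply Cmult_neq_0; assumption).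
    assert (Hcw : Cmod w = h * Cmod z) by (unfold w; rewrite Cmod_mult, Cmod_R, Rabs_pos_eq; lra).
    assert (Hln : ln (Cmod w) = - / c + ln (Cmod z)) by (rewrite Hcw, ln_mult, Lh; lra).
    assert (A : away d w) by (apply away_scal; auto; lra).
    assert (I := IHm w Hw0 A ltac:(lra)).
    rewrite (theta_shift h Hh z Hz0). fold w. rewrite Cmod_mult.
    apply Rle_trans with (Cmod z * (K * exp (c / 2 * ln (Cmod w) ^ 2 + ln (Cmod w) / 2)));
      [|apply Rmult_le_compat_l; lra].
    right. rewrite Hln. rewrite <- (exp_ln (Cmod z)) at 3 by exact Hm.
    rewrite <- (Rmult_assoc (exp _)), (Rmult_comm (exp _) K), Rmult_assoc, <- exp_plus.
      do 2 f_equal. field; lra.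
Qed.

End ThetaLower.

(** Here exp (- 1/(k / ln q)) = q^{-1/k}. *)
Lemma Theta_theta (q k : R) (z : C) : 1 < q -> 0 < k -> z <> RtoC 0 ->
  Theta q k z = theta (exp (- / (k / ln q))) z.
Proof.
intros Hq Hk Hz. assert (Hlq : 0 < ln q) by (rewrite <- ln_1; apply ln_increasing; lra).
set (h := exp (- / (k / ln q))).
assert (Hh : 0 < h < 1).
{ split. apply exp_pos. rewrite <- exp_0. apply exp_increasing.
  assert (0 < / (k / ln q)) by (apply Rinv_0_lt_compat, Rdiv_lt_0_compat; lra). lra. }
assert (E : forall n x, x = - (INR n * (INR n - 1)) / (2 * k) -> Rpower q x = qtri h n).
{ intros n x ->. rewrite (qtri_Rpower h Hh). unfold Rpower, h. rewrite ln_exp. f_equal. field.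
  lra. }
unfold Theta, CSeries_Z, theta. f_equal.
- apply CSeries_ext. intros n. f_equal.
  + f_equal. apply E. rewrite mult_IZR, minus_IZR, <- INR_IZR_INZ. reflexivity.
  + destruct n; simpl. reflexivity. rewrite SuccNat2Pos.id_succ. reflexivity.
- unfold theta_neg_part. rewrite <- CSeries_scal by apply (summable_theta_neg_part h Hh).
  apply CSeries_ext. intros n. 
  rewrite (E (S (S n))).
  + change (Cpow_Z z (- Z.of_nat (S n))) with (/ z ^ Pos.to_nat (Pos.of_succ_nat n))%C.
    rewrite SuccNat2Pos.id_succ, <- Cpow_inv by exact Hz. rewrite Cpow_S. ring.
  + rewrite mult_IZR, minus_IZR, opp_IZR, <- INR_IZR_INZ, !S_INR. f_equal. ring.
Qed.

(** * Angles *)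

Lemma Cmod_1_cis_sqr (s t : R) : Cmod (1 + s * cis t) ^ 2 = 1 + 2 * s * cos t + s ^ 2.
Proof.
unfold Cmod. rewrite pow2_sqrt. 2: apply Rplus_le_le_0_compat; apply pow2_ge_0.
unfold cis, RtoC, Cplus, Cmult; simpl. assert (H := sin2_cos2 t). unfold Rsqr in H. nra.
Qed.

(** The square of the modulus is 1 + 2 s cos t + s^2, and cos decreases on [0, PI]. *)
Lemma Cmod_1_cis_anti (s t t1 : R) : 0 <= s -> Rabs t <= Rabs t1 -> Rabs t1 <= PI ->
  Cmod (1 + s * cis t1) <= Cmod (1 + s * cis t).
Proof.
intros Hs H1 H2.
assert (E : forall x, cos x = cos (Rabs x)).
  { intros x. unfold Rabs. destruct Rcase_abs; [symmetry; apply cos_neg|reflexivity]. }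
assert (Hc : cos t1 <= cos t).
{ rewrite (E t1), (E t). destruct H1 as [H1| ->]; [|right; reflexivity]. left.
  apply cos_decreasing_1; try apply Rabs_pos; lra. }
assert (Q : Cmod (1 + s * cis t1) ^ 2 <= Cmod (1 + s * cis t) ^ 2).
  { rewrite !Cmod_1_cis_sqr. nra. }
apply Rsqr_incr_0; try apply Cmod_ge_0. unfold Rsqr. simpl in Q. lra.
Qed.

Lemma polar_form (z : C) : z <> RtoC 0 -> exists t, Rabs t <= PI /\ z = (Cmod z * cis t)%C.
Proof.
intros Hz. assert (Hm : 0 < Cmod z) by (apply Cmod_gt_0, Hz). assert (HPI := PI_RGT_0).
destruct z as [x y]. set (m := Cmod (x, y)) in *.
assert (Hxy : x ^ 2 + y ^ 2 = m ^ 2).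
  { unfold m, Cmod. rewrite pow2_sqrt. reflexivity. apply Rplus_le_le_0_compat; apply pow2_ge_0. }
assert (Hx : -1 <= x / m <= 1).
{ split; apply Rmult_le_reg_r with m; try lra; unfold Rdiv; rewrite Rmult_assoc, Rinv_l by lra;
  nra. }
assert (Hs : sqrt (1 - (x / m)²) = Rabs y / m).
{ apply sqrt_lem_1. unfold Rsqr; nra.
  apply Rmult_le_pos; [apply Rabs_pos|left; apply Rinv_0_lt_compat, Hm].
  unfold Rdiv, Rsqr. assert (Y : Rabs y * Rabs y = y * y) by (rewrite <- Rabs_mult;
    apply Rabs_pos_eq; nra).
  replace (Rabs y * / m * (Rabs y * / m)) with ((y * y) / (m * m)) by (rewrite <- Y; field; lra).
  replace (y * y) with (m * m - x * x) by nra. field; lra. }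
assert (B := acos_bound (x / m)).
destruct (Rle_dec 0 y) as [Hy|Hy].
- exists (acos (x / m)). split. rewrite Rabs_pos_eq; lra.
  unfold cis. rewrite cos_acos, sin_acos, Hs by exact Hx. rewrite Rabs_pos_eq by exact Hy.
  unfold Cmult, RtoC; simpl. f_equal; field; lra.
- exists (- acos (x / m)). split. rewrite Rabs_Ropp, Rabs_pos_eq; lra.
  unfold cis. rewrite cos_neg, sin_neg, cos_acos, sin_acos, Hs by exact Hx.
    rewrite Rabs_left by lra.
  unfold Cmult, RtoC; simpl. f_equal; field; lra.
Qed.

Lemma cis_neq_0 t : cis t <> RtoC 0.
Proof. intros E. assert (H := Cmod_cis t). rewrite E, Cmod_0 in H. lra. Qed.

Lemma cis_0 : cis 0 = RtoC 1.
Proof. unfold cis. rewrite cos_0, sin_0. reflexivity. Qed.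

Lemma cis_opp t : cis (- t) = (/ cis t)%C.
Proof.
assert (H : (cis t * cis (- t))%C = RtoC 1) by (rewrite <- cis_plus, Rplus_opp_r; apply cis_0).
replace (cis (- t)) with (/ cis t * (cis t * cis (- t)))%C by (field; apply cis_neq_0). rewrite H.
  ring.
Qed.

Lemma polar_form_near (z : C) (d : R) : z <> RtoC 0 -> exists t, Rabs (d - t) <= PI /\
  z = (Cmod z * cis t)%C.
Proof.
intros Hz. destruct (polar_form (z * cis (- d))%C) as [t [Ht E]].
{ apply Cmult_neq_0; [exact Hz|apply cis_neq_0]. }
exists (t + d). split. replace (d - (t + d)) with (- t) by ring. rewrite Rabs_Ropp. exact Ht.
rewrite cis_plus. rewrite Cmod_mult, Cmod_cis, Rmult_1_r in E.
rewrite Cmult_assoc, <- E, cis_opp. field. apply cis_neq_0.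
Qed.

Lemma cis_near (d t : R) : exists d', Rabs (d' - t) <= PI /\ cis d' = cis d.
Proof.
destruct (polar_form_near (cis d) t (cis_neq_0 d)) as [d' [H1 H2]].
exists d'. split. rewrite Rabs_minus_sym. exact H1. rewrite Cmod_cis in H2. rewrite H2. ring.
Qed.

(** * Bounds of improper integrals and rotation of rays *)

(** The bound is only needed for the proper integrals close to the improper one, so no
    dominating function has to be integrated improperly. *)
Lemma RInt_gen_bound (Fa Fb : (R -> Prop) -> Prop) (f : R -> C) (l : C) (K : R) :
  ProperFilter Fa -> ProperFilter Fb ->
  is_RInt_gen (V := C_R_NormedModule) f Fa Fb l ->
  filter_prod Fa Fb (fun ab => forall v, is_CInt f (fst ab) (snd ab) v -> Cmod v <= K) ->
  Cmod l <= K.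
Proof.
intros PA PB Hf HK. apply le_epsilon. intros e He.
assert (Hl : locally (T := C_R_NormedModule) l (fun v => Cmod (v - l) < e)).
{ apply (proj2 (locally_Cmod l _)). exists e. auto. }
apply Hf in Hl.
unfold filtermapi in Hl. assert (Hx := filter_and (F := filter_prod Fa Fb) _ _ Hl HK).
  apply filter_ex in Hx. destruct Hx as [ab [[v [V1 V2]] V3]].
specialize (V3 v V1). replace l with (v + - (v - l))%C by ring.
eapply Rle_trans. apply Cmod_triangle. rewrite Cmod_opp. lra.
Qed.

Lemma RInt_gen_ex_local (Fa Fb : (R -> Prop) -> Prop) (f : R -> C) (l : C) :
  Filter Fa -> Filter Fb -> is_RInt_gen (V := C_R_NormedModule) f Fa Fb l ->
  filter_prod Fa Fb (fun ab => ex_CInt f (fst ab) (snd ab)).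
Proof.
intros PA PB Hf. assert (Hl : locally (T := C_R_NormedModule) l (fun v => True))
  by (apply filter_true).
apply Hf in Hl. unfold filtermapi in Hl. revert Hl. apply (filter_imp (F := filter_prod Fa Fb)).
  intros ab [v [Hv _]]. exists v. exact Hv.
Qed.

Lemma filter_prod_ray (P : R -> R -> Prop) (A B : R) : 0 < A ->
  (forall a b, 0 < a < A -> B < b -> P a b) ->
  filter_prod (at_right 0) (Rbar_locally p_infty) (fun ab => P (fst ab) (snd ab)).
Proof.
intros HA H. apply Filter_prod with (Q := fun a => 0 < a < A) (R := fun b => B < b).
- exists (mkposreal A HA). intros y Hy Hy0. unfold ball in Hy; simpl in Hy.
  unfold AbsRing_ball, abs, minus, plus, opp in Hy; simpl in Hy.
  apply Rabs_def2 in Hy. lra.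
- exists B. auto.
- intros x y Hx Hy. apply H; assumption.
Qed.

Lemma filter_prod_line (P : R -> R -> Prop) :
  (forall a b, a < b -> P a b) ->
  filter_prod (Rbar_locally m_infty) (Rbar_locally p_infty) (fun ab => P (fst ab) (snd ab)).
Proof.
intros H. apply Filter_prod with (Q := fun a => a < 0) (R := fun b => 0 < b).
- exists 0. auto.
- exists 0. auto.
- intros x y Hx Hy. apply H. simpl. apply Rlt_trans with 0; assumption.
Qed.

Lemma Cmod_CInt_le_primitive (f : R -> C) (g G : R -> R) (a b : R) (v : C) : a <= b ->
  (forall x, a <= x <= b -> Cmod (f x) <= g x) ->
  (forall x, a <= x <= b -> is_derive G x (g x) /\ continuous g x) ->
  is_CInt f a b v -> Cmod v <= G b - G a.
Proof.
intros Hab Hf HG Hv.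
eapply Cmod_CInt_le; [exact Hab|exact Hf|exact Hv|].
apply (is_RInt_derive (V := R_CompleteNormedModule)); rewrite Rmin_left, Rmax_right by lra;
  intros x Hx; apply HG, Hx.
Qed.

Lemma cauchy_polar_bound (F : C -> C) (a b t1 t2 B : R) : 0 < a <= b ->
  (forall r t, a <= r <= b -> Rmin t1 t2 <= t <= Rmax t1 t2 -> Cdiff F (r * cis t)%C) ->
  (forall r t, r = a \/ r = b -> Rmin t1 t2 <= t <= Rmax t1 t2 -> Cmod (F (r * cis t)%C) <= B) ->
  Cmod (CInt (fun r => / r * F (r * cis t2)) a b - CInt (fun r => / r * F (r * cis t1)) a b)%C
  <= 2 * (Rabs (t2 - t1) * B).
Proof.
assert (W : forall t1 t2, t1 <= t2 -> 0 < a <= b ->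
  (forall r t, a <= r <= b -> t1 <= t <= t2 -> Cdiff F (r * cis t)%C) ->
  (forall r t, r = a \/ r = b -> t1 <= t <= t2 -> Cmod (F (r * cis t)%C) <= B) ->
  Cmod (CInt (fun r => / r * F (r * cis t2)) a b - CInt (fun r => / r * F (r * cis t1)) a b)%C
  <= 2 * (Rabs (t2 - t1) * B)).
{ clear t1 t2. intros t1 t2 Ht Hab HF HB. rewrite (cauchy_polar F a b t1 t2 Hab Ht HF).
  rewrite Cmod_mult, Cmod_Ci, Rmult_1_l. unfold Cminus. eapply Rle_trans. apply Cmod_triangle.
    rewrite Cmod_opp.
  assert (X : forall r, r = a \/ r = b ->
    Cmod (CInt (fun t => F (r * cis t)%C) t1 t2) <= Rabs (t2 - t1) * B).
  { intros r Hr. eapply Cmod_CInt_le_const.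
    2: apply CInt_correct, (ex_CInt_arc F a b t1 t2 r); auto; [lra|destruct Hr; lra].
    rewrite Rmin_left, Rmax_right by lra. intros t Htt. apply HB; assumption. }
  assert (X1 := X a (or_introl eq_refl)). assert (X2 := X b (or_intror eq_refl)). lra. }
intros Hab HF HB. destruct (Rle_dec t1 t2) as [H|H].
- rewrite Rmin_left, Rmax_right in HF, HB by lra. apply W; assumption.
- rewrite Rmin_right, Rmax_left in HF, HB by lra. 
  match goal with |- Cmod (?x - ?y)%C <= _ => replace (x - y)%C with (- (y - x))%C by ring end.
    rewrite Cmod_opp, Rabs_minus_sym.
  apply W; auto; lra.
Qed.

(** * Bound of the q-Laplace transform *)

Lemma ln_gt_0 q : 1 < q -> 0 < ln q.
Proof. intros H. rewrite <- ln_1. apply ln_increasing; lra. Qed.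

Lemma exp_le_compat x y : x <= y -> exp x <= exp y.
Proof. intros [H| ->]; [left; apply exp_increasing, H|right; reflexivity]. Qed.

Lemma theta_base_range q k : 1 < q -> 0 < k -> 0 < exp (- / (k / ln q)) < 1.
Proof.
intros Hq Hk. assert (H := ln_gt_0 q Hq). split. apply exp_pos. rewrite <- exp_0.
  apply exp_increasing.
assert (0 < / (k / ln q)) by (apply Rinv_0_lt_compat, Rdiv_lt_0_compat; lra). lra.
Qed.

Lemma Cdiff_Theta q k z : 1 < q -> 0 < k -> z <> RtoC 0 -> Cdiff (Theta q k) z.
Proof.
intros Hq Hk Hz. assert (Hm : 0 < Cmod z) by (apply Cmod_gt_0, Hz).
apply (Cdiff_ext_loc (theta (exp (- / (k / ln q)))) (Theta q k) z (Cmod z) Hm).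
- intros w Hw. symmetry. apply Theta_theta; auto. intros ->.
  replace (0 - z)%C with (- z)%C in Hw by ring. rewrite Cmod_opp in Hw. lra.
- apply Cdiff_theta; [apply theta_base_range; assumption|exact Hz].
Qed.

Lemma Theta_inv_bound q k d : 1 < q -> 0 < k -> 0 < d -> exists A, 0 < A /\
  forall z, z <> RtoC 0 -> away d z -> Theta q k z <> RtoC 0 /\
    Cmod (/ Theta q k z) <= A * exp (- (k / ln q / 2 * ln (Cmod z) ^ 2 + ln (Cmod z) / 2)).
Proof.
intros Hq Hk Hd. set (h := exp (- / (k / ln q))). assert (Hh := theta_base_range q k Hq Hk).
  fold h in Hh.
assert (Hc : 0 < k / ln q) by (apply Rdiv_lt_0_compat; [lra|apply ln_gt_0, Hq]).
destruct (qpoch_cv h Hh) as [_ HL].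
assert (HK : 0 < d ^ 2 * qpoch_inf h ^ 3) by (apply Rmult_lt_0_compat; apply pow_lt; assumption).
exists (/ (d ^ 2 * qpoch_inf h ^ 3)). split. apply Rinv_0_lt_compat, HK.
intros z Hz Ha. assert (B := theta_lower h Hh (k / ln q) d z Hc eq_refl Hd Hz Ha).
unfold h in B at 2. rewrite <- (Theta_theta q k z Hq Hk Hz) in B.
set (E := k / ln q / 2 * ln (Cmod z) ^ 2 + ln (Cmod z) / 2) in *.
assert (HE := exp_pos E). assert (P : 0 < Cmod (Theta q k z)) by nra.
assert (Hn : Theta q k z <> RtoC 0) by (apply Cmod_gt_0, P).
split; [exact Hn|]. rewrite Cmod_inv by exact Hn. rewrite exp_Ropp, <- Rinv_mult.
apply Rinv_le_contravar; [nra|exact B].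
Qed.

(** The difference of the two sides is at least (c/2) (|y| - 3/(2c))^2. *)
Lemma gaussian_le_exp_abs c y : 0 < c -> - (c / 2 * y ^ 2 + y / 2) <= 9 / (8 * c) - Rabs y.
Proof.
intros Hc. assert (H := pow2_ge_0 (Rabs y - 3 / (2 * c))).
assert (E : c / 2 * (Rabs y - 3 / (2 * c)) ^ 2 = c / 2 * y ^ 2 - 3 / 2 * Rabs y + 9 / (8 * c)).
{ rewrite <- (pow2_abs y). field; lra. }
assert (0 <= c / 2 * (Rabs y - 3 / (2 * c)) ^ 2) by (apply Rmult_le_pos; lra).
assert (- y <= Rabs y). { rewrite <- Rabs_Ropp. apply Rle_abs. } lra.
Qed.

(** The right-hand side, taken at y = ln (r / rho), makes a primitive in r available,
    namely an arctangent. *)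
Lemma exp_abs_le y : exp (- Rabs y) <= 2 * exp y / (1 + exp y ^ 2).
Proof.
assert (H := exp_pos y). assert (P : 0 < 1 + exp y ^ 2) by nra.
apply Rmult_le_reg_r with (1 + exp y ^ 2); [exact P|].
unfold Rdiv. rewrite Rmult_assoc, Rinv_l, Rmult_1_r by lra.
unfold Rabs. destruct (Rcase_abs y) as [Hy|Hy].
- rewrite Ropp_involutive. assert (exp y <= 1) by (rewrite <- exp_0; apply exp_le_compat; lra).
  nra.
- assert (1 <= exp y) by (rewrite <- exp_0; apply exp_le_compat; lra).
  rewrite exp_Ropp. replace (/ exp y * (1 + exp y ^ 2)) with (/ exp y + exp y) by (field; lra).
  assert (/ exp y <= / 1) by (apply Rinv_le_contravar; lra). lra.
Qed.

Lemma Cmod_ray_integrand (w th : C) (r t : R) : 0 < r -> th <> RtoC 0 ->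
  Cmod (w / th / (r * cis t) * cis t)%C = Cmod w * Cmod (/ th) * / r.
Proof.
intros Hr Hth. replace (w / th / (r * cis t) * cis t)%C with (w * / th * / r)%C.
- rewrite !Cmod_mult. rewrite <- RtoC_inv by lra. rewrite Cmod_R, Rabs_pos_eq. reflexivity.
  left; apply Rinv_0_lt_compat, Hr.
- field. repeat split; first [exact Hth|apply cis_neq_0|apply RtoC_neq_0; lra].
Qed.

(** For r <= R0 the kernel alone is integrable with respect to dr/r, uniformly in tau.
    For r >= R0 the growth of w cancels the leading term of the kernel and leaves
    exp ((al + c ln |tau|) ln r) <= 1/r. *)
Lemma laplace_bound q k d al R0 : 1 < q -> 0 < k -> 0 < d -> 1 <= R0 ->
  exists K, 0 < K /\ forall (dir : R) (w : C -> C) (tau : C) (M : R),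
    tau <> RtoC 0 -> away d (cis dir / tau)%C -> 0 <= M ->
    ln (Cmod tau) <= 0 -> al + k / ln q * ln (Cmod tau) <= - 1 ->
    (forall r, 0 < r <= R0 -> Cmod (w (r * cis dir)%C) <= M) ->
    (forall r, R0 <= r -> Cmod (w (r * cis dir)%C)
      <= M * exp (k / ln q / 2 * ln r ^ 2 + al * ln r)) ->
    ex_qLaplace q k dir w tau -> Cmod (qLaplace q k dir w tau) <= K * M.
Proof.
intros Hq Hk Hd HR0. set (c := k / ln q).
assert (Hc : 0 < c) by (apply Rdiv_lt_0_compat; [lra|apply ln_gt_0, Hq]).
destruct (Theta_inv_bound q k d Hq Hk Hd) as [A [HA HT]]. fold c in HT.
set (B := exp (9 / (8 * c))). assert (HB : 0 < B) by apply exp_pos.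
assert (HPI := PI_RGT_0).
exists (c * (A * (2 * B + 2) * PI)). split.
  { apply Rmult_lt_0_compat; [exact Hc|]. apply Rmult_lt_0_compat; [|exact HPI].
  apply Rmult_lt_0_compat; lra. }
intros dir w tau M Htau Haw HM Hl Hal Hw1 Hw2 Hex.
set (rho := Cmod tau) in *. assert (Hrho : 0 < rho) by (apply Cmod_gt_0, Htau).
set (lam := ln rho) in *.
unfold qLaplace. fold c. rewrite Cmod_mult, Cmod_R, Rabs_pos_eq by lra. rewrite Rmult_assoc.
apply Rmult_le_compat_l; [lra|].
unfold CInt_ray, CInt_gen. unfold ex_qLaplace, ex_CInt_ray, ex_CInt_gen in Hex.
apply (RInt_gen_correct (V := C_R_CompleteNormedModule)) in Hex.
set (f := fun r : R => (w (r * cis dir) / Theta q k (r * cis dir / tau) / (r * cis dir)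
  * cis dir)%C) in *.
eapply RInt_gen_bound; [| |exact Hex|]; try typeclasses eauto.
apply (filter_prod_ray (fun a b => forall v : C, is_CInt f a b v ->
  Cmod v <= A * (2 * B + 2) * PI * M) 1 1); [lra|].
intros a b Ha Hb v Hv.
(* The two terms dominate the integrand for r <= R0 and for r >= R0, respectively. *)
set (g := fun r => A * M * (2 * B * (/ rho / (1 + (r / rho) ^ 2)) + 2 / (1 + r ^ 2))).
set (G := fun r => A * M * (2 * B * atan (r / rho) + 2 * atan r)).
apply Rle_trans with (G b - G a).
- apply (Cmod_CInt_le_primitive f g G a b v); [lra| | |exact Hv].
  + intros r Hr. unfold f. assert (Hr0 : 0 < r) by lra.
    set (u := (r * cis dir)%C). 
    assert (Hu : u <> RtoC 0) by (apply Cmult_neq_0; [apply RtoC_neq_0; lra|apply cis_neq_0]).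
    assert (Hut : (u / tau)%C <> RtoC 0).
      { unfold Cdiv. apply Cmult_neq_0; [exact Hu|]. intros E. assert (X := Cinv_r tau Htau).
      rewrite E, Cmult_0_r in X. injection X. lra. }
    assert (Hau : away d (u / tau)%C).
      { replace (u / tau)%C with (r * (cis dir / tau))%C by (unfold u; field; exact Htau).
      apply away_scal; auto; lra. }
    destruct (HT _ Hut Hau) as [T1 T2].
    unfold u at 3. rewrite Cmod_ray_integrand; auto.
    assert (Hmu : Cmod (u / tau) = r / rho).
      { rewrite Cmod_div by exact Htau. unfold u. rewrite Cmod_polar; [reflexivity|lra]. }
    rewrite Hmu in T2. 
    assert (Hlr : ln (r / rho) = ln r - lam) by (unfold Rdiv; rewrite ln_mult, ln_Rinv;
      [reflexivity| | |apply Rinv_0_lt_compat]; lra).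
    set (y := ln (r / rho)) in *.
    assert (Hy : exp y = r / rho) by (unfold y; apply exp_ln, Rdiv_lt_0_compat; lra).
    assert (G1 : 0 <= 2 * B * (/ rho / (1 + (r / rho) ^ 2))).
    { apply Rmult_le_pos; [lra|]. left. apply Rdiv_lt_0_compat. apply Rinv_0_lt_compat, Hrho.
      assert (X := pow2_ge_0 (r / rho)); lra. }
    assert (G2 : 0 <= 2 / (1 + r ^ 2)).
      { left. apply Rdiv_lt_0_compat. lra. assert (X := pow2_ge_0 r); lra. }
    assert (HAM : 0 <= A * M) by nra.
    assert (Hir : 0 < / r) by (apply Rinv_0_lt_compat, Hr0).
    destruct (Rle_dec r R0) as [Hrr|Hrr].
    * apply Rle_trans with (A * M * (2 * B * (/ rho / (1 + (r / rho) ^ 2))));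
      [|unfold g; apply Rmult_le_compat_l; lra].
      apply Rle_trans with (M * (A * (B * exp (- Rabs y))) * / r).
      -- apply Rmult_le_compat_r; [lra|]. apply Rmult_le_compat; try apply Cmod_ge_0.
        apply Hw1; lra.
         eapply Rle_trans; [exact T2|]. apply Rmult_le_compat_l; [lra|]. unfold B.
           rewrite <- exp_plus.
         apply exp_le_compat. apply gaussian_le_exp_abs, Hc.
      -- assert (X := exp_abs_le y). rewrite Hy in X.
         replace (A * M * (2 * B * (/ rho / (1 + (r / rho) ^ 2))))
           with (M * (A * (B * (2 * (r / rho) / (1 + (r / rho) ^ 2)))) * / r).
         2:{ field. repeat split; try lra. assert (Y := pow2_ge_0 r).
           assert (0 < rho ^ 2) by (apply pow_lt; lra). lra. }
         apply Rmult_le_compat_r; [lra|]. apply Rmult_le_compat_l; [lra|].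
           apply Rmult_le_compat_l; [lra|]. apply Rmult_le_compat_l; [lra|]. exact X.
    * apply Rle_trans with (A * M * (2 / (1 + r ^ 2))); [|unfold g; apply Rmult_le_compat_l; lra].
      set (x := ln r) in *.
      assert (Hx : 0 <= x). { unfold x. rewrite <- ln_1. apply ln_le_compat; lra. }
      apply Rle_trans with (M * exp (c / 2 * x ^ 2 + al * x)
        * (A * exp (- (c / 2 * y ^ 2 + y / 2))) * / r).
      -- apply Rmult_le_compat_r; [lra|].
        apply Rmult_le_compat; try apply Cmod_ge_0; [apply Hw2; lra|exact T2].
      -- replace (M * exp (c / 2 * x ^ 2 + al * x) * (A * exp (- (c / 2 * y ^ 2 + y / 2)))
        * / r) with
           (A * M * (exp (c / 2 * x ^ 2 + al * x + - (c / 2 * y ^ 2 + y / 2)) * / r))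
             by (rewrite exp_plus; ring).
         apply Rmult_le_compat_l; [exact HAM|].
         apply Rle_trans with (/ r * / r).
         ++ apply Rmult_le_compat_r; [lra|]. rewrite <- (exp_ln r) at 1 by exact Hr0.
           rewrite <- exp_Ropp. fold x. apply exp_le_compat.
            rewrite Hlr. assert (0 <= c / 2 * lam ^ 2) by (apply Rmult_le_pos;
              [lra|apply pow2_ge_0]). nra.
         ++ assert (1 <= r) by lra. apply Rmult_le_reg_r with (r * r * (1 + r ^ 2)). nra.
           field_simplify; nra.
  + intros r Hr. assert (P1 : 0 < 1 + (r / rho) ^ 2) by (assert (X := pow2_ge_0 (r / rho)); lra).
    assert (P2 : 0 < 1 + r ^ 2) by (assert (X := pow2_ge_0 r); lra).
    split.
    * unfold G, g. auto_derive; [trivial|]. field. simpl in P1, P2.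
      repeat split; try lra; try nra. 
    * apply (ex_derive_continuous (K := R_AbsRing) (V := R_NormedModule)). unfold g. auto_derive.
      simpl in P1, P2. repeat split; lra.
- unfold G. 
  assert (B1 := atan_bound (b / rho)). assert (B2 := atan_bound (a / rho)).
    assert (B3 := atan_bound b). assert (B4 := atan_bound a).
  assert (HAM : 0 <= A * M) by nra.
  replace (A * (2 * B + 2) * PI * M) with (A * M * ((2 * B + 2) * PI)) by ring.
  rewrite <- Rmult_minus_distr_l. apply Rmult_le_compat_l; [exact HAM|]. nra.
Qed.

(** * Growth bounds on a ray through a singularity of the bound *)

Lemma polar_right (x y : R) : 0 < x -> ((x, y) : C) = (Cmod (x, y) * cis (atan (y / x)))%C.
Proof.
intros Hx. unfold cis. rewrite cos_atan, sin_atan.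
assert (E : sqrt (1 + (y / x)²) = Cmod (x, y) / x).
{ apply sqrt_lem_1. unfold Rsqr; nra.
  apply Rmult_le_pos; [apply Cmod_ge_0|left; apply Rinv_0_lt_compat, Hx].
  assert (X : Cmod (x, y) * Cmod (x, y) = x * x + y * y).
    { unfold Cmod. rewrite sqrt_sqrt; simpl; [ring|nra]. }
  unfold Rsqr. replace (Cmod (x, y) / x * (Cmod (x, y) / x))
    with ((Cmod (x, y) * Cmod (x, y)) / (x * x)) by (field; lra).
  rewrite X. field; lra. }
rewrite E. assert (Hm : 0 < Cmod (x, y)) by (apply Cmod_gt_0; intros Q; injection Q; lra).
unfold Cmult, RtoC; simpl. f_equal; field; lra.
Qed.

Lemma sector_ray (d h r : R) : 0 < h -> 0 < r -> sector d h (r * cis d)%C.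
Proof. intros Hh Hr. exists r, d. rewrite Rminus_diag, Rabs_R0. auto. Qed.

Lemma sector_open_ray (d h r : R) : 0 < h -> 0 < r ->
  exists eta, 0 < eta /\ forall v, Cmod (v - r * cis d)%C < eta -> sector d h v.
Proof.
intros Hh Hr.
(* A point (x, y) near 1 has the argument atan (y / x), which is small. *)
assert (Ha : exists e, 0 < e /\ forall t, Rabs t < e -> Rabs (atan t) < h).
{ destruct (real_derive_eps atan 0 (/ (1 + 0²)) (is_derive_atan 0) 1 Rlt_0_1) as [e1 [He1 H1]].
  exists (Rmin e1 (h / 3)). split. apply Rmin_glb_lt; lra.
  intros t Ht. assert (T1 : Rabs t < e1) by (eapply Rlt_le_trans; [apply Ht|apply Rmin_l]).
  assert (T2 : Rabs t < h / 3) by (eapply Rlt_le_trans; [apply Ht|apply Rmin_r]).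
  specialize (H1 t T1). rewrite Rplus_0_l, atan_0, Rminus_0_r in H1. unfold Rsqr in H1.
    rewrite Rmult_0_r, Rplus_0_r, Rinv_1, Rmult_1_r in H1.
  replace (atan t) with ((atan t - t) + t) by ring. eapply Rle_lt_trans. apply Rabs_triang. lra. }
destruct Ha as [e [He Ha]]. set (e' := Rmin e 1 / 2).
assert (He' : 0 < e' /\ e' <= / 2 /\ 2 * e' <= e).
{ unfold e'. assert (Rmin e 1 <= e) by apply Rmin_l. assert (Rmin e 1 <= 1) by apply Rmin_r.
  assert (0 < Rmin e 1) by (apply Rmin_glb_lt; lra). lra. }
exists (r * e'). split. apply Rmult_lt_0_compat; lra.
intros v Hv. set (z := (/ r * / cis d * v)%C).
assert (Hr0 : RtoC r <> RtoC 0) by (apply RtoC_neq_0; lra).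
assert (Hd0 := cis_neq_0 d).
assert (Hvz : v = (r * cis d * z)%C) by (unfold z; field; auto).
assert (Hz : Cmod (z - 1) < e').
{ apply Rmult_lt_reg_l with r; [exact Hr|].
  replace (r * Cmod (z - 1)) with (Cmod (v - r * cis d)%C); [exact Hv|].
  rewrite Hvz. replace (r * cis d * z - r * cis d)%C with (r * (cis d * (z - 1)))%C by ring.
  rewrite !Cmod_mult, Cmod_cis, Cmod_R, Rabs_pos_eq; lra. }
destruct z as [x y]. assert (X := Rabs_fst_le ((x, y) - 1)%C).
  assert (Y := Rabs_snd_le ((x, y) - 1)%C). simpl in X, Y.
assert (X1 : Rabs (x + - (1)) < e') by lra. apply Rabs_def2 in X1.
assert (Y1 : Rabs y < e'). { replace y with (y + - 0) by ring. lra. }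
assert (Hx : / 2 < x) by lra.
exists (r * Cmod (x, y)), (d + atan (y / x)). split; [|split].
- apply Rmult_lt_0_compat; [exact Hr|]. apply Cmod_gt_0. intros Q; injection Q; lra.
- replace (d + atan (y / x) - d) with (atan (y / x)) by ring. apply Ha.
  unfold Rdiv. rewrite Rabs_mult. rewrite (Rabs_pos_eq (/ x)) by (left; apply Rinv_0_lt_compat;
    lra).
  apply Rlt_le_trans with (e' * 2); [|lra]. apply Rmult_le_0_lt_compat. apply Rabs_pos.
    left; apply Rinv_0_lt_compat; lra. exact Y1.
  rewrite <- (Rinv_inv 2). apply Rinv_lt_contravar; [|lra]. apply Rmult_lt_0_compat; lra.
- rewrite Hvz. rewrite (polar_right x y) at 1 by lra. rewrite cis_plus, RtoC_mult. ring.
Qed.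

(** The distance from - delta to the whole ray; it is positive unless the ray passes
    through that point. *)
Lemma ray_dist (d delta r : R) : 0 < delta -> 0 <= r -> 0 <= cos d \/ sin d <> 0 ->
  delta * (if Rle_dec 0 (cos d) then 1 else Rabs (sin d)) <= Cmod (r * cis d + delta)%C.
Proof.
intros Hd Hr Hcs. 
assert (E : Cmod (r * cis d + delta)%C ^ 2 = (r * cos d + delta) ^ 2 + (r * sin d) ^ 2).
{ unfold Cmod. rewrite pow2_sqrt. 2: apply Rplus_le_le_0_compat; apply pow2_ge_0. simpl. ring. }
assert (S := sin2_cos2 d). unfold Rsqr in S.
apply Rsqr_incr_0; [|destruct Rle_dec;
  [lra|apply Rmult_le_pos; [lra|apply Rabs_pos]]|apply Cmod_ge_0].
unfold Rsqr. replace (Cmod (r * cis d + delta) * Cmod (r * cis d + delta))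
  with (Cmod (r * cis d + delta)%C ^ 2) by ring.
rewrite E. destruct Rle_dec as [H|H].
- assert (0 <= r * cos d) by nra. assert (0 <= (r * sin d) ^ 2) by apply pow2_ge_0. nra.
- replace (delta * Rabs (sin d) * (delta * Rabs (sin d))) with (delta ^ 2 * (sin d) ^ 2)
  by (rewrite <- (pow2_abs (sin d)); ring).
  assert (0 <= (r + delta * cos d) ^ 2) by apply pow2_ge_0. nra.
Qed.

Definition log_gaussian (c al s : R) : R := exp (c / 2 * ln s ^ 2 + al * ln s).

Lemma log_gaussian_bounded c al s1 s2 s : 0 < c -> 0 < s1 -> s1 <= s <= s2 ->
  log_gaussian c al s <= exp (c / 2 * (Rabs (ln s1) + Rabs (ln s2)) ^ 2 + Rabs al
    * (Rabs (ln s1) + Rabs (ln s2))).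
Proof.
intros Hc H1 Hs. apply exp_le_compat.
assert (L1 := ln_le_compat s1 s H1 (proj1 Hs)).
  assert (L2 := ln_le_compat s s2 ltac:(lra) (proj2 Hs)).
set (Lm := Rabs (ln s1) + Rabs (ln s2)).
assert (HL : Rabs (ln s) <= Lm).
{ unfold Lm. assert (X := Rabs_pos (ln s1)). assert (X2 := Rabs_pos (ln s2)).
  assert (Y := Rle_abs (ln s2)). assert (Z := Rle_abs (- ln s1)). rewrite Rabs_Ropp in Z.
  apply Rabs_le; lra. }
rewrite <- (pow2_abs (ln s)). assert (X0 := Rabs_pos (ln s)).
apply Rplus_le_compat.
- apply Rmult_le_compat_l; [lra|]. apply pow_incr; lra.
- eapply Rle_trans; [apply Rle_abs|]. rewrite Rabs_mult.
  apply Rmult_le_compat_l; [apply Rabs_pos|exact HL].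
Qed.

(** With ln s = ln r + y one has |y| <= 2 delta / r, and ln r <= r bounds the cross term
    of the square. *)
Lemma log_gaussian_shift c al delta s r : 0 < c -> 0 < delta -> 2 * delta + 1 <= r ->
  r - delta <= s <= r + delta ->
  log_gaussian c al s <= exp (2 * c * delta + c / 2 + Rabs al) * log_gaussian c al r.
Proof.
intros Hc Hd Hr Hs. unfold log_gaussian. rewrite <- exp_plus. apply exp_le_compat.
set (x := ln r). set (y := ln s - x).
assert (Hx : 0 <= x < r). { unfold x. split. rewrite <- ln_1; apply ln_le_compat; lra.
  assert (H := exp_ineq1_le (ln r)). rewrite exp_ln in H; lra. }
assert (Hy1 : y <= delta / r).
{ unfold y, x. rewrite <- ln_div by lra. assert (H := exp_ineq1_le (ln (s / r))).
  rewrite exp_ln in H by (apply Rdiv_lt_0_compat; lra).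
  apply Rle_trans with (s / r - 1). lra. apply Rmult_le_reg_r with r; [lra|]. field_simplify; lra.
    }
assert (Hy2 : - (2 * delta / r) <= y).
{ assert (H := exp_ineq1_le (ln (r / s))). rewrite exp_ln in H by (apply Rdiv_lt_0_compat; lra).
  rewrite ln_div in H by lra. fold x in H.
  assert (r / s - 1 <= 2 * delta / r).
    { apply Rmult_le_reg_r with (s * r). apply Rmult_lt_0_compat; lra. field_simplify; try lra.
    nra. }
  unfold y. lra. }
assert (Hdr : 0 <= delta / r). { apply Rmult_le_pos; [lra|left; apply Rinv_0_lt_compat; lra]. }
assert (Hdr2 : 2 * delta / r = 2 * (delta / r)) by (field; lra).
assert (Hya : Rabs y <= 2 * (delta / r)) by (apply Rabs_le; lra).
assert (Hd1 : 2 * (delta / r) <= 1).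
  { apply Rmult_le_reg_r with r; [lra|].
  replace (2 * (delta / r) * r) with (2 * delta) by (field; lra). lra. }
assert (Hxd : 2 * (delta / r) * x <= 2 * delta).
{ apply Rle_trans with (2 * (delta / r) * r). apply Rmult_le_compat_l; lra. right; field; lra. }
replace (ln s) with (x + y) by (unfold y; ring). fold x.
assert (A1 := Rle_abs y). assert (A0 := Rabs_pos y).
assert (A2 : y * y <= 1). { replace (y * y) with (Rabs y * Rabs y) by (rewrite <- Rabs_mult;
  apply Rabs_pos_eq; nra). nra. }
assert (A3 : al * y <= Rabs al). { eapply Rle_trans; [apply Rle_abs|]. rewrite Rabs_mult.
  assert (B := Rabs_pos al). nra. }
assert (A4 : x * y <= 2 * delta) by nra.
nra.
Qed.

(** Away from - delta the given bound suffices.  If the ray passes through - delta, a disc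
    around that point lies in the sector; for u closer than eta to - delta the circle of
    radius 2 eta around u keeps the distance eta from - delta, and the maximum principle
    applies. *)
Lemma log_gaussian_ray_bound (d hU c al delta : R) : 0 < hU -> 0 < c -> 0 < delta ->
  exists K, 0 < K /\ forall (w : C -> C) (M : R), 0 <= M ->
   (forall u, sector d hU u -> Cdiff w u) ->
   (forall u, sector d hU u -> (u + delta)%C <> RtoC 0 ->
     Cmod (w u) <= M * log_gaussian c al (Cmod (u + delta)%C)) ->
   (forall r, 0 < r <= 2 * delta + 1 -> Cmod (w (r * cis d)%C) <= K * M) /\
   (forall r, 2 * delta + 1 <= r -> Cmod (w (r * cis d)%C) <= K * M * log_gaussian c al r).
Proof.
intros HU Hc Hdel.
assert (Loc : exists K0, 0 < K0 /\ forall (w : C -> C) (M : R), 0 <= M ->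
   (forall u, sector d hU u -> Cdiff w u) ->
   (forall u, sector d hU u -> (u + delta)%C <> RtoC 0 ->
     Cmod (w u) <= M * log_gaussian c al (Cmod (u + delta)%C)) ->
   (forall r, 0 < r <= 2 * delta + 1 -> Cmod (w (r * cis d)%C) <= K0 * M)).
{ set (KK := fun eta => exp (c / 2 * (Rabs (ln eta) + Rabs (ln (3 * delta + 1 + 3 * eta))) ^ 2
  + Rabs al * (Rabs (ln eta) + Rabs (ln (3 * delta + 1 + 3 * eta))))).
  assert (Far : forall eta (w : C -> C) (M : R) u, 0 < eta -> 0 <= M -> sector d hU u ->
     (forall u, sector d hU u -> (u + delta)%C <> RtoC 0 ->
       Cmod (w u) <= M * log_gaussian c al (Cmod (u + delta)%C)) ->
     eta <= Cmod (u + delta)%C <= 3 * delta + 1 + 3 * eta -> Cmod (w u) <= KK eta * M).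
  { intros eta w M u He HM Hu Hw Hs. eapply Rle_trans. apply Hw; auto. apply Cmod_gt_0; lra.
    rewrite Rmult_comm. apply Rmult_le_compat_r; [exact HM|]. apply log_gaussian_bounded; auto. }
  assert (Up : forall r, 0 < r <= 2 * delta + 1 -> Cmod (r * cis d + delta)%C <= 3 * delta + 1).
  { intros r Hr. eapply Rle_trans. apply Cmod_triangle.
    rewrite Cmod_polar, Cmod_R, Rabs_pos_eq by lra. lra. }
  assert (S := sin2_cos2 d). unfold Rsqr in S.
  destruct (Req_dec (cos d) (- 1)) as [Hcm|Hcm].
  - (* the ray passes through - delta *)
    assert (Hcis : cis d = (- RtoC 1)%C).
      { unfold cis. rewrite Hcm. assert (sin d = 0) by nra. rewrite H. unfold Copp, RtoC; simpl.
      f_equal; ring. }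
    destruct (sector_open_ray d hU delta HU Hdel) as [e0 [He0 Ho]].
    set (eta := e0 / 3). assert (Heta : 0 < eta) by (unfold eta; lra).
    exists (KK eta). split. apply exp_pos.
    intros w M HM Hd Hw r Hr. set (u0 := (r * cis d)%C).
    assert (Hu0 : Cmod (u0 + delta)%C <= 3 * delta + 1) by (apply Up, Hr).
    destruct (Rle_dec eta (Cmod (u0 + delta)%C)) as [Q|Q].
    + apply (Far eta w M u0); auto. apply sector_ray; lra. lra.
    + assert (In : forall u, Cmod (u - u0) <= 2 * eta -> sector d hU u).
      { intros u Hu. apply Ho. rewrite Hcis.
        replace (u - delta * - (1))%C with ((u - u0) + (u0 + delta))%C by ring.
        eapply Rle_lt_trans. apply Cmod_triangle. unfold eta in *; lra. }
      apply (Cmod_le_of_circle w u0 (2 * eta)); [lra| |].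
      * intros u Hu. apply Hd, In, Hu.
      * intros u Hu. apply (Far eta w M u); auto. apply In; lra.
        assert (T1 := Cmod_triangle (u - u0) (u0 + delta)).
          replace (u - u0 + (u0 + delta))%C with (u + delta)%C in T1 by ring.
        assert (T2 := Cmod_triangle (u + delta) (- (u0 + delta))).
          replace (u + delta + - (u0 + delta))%C with (u - u0)%C in T2 by ring.
          rewrite Cmod_opp in T2. lra.
  - set (eta := delta * (if Rle_dec 0 (cos d) then 1 else Rabs (sin d))).
    assert (Hcs : 0 <= cos d \/ sin d <> 0).
    { destruct (Rle_dec 0 (cos d)) as [Q|Q]; [left; exact Q|right]. intros E. rewrite E in S.
      apply Hcm. nra. }
    assert (Heta : 0 < eta).
    { unfold eta. apply Rmult_lt_0_compat; [exact Hdel|]. destruct Rle_dec as [Q|Q]; [lra|].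
      apply Rabs_pos_lt. destruct Hcs; [contradiction|assumption]. }
    exists (KK eta). split. apply exp_pos.
    intros w M HM Hd Hw r Hr. apply (Far eta w M); auto. apply sector_ray; lra.
    split. apply ray_dist; auto; lra. assert (X := Up r Hr). lra. }
destruct Loc as [K0 [HK0 Loc]].
set (K1 := exp (2 * c * delta + c / 2 + Rabs al)). assert (HK1 : 0 < K1) by apply exp_pos.
exists (K0 + K1). split; [lra|].
intros w M HM Hd Hw. split.
- intros r Hr. eapply Rle_trans. apply (Loc w M HM Hd Hw r Hr). apply Rmult_le_compat_r; lra.
- intros r Hr. set (u := (r * cis d)%C).
  assert (Hs : r - delta <= Cmod (u + delta)%C <= r + delta).
  { assert (Hu : Cmod u = r) by (apply Cmod_polar; lra).
    assert (HD : Cmod (RtoC delta) = delta) by (rewrite Cmod_R; apply Rabs_pos_eq; lra).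
    split. assert (T := Cmod_triangle (u + delta) (- RtoC delta)).
      replace (u + delta + - delta)%C with u in T by ring. rewrite Cmod_opp in T. lra.
    eapply Rle_trans. apply Cmod_triangle. lra. }
  eapply Rle_trans. apply Hw. apply sector_ray; lra. apply Cmod_gt_0; lra.
  assert (Q := log_gaussian_shift c al delta (Cmod (u + delta)%C) r Hc Hdel Hr Hs). fold K1 in Q.
  assert (Q0 : 0 < log_gaussian c al r) by apply exp_pos.
  apply Rle_trans with (M * (K1 * log_gaussian c al r)). apply Rmult_le_compat_l; assumption.
  replace (M * (K1 * log_gaussian c al r)) with (K1 * (M * log_gaussian c al r)) by ring.
    rewrite Rmult_assoc.
  apply Rmult_le_compat_r; [nra|lra].
Qed.

(** * Difference of two q-Laplace integrals *)

Definition cone (d dir : R) (u : C) : Prop :=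
  u <> RtoC 0 /\ forall s : R, 0 <= s -> Cmod (1 + s * cis dir / u)%C > d.

Lemma Cinv_neq_0 (z : C) : z <> RtoC 0 -> (/ z)%C <> RtoC 0.
Proof. intros H E. assert (X := Cinv_r z H). rewrite E, Cmult_0_r in X. injection X. lra. Qed.

Lemma cone_away d dir T : cone d dir T -> away d (cis dir / T)%C.
Proof.
intros [_ H] s Hs. left. replace (s * (cis dir / T))%C with (s * cis dir / T)%C by (unfold Cdiv;
  ring).
apply H, Hs.
Qed.

Lemma Cmult_cis_div (s dir r t : R) : 0 < r ->
  (s * cis dir / (r * cis t))%C = ((s / r)%R * cis (dir - t))%C.
Proof.
intros Hr. replace (dir - t) with (dir + - t) by ring. rewrite cis_plus, cis_opp.
rewrite RtoC_div by lra. field. split; [apply cis_neq_0|apply RtoC_neq_0; lra].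
Qed.

Lemma polar_neq_0 r t : 0 < r -> (r * cis t)%C <> RtoC 0.
Proof. intros. apply Cmult_neq_0; [apply RtoC_neq_0; lra|apply cis_neq_0]. Qed.

Lemma cone_of_angle d dir phi r t : (forall s, 0 <= s -> Cmod (1 + s * cis phi)%C > d) ->
  Rabs (dir - t) <= Rabs phi -> Rabs phi <= PI -> 0 < r -> cone d dir (r * cis t)%C.
Proof.
intros H H1 H2 Hr. split. apply polar_neq_0, Hr.
intros s Hs. rewrite Cmult_cis_div by exact Hr.
assert (Hsr : 0 <= s / r) by (apply Rmult_le_pos; [lra|left; apply Rinv_0_lt_compat, Hr]).
eapply Rge_gt_trans; [|apply (H (s / r) Hsr)]. apply Rle_ge, Cmod_1_cis_anti; assumption.
Qed.

Lemma angle_of_cone d dir r t : 0 < r -> cone d dir (r * cis t)%C ->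
  forall s, 0 <= s -> Cmod (1 + s * cis (dir - t))%C > d.
Proof.
intros Hr [_ H] s Hs. specialize (H (s * r) ltac:(nra)). rewrite Cmult_cis_div in H by exact Hr.
replace (s * r / r) with s in H by (field; lra). exact H.
Qed.

(** This is exp (- (c/2) log^2 |T|) |T|^{c log r1 + 1/2}, what the Theta kernel leaves at
    the radius r1. *)
Definition theta_decay (c r1 : R) (T : C) : R :=
  exp (- (c / 2 * ln (Cmod T) ^ 2) + (c * ln r1 + 1 / 2) * ln (Cmod T)).

(** On the ray the quadratic terms in ln r cancel.  The remaining exponent of r is at most
    - 1/2, so the integral is governed by its lower end r1. *)
Lemma tail_bound q k d nu r1 : 1 < q -> 0 < k -> 0 < d -> 0 < r1 ->
  exists K, 0 < K /\ forall dir (w : C -> C) T M b v,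
    T <> RtoC 0 -> away d (cis dir / T)%C -> 0 <= M -> nu + k / ln q * ln (Cmod T) <= 0 ->
    (forall r, r1 <= r -> Cmod (w (r * cis dir)%C) <= M * log_gaussian (k / ln q) nu r) ->
      r1 <= b ->
    is_CInt (fun r => w (r * cis dir) / Theta q k (r * cis dir / T) / (r * cis dir)
      * cis dir)%C r1 b v ->
    Cmod v <= K * M * theta_decay (k / ln q) r1 T.
Proof.
intros Hq Hk Hd Hr1. set (c := k / ln q).
assert (Hc : 0 < c) by (apply Rdiv_lt_0_compat; [lra|apply ln_gt_0, Hq]).
destruct (Theta_inv_bound q k d Hq Hk Hd) as [A [HA HT]]. fold c in HT.
set (x1 := ln r1). set (B := 2 * exp ((nu - 1 / 2) * x1)).
assert (HB : 0 < B) by (unfold B; assert (X := exp_pos ((nu - 1 / 2) * x1)); lra).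
exists (A * B). split. nra.
intros dir w T M b v HT0 Haw HM Hnu Hw Hb Hv.
set (L := ln (Cmod T)) in *. assert (HmT : 0 < Cmod T) by (apply Cmod_gt_0, HT0).
set (D := A * M * exp (- (c / 2 * L ^ 2) + L / 2 + (nu + c * L - 1 / 2) * x1 + x1 / 2)).
assert (HD : 0 <= D) by (apply Rmult_le_pos; [nra|left; apply exp_pos]).
set (g := fun r => D * (exp (- (ln r / 2)) / r)).
  set (G := fun r => - 2 * D * exp (- (ln r / 2))).
apply Rle_trans with (G b - G r1).
- apply (Cmod_CInt_le_primitive _ g G r1 b v Hb) in Hv; [exact Hv| |].
  + intros r Hr. cbv beta. assert (Hr0 : 0 < r) by lra. set (u := (r * cis dir)%C).
    assert (Hu : u <> RtoC 0) by (apply polar_neq_0, Hr0).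
    assert (Hut : (u / T)%C <> RtoC 0) by (apply Cmult_neq_0; [exact Hu|apply Cinv_neq_0, HT0]).
    assert (Hau : away d (u / T)%C).
      { replace (u / T)%C with (r * (cis dir / T))%C by (unfold u; field; exact HT0).
      apply away_scal; auto; lra. }
    destruct (HT _ Hut Hau) as [T1 T2].
    unfold u at 3. rewrite Cmod_ray_integrand; auto.
    assert (Hmu : Cmod (u / T) = r / Cmod T).
      { rewrite Cmod_div by exact HT0. unfold u. rewrite Cmod_polar; [reflexivity|lra]. }
    rewrite Hmu, ln_div in T2 by lra. fold L in T2. set (x := ln r) in *.
    assert (Hir : 0 < / r) by (apply Rinv_0_lt_compat, Hr0).
    assert (Hx : x1 <= x) by (apply ln_le_compat; lra).
    unfold g. fold x. replace (D * (exp (- (x / 2)) / r)) with (D * exp (- (x / 2)) * / r)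
      by (unfold Rdiv; ring). apply Rmult_le_compat_r; [lra|].
    eapply Rle_trans. apply Rmult_le_compat; try apply Cmod_ge_0; [apply Hw; lra|exact T2].
    unfold log_gaussian. fold x. unfold D.
    replace (M * exp (c / 2 * x ^ 2 + nu * x)
      * (A * exp (- (c / 2 * (x - L) ^ 2 + (x - L) / 2)))) with
      (A * M * exp (c / 2 * x ^ 2 + nu * x + - (c / 2 * (x - L) ^ 2 + (x - L) / 2)))
        by (rewrite exp_plus; ring).
    rewrite (Rmult_assoc (A * M)), <- exp_plus. apply Rmult_le_compat_l; [nra|].
      apply exp_le_compat.
    assert (0 <= (- (nu + c * L)) * (x - x1)) by (apply Rmult_le_pos; lra). nra.
  + intros r Hr. split.
    * unfold G, g. auto_derive; [lra|]. change (ln r * / 2) with (ln r / 2). field. lra.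
    * apply (ex_derive_continuous (K := R_AbsRing) (V := R_NormedModule)). unfold g. auto_derive.
      lra.
- unfold G. fold x1. assert (X := exp_pos (- (ln b / 2))).
  apply Rle_trans with (2 * D * exp (- (x1 / 2))); [nra|].
  right. unfold D, B, theta_decay. fold L x1.
  replace (2 * (A * M * exp (- (c / 2 * L ^ 2) + L / 2 + (nu + c * L - 1 / 2) * x1 + x1 / 2))
    * exp (- (x1 / 2))) with
    (2 * (A * M) * (exp (- (c / 2 * L ^ 2) + L / 2 + (nu + c * L - 1 / 2) * x1 + x1 / 2 +
      - (x1 / 2)))) by (rewrite (exp_plus _ (- (x1 / 2))); ring).
  replace (A * (2 * exp ((nu - 1 / 2) * x1)) * M
    * exp (- (c / 2 * L ^ 2) + (c * x1 + 1 / 2) * L)) with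
    (2 * (A * M) * (exp ((nu - 1 / 2) * x1 + (- (c / 2 * L ^ 2) + (c * x1 + 1 / 2) * L))))
      by (rewrite (exp_plus ((nu - 1 / 2) * x1)); ring).
  f_equal. f_equal. field.
Qed.

(** For |u| = r1 this is the lower bound of Theta.  As |u| tends to 0 the kernel tends to 0,
    so small arcs satisfy the same bound. *)
Lemma arc_bound q k d r1 : 1 < q -> 0 < k -> 0 < d -> 0 < r1 ->
  exists K, 0 < K /\ forall T, T <> RtoC 0 -> exists a0, 0 < a0 /\
    forall u, u <> RtoC 0 -> away d (u / T)%C -> (Cmod u = r1 \/ Cmod u <= a0) ->
    Cmod (/ Theta q k (u / T)) <= K * theta_decay (k / ln q) r1 T.
Proof.
intros Hq Hk Hd Hr1. set (c := k / ln q).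
assert (Hc : 0 < c) by (apply Rdiv_lt_0_compat; [lra|apply ln_gt_0, Hq]).
destruct (Theta_inv_bound q k d Hq Hk Hd) as [A [HA HT]]. fold c in HT.
set (x1 := ln r1).
exists (A * exp (- (c / 2 * x1 ^ 2) - x1 / 2)). split.
  apply Rmult_lt_0_compat; [exact HA|apply exp_pos].
intros T HT0. set (L := ln (Cmod T)). assert (HmT : 0 < Cmod T) by (apply Cmod_gt_0, HT0).
set (Y := Rabs (x1 - L)).
(* The exponent (c/2) y^2 + y/2 is decreasing for y <= - 1/(2c); at y = - (1/c + Y) it
   is already at least its value at x1 - L. *)
exists (exp (L - / c - Y)). split. apply exp_pos.
intros u Hu Hau Hr.
assert (Hm : 0 < Cmod u) by (apply Cmod_gt_0, Hu).
assert (Hut : (u / T)%C <> RtoC 0) by (apply Cmult_neq_0; [exact Hu|apply Cinv_neq_0, HT0]).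
destruct (HT _ Hut Hau) as [_ T2]. rewrite Cmod_div, ln_div in T2 by (auto; lra). fold L in T2.
eapply Rle_trans; [exact T2|]. rewrite Rmult_assoc. apply Rmult_le_compat_l; [lra|].
unfold theta_decay. fold L x1. rewrite <- exp_plus. apply exp_le_compat.
replace (- (c / 2 * x1 ^ 2) - x1 / 2 + (- (c / 2 * L ^ 2) + (c * x1 + 1 / 2) * L))
  with (- (c / 2 * (x1 - L) ^ 2 + (x1 - L) / 2)) by field.
apply Ropp_le_contravar. destruct Hr as [Hr|Hr].
- rewrite Hr. fold x1. lra.
- assert (Hl : ln (Cmod u) - L <= - (/ c + Y)).
  { apply ln_le_compat in Hr; [|exact Hm]. rewrite ln_exp in Hr. lra. }
  set (y := ln (Cmod u) - L) in *.
  assert (HY : 0 <= Y) by apply Rabs_pos.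
  assert (X1 : (x1 - L) ^ 2 = Y ^ 2) by (unfold Y; rewrite pow2_abs; reflexivity).
  assert (X2 : x1 - L <= Y) by apply Rle_abs.
  rewrite X1. apply Rle_trans with (c / 2 * Y ^ 2 + Y / 2); [lra|].
  assert (Hci : 0 < / c) by (apply Rinv_0_lt_compat, Hc).
  assert (Z : c * y + 1 <= - (c * Y)).
    { assert (Q : c * y <= c * (- (/ c + Y))) by (apply Rmult_le_compat_l; lra).
    replace (c * - (/ c + Y)) with (- 1 - c * Y) in Q by (field; lra). lra. }
  assert (Z1 : 0 <= c * Y) by nra.
  assert (P : (/ c + Y) * (c * Y) <= - y * - (c * y + 1)) by (apply Rmult_le_compat; lra).
  replace ((/ c + Y) * (c * Y)) with (Y + c * Y ^ 2) in P by (field; lra). nra.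
Qed.

Definition ray_integrand (q k dir : R) (w : C -> C) (T : C) (r : R) : C :=
  (w (r * cis dir) / Theta q k (r * cis dir / T) / (r * cis dir) * cis dir)%C.

(** The angle mx bounds the distances from th, the argument of T, and the cone condition
    holds for all angles up to mx; this keeps the whole sector between dir and t2 both in
    the cone of dir and away from the zeros of u |-> Theta (u/T). *)
Lemma ray_rotation q k d r1 K0 dir t2 th (Lw : C -> C) T M a B0 mx :
  1 < q -> 0 < k -> 0 < d -> T <> RtoC 0 -> 0 <= M -> 0 < a <= r1 ->
  T = (Cmod T * cis th)%C -> mx <= PI ->
  (forall phi, Rabs phi <= mx -> forall s, 0 <= s -> Cmod (1 + s * cis phi)%C > d) ->
  Rabs (dir - th) <= mx -> Rabs (t2 - th) <= mx -> Rabs (dir - t2) <= mx ->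
  (forall u, cone d dir u -> Cmod u <= r1 -> Cdiff Lw u /\ Cmod (Lw u) <= M) ->
  (forall z, z <> RtoC 0 -> away d z -> Theta q k z <> RtoC 0) ->
  (forall u, u <> RtoC 0 -> away d (u / T)%C -> (Cmod u = r1 \/ Cmod u = a) ->
    Cmod (/ Theta q k (u / T)) <= K0 * B0) ->
  0 <= K0 * B0 ->
  let F := fun u => (Lw u / Theta q k (u / T))%C in
  Cmod (CInt (fun r => / r * F (r * cis t2)) a r1 - CInt (fun r => / r * F (r * cis dir)) a r1)%C
    <= 2 * (PI * (M * (K0 * B0))) /\
  ex_CInt (fun r => / r * F (r * cis dir))%C a r1 /\
    ex_CInt (fun r => / r * F (r * cis t2))%C a r1.
Proof.
intros Hq Hk Hd HT HM Ha HTp Hmx Hgood H1 H2 H3 HL Hn Hth HB F.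
assert (HmT : 0 < Cmod T) by (apply Cmod_gt_0, HT).
assert (Hmx0 : 0 <= mx) by (eapply Rle_trans; [apply Rabs_pos|apply H1]).
assert (Hcone : forall r t, 0 < r -> Rmin dir t2 <= t <= Rmax dir t2 ->
  cone d dir (r * cis t)%C /\ away d (r * cis t / T)%C).
{ intros r t Hr Ht.
  assert (Hb : Rabs (dir - t) <= mx /\ Rabs (t - th) <= mx).
  { apply Rabs_le_between in H1. apply Rabs_le_between in H2. apply Rabs_le_between in H3.
    unfold Rmin, Rmax in Ht. destruct (Rle_dec dir t2); split; apply Rabs_le; lra. }
  split.
  - apply cone_of_angle with (phi := mx); auto; rewrite ?(Rabs_pos_eq mx) by lra; try lra.
    apply (Hgood mx). rewrite Rabs_pos_eq; lra.
  - intros s Hs. left. rewrite HTp.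
    replace (s * (r * cis t / (Cmod T * cis th)))%C with (s * r * cis t / (Cmod T * cis th))%C
      by (unfold Cdiv; ring).
    rewrite <- RtoC_mult, Cmult_cis_div by exact HmT. apply Hgood; [tauto|].
    apply Rmult_le_pos; [nra|left; apply Rinv_0_lt_compat, HmT]. }
assert (HF : forall r t, a <= r <= r1 -> Rmin dir t2 <= t <= Rmax dir t2 ->
  Cdiff F (r * cis t)%C).
{ intros r t Hr Ht. assert (Hr0 : 0 < r) by lra. destruct (Hcone r t Hr0 Ht) as [C1 C2].
  assert (Hut : (r * cis t / T)%C <> RtoC 0) by (apply Cmult_neq_0;
    [apply polar_neq_0, Hr0|apply Cinv_neq_0, HT]).
  unfold F. apply (Cdiff_mult Lw (fun u => / Theta q k (u / T))%C).
  - apply HL; [exact C1|rewrite Cmod_polar; lra].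
  - apply (Cdiff_comp Cinv (fun u => Theta q k (u / T))). apply Cdiff_inv, Hn; assumption.
    apply (Cdiff_comp (Theta q k) (fun u => u / T)%C). apply Cdiff_Theta; assumption.
    apply Cdiff_mult. apply Cdiff_id. apply Cdiff_const. }
split; [|split].
- eapply Rle_trans. apply (cauchy_polar_bound F a r1 dir t2 (M * (K0 * B0)) Ha HF).
  + intros r t Hr Ht. assert (Hr0 : 0 < r) by (destruct Hr; lra).
    assert (Hr1 : r <= r1) by (destruct Hr; lra).
    destruct (Hcone r t Hr0 Ht) as [C1 C2]. unfold F, Cdiv at 1. rewrite Cmod_mult.
    apply Rmult_le_compat; try apply Cmod_ge_0. apply HL; [exact C1|rewrite Cmod_polar; lra].
    apply Hth; auto. apply polar_neq_0, Hr0. rewrite Cmod_polar by lra. tauto.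
  + apply Rmult_le_compat_l; [lra|]. apply Rmult_le_compat_r. apply Rmult_le_pos; assumption.
    rewrite Rabs_minus_sym. lra.
- eexists. apply is_CInt_polar; [exact Ha|]. intros r Hr. apply HF; [exact Hr|].
  split; [apply Rmin_l|apply Rmax_l].
- eexists. apply is_CInt_polar; [exact Ha|]. intros r Hr. apply HF; [exact Hr|].
  split; [apply Rmin_r|apply Rmax_r].
Qed.

Lemma ex_CInt_sub (f : R -> C) a b c : a <= b <= c -> ex_CInt f a c -> ex_CInt f a b /\
  ex_CInt f b c.
Proof.
intros H He. split.
apply (ex_RInt_Chasles_1 (V := C_R_CompleteNormedModule) f a b c H He).
apply (ex_RInt_Chasles_2 (V := C_R_CompleteNormedModule) f a b c H He).
Qed.

Lemma CInt_ext (f g : R -> C) a b : (forall x, Rmin a b < x < Rmax a b -> f x = g x) ->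
  CInt f a b = CInt g a b.
Proof. apply (RInt_ext (V := C_R_CompleteNormedModule)). Qed.

(** Both rays are turned, on [a, r1], to the bisector cm of the directions dA and dB', the
    latter being dB up to a multiple of 2 PI.  On the bisector LA and LB agree, so only
    arcs and tails remain; the arcs of radius a stay bounded as a tends to 0. *)
Lemma rays_difference q k d nu r1 : 1 < q -> 0 < k -> 0 < d -> 0 < r1 ->
  exists K, 0 < K /\ forall dA dB (wA wB LA LB : C -> C) T M IA IB,
    0 <= M -> cone d dA T -> cone d dB T -> nu + k / ln q * ln (Cmod T) <= 0 ->
    (forall u, cone d dA u -> Cmod u <= r1 -> Cdiff LA u /\ Cmod (LA u) <= M) ->
    (forall u, cone d dB u -> Cmod u <= r1 -> Cdiff LB u /\ Cmod (LB u) <= M) ->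
    (forall u, cone d dA u -> cone d dB u -> Cmod u <= r1 -> LA u = LB u) ->
    (forall r, 0 < r <= r1 -> wA (r * cis dA)%C = LA (r * cis dA)%C) ->
    (forall r, 0 < r <= r1 -> wB (r * cis dB)%C = LB (r * cis dB)%C) ->
    (forall r, r1 <= r -> Cmod (wA (r * cis dA)%C) <= M * log_gaussian (k / ln q) nu r) ->
    (forall r, r1 <= r -> Cmod (wB (r * cis dB)%C) <= M * log_gaussian (k / ln q) nu r) ->
    is_RInt_gen (V := C_R_NormedModule) (ray_integrand q k dA wA T) (at_right 0)
      (Rbar_locally p_infty) IA ->
    is_RInt_gen (V := C_R_NormedModule) (ray_integrand q k dB wB T) (at_right 0)
      (Rbar_locally p_infty) IB ->
    Cmod (IB - IA) <= K * M * theta_decay (k / ln q) r1 T.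
Proof.
intros Hq Hk Hd Hr1. set (c := k / ln q).
destruct (tail_bound q k d nu r1 Hq Hk Hd Hr1) as [K1 [HK1 HT1]]. fold c in HT1.
destruct (arc_bound q k d r1 Hq Hk Hd Hr1) as [K0 [HK0 HT0]]. fold c in HT0.
destruct (Theta_inv_bound q k d Hq Hk Hd) as [A0 [_ HTn]].
assert (HPI := PI_RGT_0).
exists (2 * K1 + 4 * (PI * K0)). split. assert (0 < PI * K0) by (apply Rmult_lt_0_compat; lra).
  lra.
intros dA dB wA wB LA LB T M IA IB HM CA CB Hnu HLA HLB HAB EA EB TA TB HIA HIB.
assert (HT := proj1 CA). assert (HmT : 0 < Cmod T) by (apply Cmod_gt_0, HT).
(* The representatives of both directions nearest to the argument th of T determine the
   sense of rotation. *)
destruct (polar_form_near T dA HT) as [th [Hth1 HTp]].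
destruct (cis_near dB th) as [dB' [Hth2 HdB]].
set (B0 := theta_decay c r1 T). assert (HB0 : 0 < B0) by apply exp_pos.
set (mx := Rmax (Rabs (dA - th)) (Rabs (dB' - th))).
assert (Hmx : mx <= PI) by (apply Rmax_lub; assumption).
assert (CB' : cone d dB' T) by (unfold cone in *; rewrite HdB; exact CB).
assert (Hgood : forall phi, Rabs phi <= mx -> forall s, 0 <= s -> Cmod (1 + s * cis phi)%C > d).
{ rewrite HTp in CA, CB'. assert (GA := angle_of_cone d dA (Cmod T) th HmT CA).
  assert (GB := angle_of_cone d dB' (Cmod T) th HmT CB').
  intros phi Hphi s Hs. unfold mx, Rmax in Hphi.
    destruct (Rle_dec (Rabs (dA - th)) (Rabs (dB' - th))).
  - eapply Rge_gt_trans; [|apply (GB s Hs)]. apply Rle_ge, Cmod_1_cis_anti; assumption.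
  - eapply Rge_gt_trans; [|apply (GA s Hs)]. apply Rle_ge, Cmod_1_cis_anti; assumption. }
assert (HmA : Rabs (dA - th) <= mx) by apply Rmax_l.
  assert (HmB : Rabs (dB' - th) <= mx) by apply Rmax_r.
set (cm := (dA + dB') / 2).
assert (Hcm : Rabs (cm - th) <= mx /\ Rabs (dA - cm) <= mx /\ Rabs (dB' - cm) <= mx).
{ apply Rabs_le_between in HmA. apply Rabs_le_between in HmB. unfold cm.
  repeat split; apply Rabs_le; lra. }
destruct Hcm as [Hcm1 [Hcm2 Hcm3]].
assert (Hmx0 : 0 <= mx) by (eapply Rle_trans; [apply Rabs_pos|apply HmA]).
assert (Hmid : forall r, 0 < r -> cone d dA (r * cis cm)%C /\ cone d dB' (r * cis cm)%C).
{ intros r Hr. split; apply cone_of_angle with (phi := mx); auto;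
  rewrite ?(Rabs_pos_eq mx) by lra; try lra; apply (Hgood mx); rewrite Rabs_pos_eq; lra. }
assert (HLB' : forall u, cone d dB' u -> Cmod u <= r1 -> Cdiff LB u /\ Cmod (LB u) <= M).
{ intros u Hu. apply HLB. unfold cone in *. rewrite HdB in Hu. exact Hu. }
destruct (HT0 T HT) as [a0 [Ha0 Harc]]. fold B0 in Harc.
assert (Hdiff := is_RInt_gen_minus _ _ _ _ HIB HIA).
assert (XA := RInt_gen_ex_local _ _ _ _ _ _ HIA).
  assert (XB := RInt_gen_ex_local _ _ _ _ _ _ HIB).
refine (RInt_gen_bound _ _ _ _ _ _ _ Hdiff _); try typeclasses eauto.
assert (XC : filter_prod (at_right 0) (Rbar_locally p_infty) (fun ab => 0 < fst ab < Rmin a0 r1 /\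
  r1 < snd ab)).
{ apply (filter_prod_ray (fun a b => 0 < a < Rmin a0 r1 /\ r1 < b) (Rmin a0 r1) r1).
  apply Rmin_glb_lt; assumption. auto. }
assert (X := filter_and _ _ XA (filter_and _ _ XB XC)). revert X.
apply (filter_imp (F := filter_prod (at_right 0) (Rbar_locally p_infty))).
intros [a b]. simpl. intros [YA [YB [Ya Yb]]] v Hv.
assert (Ya1 : a < a0) by (eapply Rlt_le_trans; [apply Ya|apply Rmin_l]).
assert (Ya2 : a < r1) by (eapply Rlt_le_trans; [apply Ya|apply Rmin_r]).
set (fA := ray_integrand q k dA wA T) in *. set (fB := ray_integrand q k dB wB T) in *.
assert (Ev : v = (CInt fB a b - CInt fA a b)%C).
{ rewrite <- (CInt_unique _ _ _ _ Hv). apply CInt_unique.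
  apply is_CInt_minus; apply CInt_correct; assumption. }
destruct (ex_CInt_sub fA a r1 b ltac:(lra) YA) as [YA1 YA2].
  destruct (ex_CInt_sub fB a r1 b ltac:(lra) YB) as [YB1 YB2].
assert (BA := HT1 dA wA T M b (CInt fA r1 b) HT (cone_away _ _ _ CA) HM Hnu TA ltac:(lra)
  (CInt_correct _ _ _ YA2)).
assert (BB := HT1 dB wB T M b (CInt fB r1 b) HT (cone_away _ _ _ CB) HM Hnu TB ltac:(lra)
  (CInt_correct _ _ _ YB2)).
fold B0 in BA, BB.
assert (HKB : 0 <= K0 * B0) by nra.
assert (Hnz : forall z, z <> RtoC 0 -> away d z -> Theta q k z <> RtoC 0) by (intros z Z1 Z2;
  apply (HTn z Z1 Z2)).
assert (Harc' : forall u, u <> RtoC 0 -> away d (u / T)%C -> (Cmod u = r1 \/ Cmod u = a) ->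
  Cmod (/ Theta q k (u / T)) <= K0 * B0).
{ intros u U1 U2 U3. apply Harc; auto. destruct U3; [left; assumption|right; lra]. }
assert (Ha : 0 < a <= r1) by lra.
destruct (ray_rotation q k d r1 K0 dA cm th LA T M a B0 mx Hq Hk Hd HT HM Ha HTp Hmx Hgood HmA
  Hcm1 Hcm2 HLA Hnz Harc' HKB) as [RA [EA1 EA2]].
destruct (ray_rotation q k d r1 K0 dB' cm th LB T M a B0 mx Hq Hk Hd HT HM Ha HTp Hmx Hgood HmB
  Hcm1 Hcm3 HLB' Hnz Harc' HKB) as [RB [EB1 EB2]].
cbv beta zeta in *.
set (FA := fun u => (LA u / Theta q k (u / T))%C).
  set (FB := fun u => (LB u / Theta q k (u / T))%C).
assert (IA1 : CInt fA a r1 = CInt (fun r => / r * FA (r * cis dA))%C a r1).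
{ apply CInt_ext. intros r Hr. rewrite Rmin_left, Rmax_right in Hr by lra.
  unfold fA, ray_integrand, FA. rewrite EA by lra.
  set (y := (LA (r * cis dA) / Theta q k (r * cis dA / T))%C). clearbody y. field.
    split; first [apply cis_neq_0|apply RtoC_neq_0; lra]. }
assert (IB1 : CInt fB a r1 = CInt (fun r => / r * FB (r * cis dB'))%C a r1).
{ apply CInt_ext. intros r Hr. rewrite Rmin_left, Rmax_right in Hr by lra.
  unfold fB, ray_integrand, FB. rewrite HdB, EB by lra.
  set (y := (LB (r * cis dB) / Theta q k (r * cis dB / T))%C). clearbody y. field.
    split; first [apply cis_neq_0|apply RtoC_neq_0; lra]. }
assert (Imid : CInt (fun r => / r * FA (r * cis cm))%C a r1 = CInt (fun r =>
  / r * FB (r * cis cm))%C a r1).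
{ apply CInt_ext. intros r Hr. rewrite Rmin_left, Rmax_right in Hr by lra. unfold FA, FB.
  rewrite HAB; auto.
  apply Hmid; lra. assert (Q : cone d dB' (r * cis cm)%C) by (apply Hmid; lra). unfold cone in *.
    rewrite HdB in Q. exact Q.
  rewrite Cmod_polar; lra. }
change (Cmod (CInt (fun r => / r * FA (r * cis cm))%C a r1 - CInt (fun r =>
  / r * FA (r * cis dA))%C a r1)%C <= 2 * (PI * (M * (K0 * B0)))) in RA.
change (Cmod (CInt (fun r => / r * FB (r * cis cm))%C a r1 - CInt (fun r =>
  / r * FB (r * cis dB'))%C a r1)%C <= 2 * (PI * (M * (K0 * B0)))) in RB.
rewrite (CInt_Chasles fA a r1 b YA1 YA2), (CInt_Chasles fB a r1 b YB1 YB2), IA1, IB1 in Ev.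
set (rA := CInt (fun r => / r * FA (r * cis dA))%C a r1) in *.
  set (rB := CInt (fun r => / r * FB (r * cis dB'))%C a r1) in *.
set (mA := CInt (fun r => / r * FA (r * cis cm))%C a r1) in *.
  set (mB := CInt (fun r => / r * FB (r * cis cm))%C a r1) in *.
rewrite Ev. rewrite Imid in RA.
match goal with |- Cmod ?e <= _ => replace e
  with (CInt fB r1 b + (- CInt fA r1 b + ((mB - rA) + - (mB - rB))))%C by ring end.
eapply Rle_trans. apply Cmod_triangle. 
assert (Q1 := Cmod_triangle (- CInt fA r1 b) ((mB - rA) + - (mB - rB))).
assert (Q2 := Cmod_triangle (mB - rA) (- (mB - rB))). rewrite Cmod_opp in Q1, Q2.
fold c. fold B0. replace ((2 * K1 + 4 * (PI * K0)) * M * B0)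
  with (K1 * M * B0 + (K1 * M * B0 + (2 * (PI * (M * (K0 * B0))) + 2 * (PI * (M * (K0 * B0))))))
  by ring.
lra.
Qed.

(** * The solutions of the equation *)

Lemma weight_pos mu beta m : 0 < weight mu beta m.
Proof. unfold weight. apply Rmult_lt_0_compat; apply exp_pos. Qed.

Lemma kappa_pos e : equation_hyps e -> 0 < e_kappa e.
Proof.
intros He. destruct (eh_k He) as [H1 H2]. unfold e_kappa. apply Rinv_0_lt_compat.
assert (/ e_k e L2 < / e_k e L1) by (apply Rinv_lt_contravar; [nra|lra]). lra.
Qed.

Lemma affine_le_opp_1 (a c x : R) : 0 < c -> x <= - (Rabs a + 1) / c -> a + c * x <= - 1.
Proof.
intros Hc Hx. assert (c * x <= c * (- (Rabs a + 1) / c)) by (apply Rmult_le_compat_l; lra).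
replace (c * (- (Rabs a + 1) / c)) with (- (Rabs a + 1)) in H by (field; lra).
assert (X := Rle_abs a). lra.
Qed.

(** The radius r0 is chosen such that al + c ln r0 <= - 1, as [laplace_bound] requires. *)
Lemma Laplace_w1_bound e g s p : equation_hyps e -> geometry_hyps e g -> family_hyps e g s ->
  (p < g_n g)%nat ->
  exists K r0, 0 < K /\ 0 < r0 /\ forall m eps tau, E_ g p eps -> Rset g p tau ->
    Cmod tau <= r0 ->
    Cdiff (Laplace_w1 e g s p m eps) tau /\
    Cmod (Laplace_w1 e g s p m eps tau) <= K * weight (e_mu e) (e_beta e) m.
Proof.
intros He Hg Hs Hp.
assert (Hq := eh_q He). assert (Hlq := ln_gt_0 _ Hq). assert (Hkap := kappa_pos e He).
set (c := e_kappa e / ln (e_q e)). assert (Hc : 0 < c) by (apply Rdiv_lt_0_compat; assumption).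
set (al := g_alpha g).
destruct (fh_W2_bound Hs Hp) as [KW [delta [HKW [Hdel HW]]]].
destruct (gh_U Hg Hp) as [HU _].
destruct (log_gaussian_ray_bound (g_dir g p) (g_U_half g p) c al delta HU Hc Hdel)
  as [K1 [HK1 H1]].
destruct (laplace_bound (e_q e) (e_kappa e) (g_dtilde g) al (2 * delta
  + 1) Hq Hkap (proj1 (gh_dtilde Hg)) ltac:(lra)) as [K2 [HK2 H2]].
fold c in H2.
set (rb := Rpower (e_q e) ((1 / 2 - g_alpha g) / e_kappa e) / 2).
assert (Hrb : 0 < rb) by (unfold rb;
  assert (X := exp_pos ((1 / 2 - g_alpha g) / e_kappa e * ln (e_q e))); unfold Rpower; lra).
set (r0 := Rmin (rb / 2) (Rmin 1 (exp (- (Rabs al + 1) / c)))).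
assert (Hr0 : 0 < r0) by (repeat apply Rmin_glb_lt; try lra; apply exp_pos).
assert (Hr1 : r0 <= rb / 2) by apply Rmin_l.
assert (Hr2 : r0 <= 1) by (eapply Rle_trans; [apply Rmin_r|apply Rmin_l]).
assert (Hr3 : r0 <= exp (- (Rabs al + 1) / c)) by (eapply Rle_trans; [apply Rmin_r|apply Rmin_r]).
exists (K2 * (K1 * KW)), r0. split; [repeat apply Rmult_lt_0_compat; assumption|].
  split; [exact Hr0|].
intros m eps tau Heps Htau Hr.
destruct (fh_W3_holo Hs (p := p) m (eps := eps) (r1 := rb) Hp Heps ltac:(split;
  [exact Hrb|apply Rle_refl])) as [W3a W3b].
assert (Hdisc : disc rb tau) by (unfold disc; lra).
split; [apply W3b; split; assumption|].
assert (Hcone : cone (g_dtilde g) (g_dir g p) tau) by exact Htau.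
assert (Hm : 0 < Cmod tau) by (apply Cmod_gt_0, Hcone).
assert (Hwt := weight_pos (e_mu e) (e_beta e) m).
destruct (H1 (fun u => f_w1 s p u m eps) (KW * weight (e_mu e) (e_beta e) m)) as [A1 A2].
- nra.
- intros u Hu. exact (@fh_W2_holo_u e g s Hs p m eps Hp Heps u (or_introl Hu)).
- intros u Hu Hne. eapply Rle_trans. apply HW; [left; exact Hu|exact Heps|exact Hne]. right.
  unfold log_gaussian. do 2 f_equal. unfold c. fold al. field. lra.
- unfold Laplace_w1. 
  replace (K2 * (K1 * KW) * weight (e_mu e) (e_beta e) m)
    with (K2 * (K1 * (KW * weight (e_mu e) (e_beta e) m))) by ring.
  apply H2; auto.
  + apply Hcone.
  + apply cone_away, Hcone.
  + left. apply Rmult_lt_0_compat; [exact HK1|]. apply Rmult_lt_0_compat; [exact HKW|exact Hwt].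
  + rewrite <- ln_1. apply ln_le_compat; lra.
  + apply affine_le_opp_1; [exact Hc|]. rewrite <- (ln_exp (- (Rabs al + 1) / c)).
    apply ln_le_compat; lra.
  + apply W3a; assumption.
Qed.

(** Near the origin, w_{k_2} on its ray is a q-Laplace transform of w_{k_1}; r1 lies below all
    radii up to which this, the bounds and the coincidence of the two transforms hold. *)
Lemma inner_difference e g s p : equation_hyps e -> geometry_hyps e g -> family_hyps e g s ->
  (p < g_n g)%nat -> (exists z, U_ g p z /\ U_ g (next g p) z) ->
  exists K r1, 0 < K /\ 0 < r1 /\ forall t eps m, T_ g t -> E_ g p eps -> E_ g (next g p) eps ->
    Cmod (CInt_ray (g_dir g (next g p)) (u_inner e g s (next g p) t eps m) -
          CInt_ray (g_dir g p) (u_inner e g s p t eps m)) <=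
    K * weight (e_mu e) (e_beta e) m * theta_decay (e_k e L2 / ln (e_q e)) r1 (eps * t)%C.
Proof.
intros He Hg Hs Hp HU. set (p' := next g p).
assert (Hn := gh_n Hg).
assert (Hp' : (p' < g_n g)%nat) by (apply Nat.mod_upper_bound; lia).
assert (Hq := eh_q He). assert (Hlq := ln_gt_0 _ Hq). destruct (eh_k He) as [Hk1 Hk2].
  assert (Hk : 0 < e_k e L2) by lra.
assert (Hc : 0 < e_k e L2 / ln (e_q e)) by (apply Rdiv_lt_0_compat; assumption).
destruct (Laplace_w1_bound e g s p He Hg Hs Hp) as [KA [rA [HKA [HrA HA]]]].
destruct (Laplace_w1_bound e g s p' He Hg Hs Hp') as [KB [rB [HKB [HrB HB]]]].
destruct (fh_W1_bound Hs Hp) as [CA [HCA WA]]. destruct (fh_W1_bound Hs Hp') as [CB [HCB WB]].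
destruct (fh_W3_eq Hs Hp) as [hA [sA [HhA [HsA EA]]]].
  destruct (fh_W3_eq Hs Hp') as [hB [sB [HhB [HsB EB]]]].
destruct (gh_S Hg Hp) as [SA _]. destruct (gh_S Hg Hp') as [SB _].
destruct (eh_eps0 He) as [He0 He1]. destruct (gh_rT Hg) as [HrT0 HrT1].
assert (Hdisc : 0 < e_eps0 e * g_rT g) by (apply Rmult_lt_0_compat; assumption).
set (r1 := Rmin (Rmin rA rB) (Rmin (Rmin sA sB) (e_eps0 e * g_rT g)) / 2).
assert (Hr : 0 < r1 /\ r1 <= rA /\ r1 <= rB /\ r1 < sA /\ r1 < sB /\ r1 < e_eps0 e * g_rT g).
{ assert (X0 : 0 < Rmin (Rmin rA rB) (Rmin (Rmin sA sB) (e_eps0 e * g_rT g)))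
  by (repeat apply Rmin_glb_lt; assumption).
  assert (X1 := Rmin_l (Rmin rA rB) (Rmin (Rmin sA sB) (e_eps0 e * g_rT g))).
    assert (X2 := Rmin_r (Rmin rA rB) (Rmin (Rmin sA sB) (e_eps0 e * g_rT g))).
  assert (X3 := Rmin_l rA rB). assert (X4 := Rmin_r rA rB).
    assert (X5 := Rmin_l (Rmin sA sB) (e_eps0 e * g_rT g)).
    assert (X6 := Rmin_r (Rmin sA sB) (e_eps0 e * g_rT g)).
  assert (X7 := Rmin_l sA sB). assert (X8 := Rmin_r sA sB). unfold r1. repeat split; lra. }
clearbody r1. destruct Hr as [Hr1 [HrA1 [HrB1 [HsA1 [HsB1 Hd1]]]]].
destruct (rays_difference (e_q e) (e_k e L2) (g_dtilde g) (g_nu g) r1 Hq Hk (proj1 (gh_dtilde Hg))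
  Hr1) as [K [HK HD]].
set (M0 := KA + KB + CA + CB).
exists (K * M0), r1. split; [unfold M0; apply Rmult_lt_0_compat; lra|]. split; [exact Hr1|].
intros t eps m Ht HeA HeB.
set (T := (eps * t)%C).
assert (RA := gh_Rb_prod Hg Hp Ht HeA). assert (RB := gh_Rb_prod Hg Hp' Ht HeB). fold T in RA, RB.
(* The inner integrals do not involve z; their existence is read off at z = 0. *)
assert (Hz : strip (e_beta e) (RtoC 0)).
  { unfold strip. simpl. rewrite Rabs_R0. apply (eh_beta He). }
destruct (fh_repr Hs Hp Ht Hz HeA) as [IA _]. destruct (fh_repr Hs Hp' Ht Hz HeB) as [IB _].
specialize (IA m). specialize (IB m).
assert (Hwt := weight_pos (e_mu e) (e_beta e) m). set (W := weight (e_mu e) (e_beta e) m) in *.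
assert (Hde := gh_E_sub Hg Hp HeA).
unfold ex_CInt_ray, ex_CInt_gen in IA, IB.
apply (RInt_gen_correct (V := C_R_CompleteNormedModule)) in IA.
apply (RInt_gen_correct (V := C_R_CompleteNormedModule)) in IB.
assert (HmT : 0 < Cmod T) by (apply Cmod_gt_0; apply RA).
assert (TA : forall r, r1 <= r -> Cmod (f_w2 s p (r * cis (g_dir g p))%C m eps)
  <= M0 * W * log_gaussian (e_k e L2 / ln (e_q e)) (g_nu g) r).
{ intros r Hrr. assert (Hsr : S_ g p (r * cis (g_dir g p))%C) by (apply sector_ray; lra).
  eapply Rle_trans. apply WA; assumption. rewrite Cmod_polar by lra.
  replace (e_k e L2 / (2 * ln (e_q e)) * ln r ^ 2) with (e_k e L2 / ln (e_q e) / 2 * ln r ^ 2)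
    by (field; lra).
  fold (log_gaussian (e_k e L2 / ln (e_q e)) (g_nu g) r). fold W.
    apply Rmult_le_compat_r; [left; apply exp_pos|]. apply Rmult_le_compat_r; unfold M0; lra. }
assert (TB : forall r, r1 <= r -> Cmod (f_w2 s p' (r * cis (g_dir g p'))%C m eps)
  <= M0 * W * log_gaussian (e_k e L2 / ln (e_q e)) (g_nu g) r).
{ intros r Hrr. assert (Hsr : S_ g p' (r * cis (g_dir g p'))%C) by (apply sector_ray; lra).
  eapply Rle_trans. apply WB; assumption. rewrite Cmod_polar by lra.
  replace (e_k e L2 / (2 * ln (e_q e)) * ln r ^ 2) with (e_k e L2 / ln (e_q e) / 2 * ln r ^ 2)
    by (field; lra).
  fold (log_gaussian (e_k e L2 / ln (e_q e)) (g_nu g) r). fold W.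
    apply Rmult_le_compat_r; [left; apply exp_pos|]. apply Rmult_le_compat_r; unfold M0; lra. }
replace (K * M0 * W) with (K * (M0 * W)) by ring.
apply (HD (g_dir g p) (g_dir g p') (fun u => f_w2 s p u m eps) (fun u => f_w2 s p' u m eps)
          (Laplace_w1 e g s p m eps) (Laplace_w1 e g s p' m eps)); try assumption.
- unfold M0; nra.
- apply RA.
- apply RB.
- assert (Hln : ln (Cmod T) <= ln (g_rT g)).
  { apply ln_le_compat; [exact HmT|]. destruct RA as [_ Q]. unfold disc in Q. nra. }
  assert (X := gh_rT_nu Hg). assert (e_k e L2 / ln (e_q e) * ln (Cmod T)
    <= e_k e L2 / ln (e_q e) * ln (g_rT g)) by (apply Rmult_le_compat_l; lra). lra.
- intros u Hu Hur. destruct (HA m eps u HeA Hu ltac:(lra)) as [Q1 Q2]. split; [exact Q1|].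
  eapply Rle_trans; [exact Q2|]. apply Rmult_le_compat_r; unfold M0; lra.
- intros u Hu Hur. destruct (HB m eps u HeB Hu ltac:(lra)) as [Q1 Q2]. split; [exact Q1|].
  eapply Rle_trans; [exact Q2|]. apply Rmult_le_compat_r; unfold M0; lra.
- intros u Hu Hu' Hur. apply (fh_W4 Hs Hp HU); auto; (split; [assumption|unfold disc; lra]).
- intros r Hrr. symmetry. apply EA; [|exact HeA]. split. apply sector_ray; lra.
  rewrite Cmod_polar; lra.
- intros r Hrr. symmetry. apply EB; [|exact HeB]. split. apply sector_ray; lra.
  rewrite Cmod_polar; lra.
Qed.

(** From exp (y / 2) >= 1 + y / 2; the right-hand side has a bounded primitive. *)
Lemma exp_ge_quadratic y : 0 <= y -> exp (- y) <= 4 / (1 + y ^ 2).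
Proof.
intros Hy. assert (H := exp_ineq1_le (y / 2)).
assert (E : exp y = exp (y / 2) * exp (y / 2)) by (rewrite <- exp_plus; f_equal; field).
assert (1 + y ^ 2 <= 4 * exp y) by (rewrite E; nra).
rewrite exp_Ropp. assert (P := exp_pos y).
  assert (0 < 1 + y ^ 2) by (assert (X := pow2_ge_0 y); lra).
replace (4 / (1 + y ^ 2)) with (/ ((1 + y ^ 2) / 4)) by (field; lra).
apply Rinv_le_contravar; lra.
Qed.

Lemma Cmod_Fourier_kernel (z : C) (m b : R) : Rabs (snd z) < b ->
  Cmod (cexp (Ci * z * m)) <= exp (b * Rabs m).
Proof.
intros Hz. rewrite Cmod_cexp. apply exp_le_compat.
replace (fst (Ci * z * m)%C) with (- (snd z * m)) by (destruct z; simpl; ring).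
eapply Rle_trans; [apply Rle_abs|]. rewrite Rabs_Ropp, Rabs_mult.
  apply Rmult_le_compat_r; [apply Rabs_pos|lra].
Qed.

Lemma weight_le mu beta m : 0 < mu -> weight mu beta m <= exp (- beta * Rabs m).
Proof.
intros Hmu. unfold weight. rewrite <- (Rmult_1_l (exp (- beta * Rabs m))) at 2.
  apply Rmult_le_compat_r; [left; apply exp_pos|].
unfold Rpower. apply Rle_trans with (exp 0); [apply exp_le_compat|rewrite exp_0; lra].
  assert (X := Rabs_pos m).
assert (0 <= ln (1 + Rabs m)) by (rewrite <- ln_1; apply ln_le_compat; lra). nra.
Qed.

(** The weight decays like exp (- beta |m|) and the Fourier kernel grows at most like
    exp (beta' |m|) on the strip, so the integral in m converges. *)
Lemma solution_difference e g s p beta' : equation_hyps e -> geometry_hyps e g ->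
  family_hyps e g s ->
  0 < beta' < e_beta e ->
  (p < g_n g)%nat -> (exists z, U_ g p z /\ U_ g (next g p) z) ->
  exists K r1, 0 < K /\ 0 < r1 /\ forall t z eps, T_ g t -> strip beta' z -> E_ g p eps ->
    E_ g (next g p) eps ->
    (eps * t)%C <> RtoC 0 /\
    Cmod (f_u s (next g p) t z eps - f_u s p t z eps)
      <= K * theta_decay (e_k e L2 / ln (e_q e)) r1 (eps * t)%C.
Proof.
intros He Hg Hs Hb Hp HU.
destruct (inner_difference e g s p He Hg Hs Hp HU) as [K [r1 [HK [Hr1 HI]]]].
set (p' := next g p) in *. assert (Hn := gh_n Hg).
assert (Hp' : (p' < g_n g)%nat) by (apply Nat.mod_upper_bound; lia).
set (gam := e_beta e - beta'). assert (Hgam : 0 < gam) by (unfold gam; lra).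
assert (HPI := PI_RGT_0).
assert (Hlq := ln_gt_0 _ (eh_q He)). destruct (eh_k He) as [Hk1 Hk2]. 
set (c0 := (/ sqrt (2 * PI) * (e_k e L2 / ln (e_q e))%R)%C).
set (K1 := K * (4 / gam) * PI). assert (HK1 : 0 < K1).
  { unfold K1. apply Rmult_lt_0_compat; [|lra]. apply Rmult_lt_0_compat; [lra|].
  apply Rdiv_lt_0_compat; lra. }
assert (Hc0 := Cmod_ge_0 c0).
exists ((Cmod c0 + 1) * K1), r1. split; [apply Rmult_lt_0_compat; lra|]. split; [exact Hr1|].
intros t z eps Ht Hz HeA HeB.
assert (RA := gh_Rb_prod Hg Hp Ht HeA). split. { apply RA. }
assert (Hz' : strip (e_beta e) z) by (unfold strip in *; lra).
destruct (fh_repr Hs Hp Ht Hz' HeA) as [_ [XA ->]].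
  destruct (fh_repr Hs Hp' Ht Hz' HeB) as [_ [XB ->]].
fold c0. set (P := theta_decay (e_k e L2 / ln (e_q e)) r1 (eps * t)%C).
  assert (HP : 0 < P) by apply exp_pos.
match goal with |- Cmod (c0 * ?x - c0 * ?y)%C <= _ =>
  replace (c0 * x - c0 * y)%C with (c0 * (x - y))%C by ring end.
rewrite Cmod_mult, Rmult_assoc. 
apply Rle_trans with (Cmod c0 * (K1 * P));
  [|apply Rmult_le_compat_r; [apply Rmult_le_pos; lra|lra]].
apply Rmult_le_compat_l; [exact Hc0|].
unfold ex_CInt_line, ex_CInt_gen in XA, XB.
apply (RInt_gen_correct (V := C_R_CompleteNormedModule)) in XA.
apply (RInt_gen_correct (V := C_R_CompleteNormedModule)) in XB.
assert (XD := is_RInt_gen_minus _ _ _ _ XB XA).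
set (fd := fun y : R => minus (u_outer e g s p' t z eps y :
  C_R_NormedModule) (u_outer e g s p t z eps y)) in *.
assert (Hb1 : forall m, Cmod (fd m) <= K * P * (4 / (1 + (gam * m) ^ 2))).
{ intros m. change (fd m) with (u_outer e g s p' t z eps m - u_outer e g s p t z eps m)%C.
  unfold u_outer.
  match goal with |- Cmod (?x * ?ee - ?y * ?ee)%C <= _ =>
    replace (x * ee - y * ee)%C with ((x - y) * ee)%C by ring end.
  rewrite Cmod_mult. 
  assert (H1 := HI t eps m Ht HeA HeB). fold P in H1.
  assert (H2 := Cmod_Fourier_kernel z m beta' Hz).
  eapply Rle_trans. apply Rmult_le_compat; try apply Cmod_ge_0; [exact H1|exact H2].
  assert (H3 := weight_le (e_mu e) (e_beta e) m (eh_mu He)).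
  replace (K * weight (e_mu e) (e_beta e) m * P * exp (beta' * Rabs m))
    with (K * P * (weight (e_mu e) (e_beta e) m * exp (beta' * Rabs m))) by ring.
  apply Rmult_le_compat_l; [left; apply Rmult_lt_0_compat; assumption|].
  apply Rle_trans with (exp (- e_beta e * Rabs m) * exp (beta' * Rabs m)).
    apply Rmult_le_compat_r; [left; apply exp_pos|exact H3].
  rewrite <- exp_plus. replace (- e_beta e * Rabs m + beta' * Rabs m) with (- (gam * Rabs m))
    by (unfold gam; ring).
  eapply Rle_trans. apply exp_ge_quadratic. apply Rmult_le_pos; [lra|apply Rabs_pos].
  right. do 2 f_equal. rewrite !Rpow_mult_distr, pow2_abs. reflexivity. }
refine (RInt_gen_bound _ _ _ _ (K1 * P) _ _ XD _); try typeclasses eauto.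
apply (filter_prod_line (fun a b => forall v : C, is_CInt fd a b v -> Cmod v <= K1 * P)).
intros a b Hab v Hv.
set (G := fun m => K * P * (4 / gam * atan (gam * m))).
apply Rle_trans with (G b - G a).
- apply (Cmod_CInt_le_primitive fd (fun m => K * P * (4 / (1 + (gam * m) ^ 2))) G a b v);
  [lra| | |exact Hv].
  + intros m _. apply Hb1.
  + intros m _. assert (P1 : 0 < 1 + (gam * m) ^ 2) by (assert (X := pow2_ge_0 (gam * m)); lra).
    split.
    * unfold G. auto_derive; [trivial|]. field. simpl in P1. split; lra.
    * apply (ex_derive_continuous (K := R_AbsRing) (V := R_NormedModule)). auto_derive.
      simpl in P1. lra.
- unfold G. rewrite <- Rmult_minus_distr_l, <- Rmult_minus_distr_l.
  assert (B1 := atan_bound (gam * b)). assert (B2 := atan_bound (gam * a)).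
  replace (K1 * P) with (K * P * (4 / gam * PI)) by (unfold K1; ring).
  apply Rmult_le_compat_l; [left; apply Rmult_lt_0_compat; assumption|].
  apply Rmult_le_compat_l; [left; apply Rdiv_lt_0_compat; lra|lra].
Qed.

Lemma pow_exp x N : exp x ^ N = exp (INR N * x).
Proof.
induction N. simpl. rewrite Rmult_0_l, exp_0. reflexivity.
rewrite S_INR. simpl. rewrite IHN, <- exp_plus. f_equal. ring.
Qed.

Theorem proposition2 (e : equation) (g : geometry) (s : family)
    (He : equation_hyps e) (Hg : geometry_hyps e g) (Hs : family_hyps e g s)
    (beta' : R) (Hbeta' : 0 < beta' < e_beta e)
    (p : nat) (Hp : (p < g_n g)%nat)
    (HU : exists z, U_ g p z /\ U_ g (next g p) z) :
  (exists K1 K2 : R, 0 < K1 /\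
     forall t z eps : C, T_ g t -> strip beta' z -> E_ g p eps -> E_ g (next g p) eps ->
       Cmod (f_u s (next g p) t z eps - f_u s p t z eps)%C <=
         K1 * exp (- (e_k e L2 / (2 * ln (e_q e))) * ln (Cmod (eps * t)%C) ^ 2)
         * Rpower (Cmod (eps * t)%C) K2)
  /\
  (exists K1 K2 : R, 0 < K1 /\
     forall t z eps : C, T_ g t -> strip beta' z -> E_ g p eps -> E_ g (next g p) eps ->
     forall N : nat,
       Cmod (f_u s (next g p) t z eps - f_u s p t z eps)%C <=
         K1 * Rpower (e_q e) (K2 ^ 2 / (2 * e_k e L2))
         * Rpower (e_q e) (- K2 / e_k e L2) ^ N
         * Rpower (e_q e) (INR N ^ 2 / (2 * e_k e L2))
         * Cmod (eps * t)%C ^ N).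
Proof.
destruct (solution_difference e g s p beta' He Hg Hs Hbeta' Hp HU) as [K [r1 [HK [Hr1 H]]]].
assert (Hlq := ln_gt_0 _ (eh_q He)). destruct (eh_k He) as [Hk1 Hk2].
  assert (Hk : 0 < e_k e L2) by lra.
set (c := e_k e L2 / ln (e_q e)) in *.
  assert (Hc : 0 < c) by (apply Rdiv_lt_0_compat; assumption).
set (K2 := c * ln r1 + 1 / 2).
split; exists K, K2; (split; [exact HK|]).
- intros t z eps Ht Hz H1 H2. destruct (H t z eps Ht Hz H1 H2) as [_ B].
  eapply Rle_trans; [exact B|].
  rewrite Rmult_assoc. apply Rmult_le_compat_l; [lra|]. right. unfold theta_decay, Rpower.
    rewrite <- exp_plus. f_equal. fold K2. unfold c. field. lra.
- intros t z eps Ht Hz H1 H2 N. destruct (H t z eps Ht Hz H1 H2) as [H0 B].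
  eapply Rle_trans; [exact B|].
  rewrite !Rmult_assoc. apply Rmult_le_compat_l; [lra|]. unfold theta_decay, Rpower. fold K2.
  set (L := ln (Cmod (eps * t)%C)). assert (Hm : 0 < Cmod (eps * t)%C) by (apply Cmod_gt_0, H0).
  rewrite <- (exp_ln (Cmod (eps * t)%C)) by exact Hm. fold L. rewrite !pow_exp, <- !exp_plus.
    apply exp_le_compat.
  (* The square whose expansion is the difference of the two exponents. *)
  assert (X : 0 <= c / 2 * (L - (K2 - INR N) / c) ^ 2) by (apply Rmult_le_pos;
    [lra|apply pow2_ge_0]).
  assert (E : c / 2 * (L - (K2 - INR N) / c) ^ 2
    = c / 2 * L ^ 2 - (K2 - INR N) * L + (K2 - INR N) ^ 2 / (2 * c)) by (field; lra).
  match goal with |- ?l <= ?r => assert (E2 : r - l = c / 2 * (L - (K2 - INR N) / c) ^ 2) end.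
  { rewrite E. unfold c. field. lra. }
  lra.
Qed.
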